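(* Let $u,v,y\in\mathbb{C}$ with $|u|,|v|,|y|\le 1$, let $w,x\in\mathbb{C}$ with $\mathrm{Re}(w),\mathrm{Re}(x)\ge 0$, and let $\theta$ be the variable of the Laplace transform in $t$. The joint functional of the process $A(t)$ on the interval $[0,\tau_{\nu-1})$, $$G_1^*(\theta,u,v,w,x,y)=\int_{t\ge 0}e^{-\theta t}\,E\left[u^{A_{\nu-1}}v^{A_\nu}e^{-w\tau_{\nu-1}-x\Delta_\nu}y^{A(t)}\mathbf{1}_{\{t<\tau_{\nu-1}\}}\right]dt,$$ satisfies $$G_1^*(\theta,u,v,w,x,y)=\mathcal{D}_s^{M-1}\left\{B_1(B_2-B_3)\right\},$$ where $$B_1=\frac{\gamma(v,x)-\gamma(vs,x)}{\theta+\lambda g(uvs)-\lambda g(uvys)},\qquad B_2=\frac{\gamma_0(uvs,w)}{1-\gamma(uvs,w)},\qquad B_3=\frac{\gamma_0(uvys,\theta+w)}{1-\gamma(uvys,\theta+w)}.$$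
   Context: $A(t)$, $t\ge 0$, is a marked (compound) Poisson process with position-independent marking: $A(t)=\sum_{k}a_k\mathbf{1}_{\{t_k\le t\}}$, where $\{t_k\}$ are the points of a Poisson process on $\mathbb{R}_+$ of intensity $\lambda>0$ and the marks $a_k$ are i.i.d. random variables valued in $\{0,1,2,\dots\}$, independent of $\{t_k\}$, with common probability generating function $g(z)=E[z^{a_1}]$, $|z|\le 1$. The process is observed at a delayed renewal process $\{\tau_n:n=0,1,2,\dots\}$ in $\mathbb{R}_+$, independent of the filtration to which $A(t)$ is adapted. Put $\tau_{-1}=0$ and $\Delta_n=\tau_n-\tau_{n-1}$ for $n\ge 0$; $\Delta_1,\Delta_2,\dots$ have a common distribution, while $\Delta_0=\tau_0$ may have a different one. Put $A_n=A(\tau_n)$ for $n\ge 0$, $A_{-1}=0$, and $X_n=A_n-A_{n-1}$. For $|z|\le 1$, $\mathrm{Re}(\theta)\ge 0$, $$\gamma_0(z,\theta)=E\left[z^{X_0}e^{-\theta\Delta_0}\right],\qquad \gamma(z,\theta)=E\left[z^{X_1}e^{-\theta\Delta_1}\right].$$ For a fixed positive integer $M$ (the threshold), the exit index is $\nu=\inf\{n=0,1,2,\dots:A_n>M\}$, and $\tau_\nu$ is the first observed crossing time. For a complex-valued function $\varphi(s)$ analytic at $0$, $\mathcal{D}_s^k\{\varphi(s)\}=\lim_{s\to 0}\frac{1}{k!}\frac{\partial^k}{\partial s^k}\left[\frac{1}{1-s}\varphi(s)\right]$ for $k\ge 0$, and $\mathcal{D}_s^k\{\varphi(s)\}=0$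 for $k<0$.
   Formalization: The exit index is taken as ν = inf{n : A_n ≥ M} instead of inf{n : A_n > M}, since with the strict inequality the operator of order M−1 gives a false identity (order M would be needed); the Laplace variable θ is taken with Re(θ) > 0. *)

(* Defs.v *)
From HB Require Import structures.
From mathcomp Require Import all_boot all_order all_algebra.
From mathcomp Require Import complex.
From mathcomp Require Import all_classical all_reals all_analysis.

Set Implicit Arguments.
Unset Strict Implicit.
Unset Printing Implicit Defensive.

Import Order.TTheory GRing.Theory Num.Theory.
Import numFieldNormedType.Exports.

Local Open Scope classical_set_scope.
Local Open Scope complex_scope.
Local Open Scope ring_scope.

Section ComplexAnalysis.
Context {R : realType}.

Definition cexp (z : R[i]) : R[i] :=
  (expR (complex.Re z))%:C * (cos (complex.Im z) +i* sin (complex.Im z)).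

Definition cintegral d (T : measurableType d) (mu : {measure set T -> \bar R})
    (D : set T) (f : T -> R[i]) : R[i] :=
  Rintegral mu D (fun x => complex.Re (f x))
    +i* Rintegral mu D (fun x => complex.Im (f x)).

Definition cexpectation d (T : measurableType d) (P : probability T R)
    (f : T -> R[i]) : R[i] :=
  cintegral P setT f.

(* [derive1n] is taken over the field R[i], hence is the complex derivative. *)
Definition Dop (k : int) (phi : R[i] -> R[i]) : R[i] :=
  let psi : R[i]^o -> R[i]^o := fun s => (1 - s)^-1 * phi s in
  if k is Posz n then
    lim ((n`!%:R)^-1 * derive1n n psi s @[s --> (0 : R[i]^o)^'])
  else 0.

End ComplexAnalysis.

Section Independence.
Context {R : realType} d (Omega : measurableType d) (P : probability Omega R).

Definition mutually_independent (I : eqType) d' (E : measurableType d')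
    (X : I -> Omega -> E) : Prop :=
  forall (J : seq I) (B : I -> set E), uniq J ->
    (forall i, measurable (B i)) ->
    P (\big[setI/setT]_(i <- J) (X i @^-1` B i)) =
    (\prod_(i <- J) P (X i @^-1` B i))%E.

Definition identically_distributed d' (E : measurableType d')
    (X Y : Omega -> E) : Prop :=
  forall B, measurable B -> P (X @^-1` B) = P (Y @^-1` B).

Definition sigma_of (I : Type) d' (E : measurableType d')
    (X : I -> Omega -> E) : set (set Omega) :=
  <<s [set C | exists i B, measurable B /\ C = X i @^-1` B] >>.

Definition independent_families (I J : Type) d1 (E1 : measurableType d1)
    d2 (E2 : measurableType d2)
    (X : I -> Omega -> E1) (Y : J -> Omega -> E2) : Prop :=
  forall C D, sigma_of X C -> sigma_of Y D -> P (C `&` D) = (P C * P D)%E.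

End Independence.

Section MarkedPoisson.
Context {R : realType} d (Omega : measurableType d) (P : probability Omega R).

(* The marked sum over the points in [0, r]; it is finite for the locally
   finite point sequences considered below. *)
Definition marked_process (T : nat -> Omega -> R) (a : nat -> Omega -> nat)
    (r : R) (omega : Omega) : nat :=
  \sum_(k \in [set k | T k omega <= r]) a k omega.

Definition counting_process (T : nat -> Omega -> R) : R -> Omega -> nat :=
  marked_process T (fun _ _ => 1%N).

(* The case s = r is excluded in [poisson_law] because [poisson_pmf 0] is not
   the point mass at 0.  Increments use the subtraction of nat, which is not
   truncated here since the counting process is nondecreasing in time. *)
Record poisson_points (lambda : R) (T : nat -> Omega -> R) : Prop := {
  points_ge0 : forall k omega, 0 <= T k omega;
  points_ordered : forall k omega, T k omega <= T k.+1 omega;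
  points_locally_finite : forall omega, T k omega @[k --> \oo] --> +oo;
  poisson_at0 : P [set omega | counting_process T 0 omega = 0%N] = 1%E;
  poisson_law : forall (s r : R) (n : nat), 0 <= s -> s < r ->
    P [set omega |
        (counting_process T r omega - counting_process T s omega)%N = n] =
    (poisson_pmf (lambda * (r - s)) n)%:E;
  poisson_independent_increments : forall r : nat -> R,
    0 <= r 0%N -> (forall i, r i <= r i.+1) ->
    mutually_independent P (fun i omega =>
      (counting_process T (r i.+1) omega
       - counting_process T (r i) omega)%N)
}.

Record position_independent_marking (T : nat -> Omega -> R)
    (a : nat -> Omega -> nat) : Prop := {
  marks_independent : mutually_independent P a;
  marks_same_law : forall k, identically_distributed P (a k) (a 1%N);
  marks_indep_points : independent_families P a T
}.

Definition pgf (X : Omega -> nat) (z : R[i]) : R[i] :=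
  cexpectation P (fun omega => z ^+ X omega).

End MarkedPoisson.

(* x_{n-1}, with x_{-1} = x0 *)
Definition prev (V : Type) (x0 : V) (x : nat -> V) (n : nat) : V :=
  if n is m.+1 then x m else x0.

Section Observation.
Context {R : realType} d (Omega : measurableType d) (P : probability Omega R).

Definition tau_prev (tau : nat -> Omega -> R) : nat -> Omega -> R :=
  prev (fun=> 0) tau.

Definition Delta (tau : nat -> Omega -> R) (n : nat) (omega : Omega) : R :=
  tau n omega - tau_prev tau n omega.

Record delayed_renewal (tau : nat -> Omega -> R) : Prop := {
  Delta_ge0 : forall n omega, 0 <= Delta tau n omega;
  Delta_independent : mutually_independent P (Delta tau);
  Delta_same_law : forall n, (0 < n)%N ->
    identically_distributed P (Delta tau n) (Delta tau 1)
}.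

Definition A_obs (A : R -> Omega -> nat) (tau : nat -> Omega -> R)
    (n : nat) (omega : Omega) : nat :=
  A (tau n omega) omega.

Definition A_prev (A : R -> Omega -> nat) (tau : nat -> Omega -> R) :
    nat -> Omega -> nat :=
  prev (fun=> 0%N) (A_obs A tau).

Definition X_obs (A : R -> Omega -> nat) (tau : nat -> Omega -> R)
    (n : nat) (omega : Omega) : nat :=
  (A_obs A tau n omega - A_prev A tau n omega)%N.

(* E [z ^ X_n * exp (- theta Delta_n)] *)
Definition gamma_ (A : R -> Omega -> nat) (tau : nat -> Omega -> R)
    (n : nat) (z theta : R[i]) : R[i] :=
  cexpectation P (fun omega =>
    z ^+ X_obs A tau n omega * cexp (- theta * (Delta tau n omega)%:C)).

(* The level M is crossed as soon as it is reached (M <= A_n).  This is the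
   convention under which the coefficient extraction below has order M - 1:
   the coefficient of s ^ (M - 1) in (s ^ a - s ^ b) / (1 - s), with a <= b,
   is 1 if a < M <= b and 0 otherwise.  With the convention M < A_n the order
   would be M.  [None] stands for an infinite exit index. *)
Definition exit_index (M : nat) (A : nat -> nat) : option nat :=
  if pselect (exists n, (M <= A n)%N) is left h then Some (ex_minn h)
  else None.

(* The integrand counts as 0 where the exit index is infinite, which is a null
   event unless the marks or the Delta_n (n >= 1) vanish almost surely. *)
Definition G1 (M : nat) (A : R -> Omega -> nat) (tau : nat -> Omega -> R)
    (theta u v w x y : R[i]) : R[i] :=
  cintegral lebesgue_measure `[0, +oo[%classic (fun r : R =>
    cexp (- theta * r%:C) * cexpectation P (fun omega =>
      if exit_index M (A_obs A tau ^~ omega) is Some n then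
        u ^+ A_prev A tau n omega * v ^+ A_obs A tau n omega
        * cexp (- w * (tau_prev tau n omega)%:C - x * (Delta tau n omega)%:C)
        * y ^+ A r omega
        * (r < tau_prev tau n omega)%R%:R
      else 0)).

End Observation.

(* Main.v *)
From HB Require Import structures.
Require Import Defs.
From mathcomp Require Import all_boot all_order all_algebra.
From mathcomp Require Import complex.
From mathcomp Require Import all_classical all_reals all_analysis.
From mathcomp Require Import measurable_realfun.
From mathcomp Require Import ring lra.

Set Implicit Arguments.
Unset Strict Implicit.
Unset Printing Implicit Defensive.

Import Order.TTheory GRing.Theory Num.Theory.
Import numFieldNormedType.Exports.

Local Open Scope classical_set_scope.
Local Open Scope complex_scope.
Local Open Scope ring_scope.

(** Fix a small complex number s and consider the generating function of the
    functionals over the thresholds, the sum of s^k G_(k+1) over k >= 0, where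
    G_(k+1) is the functional [G1] at threshold k + 1.  The theorem says that
    this function is (1 - s)^-1 B1 (B2 - B3), read off coefficient by
    coefficient.

    Why the generating function is explicit.  Exit at index 0 contributes
    nothing, because the time window before tau_(-1) = 0 is empty.  The exit
    index at threshold k + 1 is m + 1 exactly when A_m <= k < A_(m+1), and as
    the observed values are nondecreasing, the powers s^k over these k add up
    to (s^(A_m) - s^(A_(m+1))) / (1 - s) ([geometric_window]).  Summing over
    the thresholds thus removes the exit index: what remains is a sum over m
    of integrals in which only t, tau_m, tau_(m+1) and the values of A at
    these three times occur.  Each of them can be computed ([cI_obs_term]):
    - given the observation times, the increments of A over [0, t],
      [t, tau_m] and [tau_m, tau_(m+1)] are independent, and the increment
      over an interval of length h has the generating function
      exp (- lambda (1 - g z) h) ([marked_random_increments_pgf]);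
    - the integral over t in [0, tau_m[ of the resulting exponentials is a
      difference of two exponentials of tau_m, divided by
      D = theta + lambda g(uvs) - lambda g(uvys) ([cI_exp_segment]);
    - the Delta_n are independent, so the expectation of an exponential of
      tau_m times an exponential of Delta_(m+1) is a product of the form
      L_0 L_1^m L_1' of Laplace transforms ([renewal_laplace]).
    By the same conditioning gamma_n (z, th) is the Laplace transform of
    Delta_n at th + lambda (1 - g z) ([gamma_first], [gamma_next]).  The sum
    over m therefore consists of two geometric series with the values B2 and
    B3, multiplied by B1 / (1 - s).  Their ratios have modulus less than 1
    unless X_1 = 0 almost surely, and in that case B1 = 0
    ([gamma_dichotomy]).

    The Poisson law of the increments of the counting process enters through its
    probability generating function, which is identified by multiplicativity
    in time and a first-order expansion at time 0 ([count_pgfE]).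

    Why coefficients can be read off.  All sums over thresholds and over m are
    kept finite, with explicit error bounds: truncation at K thresholds costs
    at most 2 |s|^K / Re theta, uniformly in the truncation of m
    ([cabs_generating_function_tail]).  A function with such an asymptotic
    expansion, uniform on a disc and with geometrically bounded coefficients,
    is differentiable in the complex sense with a derivative of the same kind
    ([power_expansion_derive1]), so its k-th derivative at 0 is k! times the
    k-th coefficient ([Dop_power_expansion]).

    Names: [cabs] is the modulus, [cmeas], [bmeas] and [cintble] stand for
    measurable, bounded measurable and integrable complex-valued functions,
    and cI and cE in the name of a lemma stand for [cintegral] over a general
    measure and over a probability. *)

(** * The modulus of a complex number as a real number *)

Section Modulus.
Context {R : realType}.
Implicit Types z w : R[i].

Definition cabs (z : R[i]) : R := complex.Re `|z|.

Lemma cabsE z : `|z| = (cabs z)%:C.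
Proof. by rewrite /cabs RRe_real // normr_real. Qed.

Lemma cabs_ge0 z : 0 <= cabs z.
Proof. by rewrite -ler0c -cabsE normr_ge0. Qed.

Lemma cabsM z w : cabs (z * w) = cabs z * cabs w.
Proof. by apply: complexI; rewrite rmorphM /= -!cabsE normrM. Qed.

Lemma cabsX z n : cabs (z ^+ n) = cabs z ^+ n.
Proof. by apply: complexI; rewrite rmorphXn /= -!cabsE normrX. Qed.

Lemma cabsD z w : cabs (z + w) <= cabs z + cabs w.
Proof. by rewrite -lecR rmorphD /= -!cabsE ler_normD. Qed.

Lemma cabsN z : cabs (- z) = cabs z.
Proof. by apply: complexI; rewrite -!cabsE normrN. Qed.

Lemma cabsB z w : cabs (z - w) <= cabs z + cabs w.
Proof. by rewrite -[cabs w]cabsN cabsD. Qed.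

Lemma cabsBC z w : cabs (z - w) = cabs (w - z).
Proof. by rewrite -cabsN opprB. Qed.

Lemma cabs0 : cabs 0 = 0 :> R.
Proof. by rewrite /cabs normr0. Qed.

Lemma cabs1 : cabs 1 = 1 :> R.
Proof. by rewrite /cabs normr1. Qed.

Lemma cabs_eq0 z : (cabs z == 0) = (z == 0).
Proof. by rewrite -(inj_eq (@complexI R)) -cabsE normr_eq0. Qed.

Lemma cabs_gt0 z : (0 < cabs z) = (z != 0).
Proof. by rewrite lt_neqAle cabs_ge0 andbT eq_sym cabs_eq0. Qed.

Lemma cabsV z : cabs z^-1 = (cabs z)^-1.
Proof. by apply: complexI; rewrite fmorphV /= -!cabsE normfV. Qed.

Lemma cabs_real (r : R) : cabs r%:C = `|r|.
Proof. by rewrite /cabs normc_def /= expr0n addr0 sqrtr_sqr. Qed.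

Lemma cabs_nat n : cabs n%:R = n%:R :> R.
Proof. by apply: complexI; rewrite -cabsE normr_nat rmorph_nat. Qed.

Lemma cabs_sum n (F : 'I_n -> R[i]) :
  cabs (\sum_(i < n) F i) <= \sum_(i < n) cabs (F i).
Proof.
rewrite -lecR -cabsE rmorph_sum /=; under [leRHS]eq_bigr do rewrite -cabsE.
exact: ler_norm_sum.
Qed.

Lemma cabs_sum_le n (F : 'I_n -> R[i]) (h : 'I_n -> R) : (forall i, cabs (F i) <= h i) ->
  cabs (\sum_(i < n) F i) <= \sum_(i < n) h i.
Proof. by move=> Fh; apply: (le_trans (cabs_sum _)); exact: ler_sum. Qed.

Lemma Re_le_cabs z : `|complex.Re z| <= cabs z.
Proof. by rewrite -lecR -cabsE normc_ge_Re. Qed.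

Lemma Im_le_cabs z : `|complex.Im z| <= cabs z.
Proof.
by have := Re_le_cabs (z * 'i); rewrite ReiNIm normrN cabsM [X in _ * X]/cabs normc_def /= expr0n expr1n add0r sqrtr1 mulr1.
Qed.

Lemma cabs_le_ReIm z : cabs z <= `|complex.Re z| + `|complex.Im z|.
Proof.
rewrite [z in cabs z]complexE (le_trans (cabsD _ _)) // cabsM !cabs_real.
by rewrite [X in _ + X * _]/cabs normc_def /= expr0n expr1n add0r sqrtr1 mul1r.
Qed.

(** Identities between limits are proved by this criterion, which asks for
    approximations only and so avoids the topology of [R[i]]. *)
Lemma cabs_eq_le z w : (forall e, 0 < e -> cabs (z - w) <= e) -> z = w.
Proof.
move=> H; apply/eqP; rewrite -subr_eq0 -cabs_eq0; apply/negPn/negP => h.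
have h0 : 0 < cabs (z - w) by rewrite lt_neqAle eq_sym h cabs_ge0.
have := H (cabs (z - w) / 2); rewrite divr_gt0 // => /(_ isT); lra.
Qed.

Lemma complex_ext z w : complex.Re z = complex.Re w -> complex.Im z = complex.Im w -> z = w.
Proof. by case: z w => [a b] [c e] /= -> ->. Qed.

Lemma Re_add z w : complex.Re (z + w) = complex.Re z + complex.Re w.
Proof. by case: z w => [a b] [c e]. Qed.
Lemma Im_add z w : complex.Im (z + w) = complex.Im z + complex.Im w.
Proof. by case: z w => [a b] [c e]. Qed.
Lemma Re_opp z : complex.Re (- z) = - complex.Re z.
Proof. by case: z. Qed.
Lemma Im_opp z : complex.Im (- z) = - complex.Im z.
Proof. by case: z. Qed.
Lemma Re_mul z w : complex.Re (z * w) = complex.Re z * complex.Re w - complex.Im z * complex.Im w.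
Proof. by case: z w => [a b] [c e]. Qed.
Lemma Im_mul z w : complex.Im (z * w) = complex.Re z * complex.Im w + complex.Im z * complex.Re w.
Proof. by case: z w => [a b] [c e]. Qed.

End Modulus.

(** * Power series in a complex variable *)

Section PowerSeries.
Context {R : realType}.

(** A power series expansion at 0 without an infinite sum: the partial sums
    approximate [f] with a geometric error on the disc of radius [1 / (4 K)].
    The factor 4 leaves room for the doubling of [K] in each derivative. *)
Definition power_expansion (f : R[i] -> R[i]) (c : nat -> R[i]) :=
  exists C K : R, [/\ 0 <= C, 0 < K, forall k, cabs (c k) <= C * K ^+ k &
    forall s, cabs s * K <= 1 / 4 -> forall N,
      cabs (f s - \sum_(k < N) c k * s ^+ k) <= C * (K * cabs s) ^+ N].

Lemma geometric_sum_le (q : R) N : 0 <= q -> q <= 1 / 2 ->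
  \sum_(k < N) q ^+ k <= 2.
Proof.
move=> q0 q1.
have : (1 - q) * \sum_(k < N) q ^+ k <= 1.
  by rewrite -opprB mulNr -subrX1 opprB lerBlDr lerDl exprn_ge0.
have := @sumr_ge0 R _ (index_enum 'I_N) xpredT (fun k => q ^+ k) (fun i _ => exprn_ge0 i q0).
by nra.
Qed.

(** The partial sums lowered and raised by the error bound are a nondecreasing
    and a nonincreasing sequence; this is where [q <= 1 / 2] is needed.  The
    sum of the series is the supremum of the lower sequence. *)
Lemma geometric_series_real (a : nat -> R) (C q : R) : 0 <= C -> 0 <= q -> q <= 1 / 2 ->
  (forall k, `|a k| <= C * q ^+ k) ->
  exists l, forall N, `|l - \sum_(k < N) a k| <= 2 * C * q ^+ N.
Proof.
move=> C0 q0 q1 Ha.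
pose lo N := \sum_(k < N) a k - 2 * C * q ^+ N.
pose up N := \sum_(k < N) a k + 2 * C * q ^+ N.
have step N : lo N <= lo N.+1 /\ up N.+1 <= up N.
  rewrite /lo /up !big_ord_recr /= exprS.
  have := Ha N; rewrite ler_norml => /andP[h1 h2].
  have : 0 <= C * q ^+ N by rewrite mulr_ge0 ?exprn_ge0.
  move: h1 h2; set b := a N; set S := \sum_(_ < _) _.
  have -> : 2 * C * (q * q ^+ N) = 2 * q * (C * q ^+ N) by ring.
  rewrite -[2 * C * _]mulrA; set t := C * _ => h1 h2 t0.
  by split; nra.
have lom : {homo lo : n m / (n <= m)%N >-> n <= m}.
  by apply: homo_leq => [x//|x y z|n]; [exact: le_trans|case: (step n)].
have upm : {homo up : n m / (n <= m)%N >-> n >= m}.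
  by apply: homo_leq => [x//|x y z /= h1 h2|n]; [exact: le_trans h2 h1|case: (step n)].
have lu n m : lo n <= up m.
  apply: (le_trans (lom _ _ (leq_maxl n m))).
  apply: (le_trans _ (upm _ _ (leq_maxr n m))).
  by rewrite /lo /up lerD2l ge0_cp ?mulr_ge0 // exprn_ge0.
have ne : range lo !=set0 by exists (lo 0%N); exists 0%N.
exists (sup (range lo)) => N.
have h1 : lo N <= sup (range lo).
  by apply: ub_le_sup; [exists (up 0%N) => _ [n _ <-]; exact: lu|exists N].
have h2 : sup (range lo) <= up N.
  by apply: ge_sup => // _ [n _ <-]; exact: lu.
by move: h1 h2; rewrite /lo /up ler_norml; set S := \sum_(_ < _) _; set t := _ * q ^+ N; set l := sup _; move=> h1 h2; apply/andP; split; lra.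
Qed.

Lemma Re_sum n (F : 'I_n -> R[i]) : complex.Re (\sum_(i < n) F i) = \sum_(i < n) complex.Re (F i).
Proof. by elim/big_rec2: _ => // i x y _ <-; rewrite Re_add. Qed.
Lemma Im_sum n (F : 'I_n -> R[i]) : complex.Im (\sum_(i < n) F i) = \sum_(i < n) complex.Im (F i).
Proof. by elim/big_rec2: _ => // i x y _ <-; rewrite Im_add. Qed.

Lemma geometric_series (a : nat -> R[i]) (C q : R) : 0 <= C -> 0 <= q -> q <= 1 / 2 ->
  (forall k, cabs (a k) <= C * q ^+ k) ->
  exists l, forall N, cabs (l - \sum_(k < N) a k) <= 4 * C * q ^+ N.
Proof.
move=> C0 q0 q1 Ha.
have [|l1 H1] := @geometric_series_real (fun k => complex.Re (a k)) C q C0 q0 q1.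
  by move=> k; exact: le_trans (Re_le_cabs _) (Ha k).
have [|l2 H2] := @geometric_series_real (fun k => complex.Im (a k)) C q C0 q0 q1.
  by move=> k; exact: le_trans (Im_le_cabs _) (Ha k).
exists (l1 +i* l2) => N; apply: (le_trans (cabs_le_ReIm _)).
rewrite Re_add Im_add Re_opp Im_opp Re_sum Im_sum /=.
by have := H1 N; have := H2 N; lra.
Qed.

(** The second-order Taylor bound for powers, multiplied by [r ^+ 2] so that no
    division occurs.  The factor [2 ^+ k] absorbs the number of terms. *)
Lemma taylor2_expn (s h : R[i]) (r : R) k : cabs s <= r -> cabs (s + h) <= r ->
  cabs ((s + h) ^+ k - s ^+ k - h * (k%:R * s ^+ k.-1)) * r ^+ 2
    <= cabs h ^+ 2 * (2 * r) ^+ k.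
Proof.
move=> sr shr; have r0 : 0 <= r by exact: le_trans (cabs_ge0 _) sr.
elim: k => [|k IH].
  by rewrite !expr0 subrr mul0r mulr0 subr0 cabs0 mul0r mulr1 exprn_ge0 ?cabs_ge0.
have -> : (s + h) ^+ k.+1 - s ^+ k.+1 - h * (k.+1%:R * s ^+ k) =
   (s + h) * ((s + h) ^+ k - s ^+ k - h * (k%:R * s ^+ k.-1)) + h ^+ 2 * (k%:R * s ^+ k.-1).
  case: k {IH} => [|k]; first by rewrite !expr0 !expr1 /=; ring.
  by rewrite /= !exprS -[k.+2]addn1 -[k.+1]addn1 !natrD; ring.
apply: (@le_trans _ _ ((r * cabs ((s + h) ^+ k - s ^+ k - h * (k%:R * s ^+ k.-1))
   + cabs h ^+ 2 * (k%:R * cabs s ^+ k.-1)) * r ^+ 2)).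
  rewrite ler_wpM2r ?exprn_ge0 // (le_trans (cabsD _ _)) // !cabsM !cabsX cabs_nat expr2 lerD2r.
  by rewrite ler_wpM2r ?cabs_ge0.
rewrite mulrDl -mulrA.
have h1 : r * (cabs ((s + h) ^+ k - s ^+ k - h * (k%:R * s ^+ k.-1)) * r ^+ 2)
   <= r * (cabs h ^+ 2 * (2 * r) ^+ k) by rewrite ler_wpM2l.
have h2 : k%:R * cabs s ^+ k.-1 * r ^+ 2 <= r * (2 * r) ^+ k.
  case: k {IH h1} => [|k]; first by rewrite !mul0r mulr_ge0 ?exprn_ge0 ?mulr_ge0.
  rewrite /= -mulrA exprMn [leRHS]mulrCA ler_pM ?mulr_ge0 ?exprn_ge0 ?cabs_ge0 //.
    by rewrite -natrX ler_nat ltnW // ltn_expl.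
  by rewrite -exprS -[k.+2]addn2 exprD ler_wpM2r ?exprn_ge0 // lerXn2r // ?nnegrE ?cabs_ge0.
have -> : cabs h ^+ 2 * (2 * r) ^+ k.+1 =
   r * (cabs h ^+ 2 * (2 * r) ^+ k) + cabs h ^+ 2 * (r * (2 * r) ^+ k).
  by rewrite [(2 * r) ^+ k.+1]exprS; ring.
by rewrite lerD // -mulrA ler_wpM2l // exprn_ge0 ?cabs_ge0.
Qed.

(** Passage to the limit in the truncation order [N] of an inequality. *)
Lemma le_geometric_error (x B E q : R) : 0 <= E -> 0 <= q -> q <= 1 / 2 ->
  (forall N, x <= B + E * q ^+ N) -> x <= B.
Proof.
move=> E0 q0 q1 H; apply/ler_addgt0Pr => e e0.
pose N := Num.bound (E / e).
have hN : E / e < N%:R by apply: archi_boundP; rewrite divr_ge0 // ltW.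
apply: (le_trans (H N)); rewrite lerD2l.
have h2 : q ^+ N * N%:R <= 1.
  apply: (@le_trans _ _ (q ^+ N * 2 ^+ N)).
    by rewrite ler_wpM2l ?exprn_ge0 // -natrX ler_nat ltnW // ltn_expl.
  by rewrite -exprMn exprn_ile1 //; [rewrite mulr_ge0|lra].
have : E <= N%:R * e by rewrite -ler_pdivrMr // ltW.
have := exprn_ge0 N q0; move: h2; set u := q ^+ N; set n := N%:R => h2 h3 h4.
apply: (@le_trans _ _ (n * e * u)); first by rewrite ler_wpM2r.
by have : (u * n) * e <= 1 * e; [rewrite ler_wpM2r // ltW|lra].
Qed.

(** The candidate [g] for the derivative is the sum of the differentiated
    series.  The difference quotient at [s] is compared with [g] through the
    partial sums of order [N]: the Taylor remainders of the monomials add up to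
    [O(h ^ 2)] uniformly in [N], and the truncation errors vanish as [N] grows,
    for fixed [h]. *)
Lemma power_expansion_derive1 (f : R[i]^o -> R[i]^o) (c : nat -> R[i]) :
  power_expansion f c -> power_expansion (derive1 f) (fun k => k.+1%:R * c k.+1).
Proof.
move=> [C [K [C0 K0 cC fC]]].
pose b k : R[i] := k.+1%:R * c k.+1.
have bC k : cabs (b k) <= C * K * (2 * K) ^+ k.
  rewrite /b cabsM cabs_nat exprMn.
  have h1 : k.+1%:R <= 2 ^+ k :> R by rewrite -natrX ler_nat ltn_expl.
  have -> : C * K * (2 ^+ k * K ^+ k) = 2 ^+ k * (C * K ^+ k.+1) by rewrite exprS; ring.
  by rewrite ler_pM ?cabs_ge0.
have CK0 : 0 <= C * K by rewrite mulr_ge0 // ltW.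
exists (4 * (C * K)), (2 * K); split => //; first by rewrite mulr_ge0.
- by rewrite mulr_gt0.
- by move=> k; apply: (le_trans (bC k)); rewrite ler_wpM2r ?exprn_ge0 ?mulr_ge0 ?(ltW K0) //; lra.
move=> s sK.
have sK2 : 2 * K * cabs s <= 1 / 2 by move: sK; lra.
have K20 : 0 <= 2 * K * cabs s by rewrite !mulr_ge0 ?cabs_ge0 // ltW.
have [|g gH] := @geometric_series (fun k => b k * s ^+ k) (C * K) (2 * K * cabs s) CK0 K20 sK2.
  by move=> k; rewrite cabsM cabsX exprMn mulrA ler_wpM2r ?exprn_ge0 ?cabs_ge0.
suff -> : derive1 f s = g by exact: gH.
(* [r] is the radius of the disc on which [f] is controlled; [s] lies in its
   half, which leaves room for the increments [h]. *)
pose r := (4 * K)^-1.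
have r0 : 0 < r by rewrite invr_gt0 mulr_gt0.
have rK : r * K = 1 / 4 by rewrite /r; field; lra.
have sr : cabs s <= r / 2.
  by rewrite -(ler_pM2r K0); move: sK rK; lra.
have main h : cabs h <= r / 2 ->
    cabs (f (h + s) - f s - h * g) * r ^+ 2 <= 2 * C * cabs h ^+ 2.
  move=> hr.
  have shr : cabs (s + h) <= r by rewrite (le_trans (cabsD _ _)) //; lra.
  have sr' : cabs s <= r by lra.
  have r20 : 0 < r ^+ 2 by rewrite exprn_gt0.
  apply: (@le_geometric_error _ _ ((C + C + cabs h * (4 * (C * K))) * r ^+ 2) (1 / 2)); [|lra|lra|].
    by rewrite mulr_ge0 ?(ltW r20) // !addr_ge0 // !mulr_ge0 ?cabs_ge0 // ltW.
  move=> N.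
  pose D k := (s + h) ^+ k - s ^+ k - h * (k%:R * s ^+ k.-1).
  (* [N.+1] terms of [f] correspond to [N] terms of its derivative. *)
  have shE : h + s = s + h by rewrite addrC.
  have -> : f (h + s) - f s - h * g =
     (f (s + h) - \sum_(k < N.+1) c k * (s + h) ^+ k)
     - (f s - \sum_(k < N.+1) c k * s ^+ k)
     - h * (g - \sum_(k < N) b k * s ^+ k)
     + \sum_(k < N.+1) c k * D k.
    have -> : \sum_(k < N) b k * s ^+ k = \sum_(k < N.+1) c k * (k%:R * s ^+ k.-1).
      rewrite big_ord_recl /= mul0r mulr0 add0r; apply: eq_bigr => i _.
      by rewrite /b /bump /= add1n mulrCA mulrA.
    have -> : \sum_(k < N.+1) c k * D k = \sum_(k < N.+1) c k * (s + h) ^+ k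
       - \sum_(k < N.+1) c k * s ^+ k - h * \sum_(k < N.+1) c k * (k%:R * s ^+ k.-1).
      rewrite mulr_sumr -!sumrB; apply: eq_bigr => i _; rewrite /D; ring.
    by rewrite shE; ring.
  have e1 : cabs (f (s + h) - \sum_(k < N.+1) c k * (s + h) ^+ k) <= C * (1 / 2) ^+ N.
    have q1 : K * cabs (s + h) <= 1 / 4 by rewrite -rK mulrC ler_wpM2r // ltW.
    have q0 : 0 <= K * cabs (s + h) by rewrite mulr_ge0 ?cabs_ge0 // ltW.
    apply: (le_trans (fC _ _ N.+1)); first by rewrite mulrC.
    rewrite ler_wpM2l // exprS.
    apply: (@le_trans _ _ (1 * (K * cabs (s + h)) ^+ N)); first by rewrite ler_wpM2r ?exprn_ge0 //; lra.
    by rewrite mul1r lerXn2r // ?nnegrE; lra.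
  have e2 : cabs (f s - \sum_(k < N.+1) c k * s ^+ k) <= C * (1 / 2) ^+ N.
    have q1 : K * cabs s <= 1 / 4 by rewrite -rK mulrC ler_wpM2r // ltW.
    have q0 : 0 <= K * cabs s by rewrite mulr_ge0 ?cabs_ge0 // ltW.
    apply: (le_trans (fC _ _ N.+1)); first by rewrite mulrC.
    rewrite ler_wpM2l // exprS.
    apply: (@le_trans _ _ (1 * (K * cabs s) ^+ N)); first by rewrite ler_wpM2r ?exprn_ge0 //; lra.
    by rewrite mul1r lerXn2r // ?nnegrE; lra.
  have e3 : cabs (h * (g - \sum_(k < N) b k * s ^+ k)) <= cabs h * (4 * (C * K)) * (1 / 2) ^+ N.
    rewrite cabsM -mulrA ler_wpM2l ?cabs_ge0 //; apply: (le_trans (gH N)).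
    by rewrite ler_wpM2l ?mulr_ge0 // ?(ltW K0) // lerXn2r // nnegrE; lra.
  have e4 : cabs (\sum_(k < N.+1) c k * D k) * r ^+ 2 <= 2 * C * cabs h ^+ 2.
    apply: (@le_trans _ _ (\sum_(k < N.+1) C * cabs h ^+ 2 * (1 / 2) ^+ k)).
      apply: (le_trans (ler_wpM2r (ltW r20) (cabs_sum _))); rewrite mulr_suml; apply: ler_sum => k _.
      rewrite cabsM -[_ * cabs (D k) * _]mulrA.
      have := taylor2_expn k sr' shr; rewrite -/(D k) => Dk.
      apply: (@le_trans _ _ (C * K ^+ k * (cabs h ^+ 2 * (2 * r) ^+ k))).
        by rewrite ler_pM // ?mulr_ge0 ?exprn_ge0 ?cabs_ge0 // ltW.
      rewrite le_eqVlt; apply/orP; left; apply/eqP.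
      have -> : (1 / 2 : R) = K * (2 * r) by move: rK; lra.
      by rewrite [(K * _) ^+ k]exprMn; ring.
    rewrite -mulr_sumr.
    have -> : 2 * C * cabs h ^+ 2 = C * cabs h ^+ 2 * 2 by ring.
    by rewrite ler_wpM2l ?mulr_ge0 ?exprn_ge0 ?cabs_ge0 // geometric_sum_le //; lra.
  apply: (le_trans (ler_wpM2r (ltW r20) (cabsD _ _))); rewrite mulrDl addrC; apply: lerD => //.
  rewrite [leRHS]mulrAC ler_wpM2r ?(ltW r20) //.
  apply: (le_trans (cabsB _ _)); rewrite mulrDl; apply: lerD => //.
  apply: (le_trans (cabsB _ _)); rewrite mulrDl; exact: lerD.
rewrite /derive1; apply/(@cvg_lim (R[i]^o)); first exact: norm_hausdorff.
apply/cvgrPdist_le => e e0.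
have eE : e = (complex.Re e)%:C by rewrite RRe_real // gtr0_real.
have e0' : 0 < complex.Re e by rewrite -ltcR -eE.
pose eta : R := Num.min (r / 2) (complex.Re e * r ^+ 2 / (2 * C + 1)).
have eta0 : 0 < eta.
  by rewrite lt_min divr_gt0 //= divr_gt0 ?mulr_gt0 ?exprn_gt0 //; lra.
near=> h.
have h0 : h != 0 by near: h; exact: nbhs_dnbhs_neq.
have heta : cabs h < eta.
  rewrite -ltcR -cabsE; near: h; apply: dnbhs0_lt; by rewrite ltcR.
move: heta; rewrite lt_min => /andP[h1 h2].
have := main h (ltW h1) => M.
rewrite eE cabsE lecR.
have hp : 0 < cabs h by rewrite cabs_gt0.
have -> : g - h^-1 *: (f (h + s) - f s) = - (h^-1 * (f (h + s) - f s - h * g)).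
  by rewrite /GRing.scale /=; field.
rewrite cabsN cabsM cabsV mulrC ler_pdivrMr //.
move: h2; rewrite ltr_pdivlMr; last by lra.
move=> h2; rewrite -(ler_pM2r (exprn_gt0 2 r0)); apply: (le_trans M).
rewrite -[2 * C * _]mulrA expr2.
have : cabs h * (cabs h * (2 * C + 1)) <= cabs h * (complex.Re e * r ^+ 2) by rewrite ler_wpM2l ?(ltW hp) ?(ltW h2).
have : 0 <= cabs h * cabs h by rewrite mulr_ge0 // ltW.
by set t := r ^+ 2; lra.
Unshelve. all: by end_near.
Qed.

Lemma power_expansion_derive1n (f : R[i]^o -> R[i]^o) (c : nat -> R[i]) n :
  power_expansion f c -> exists2 c', power_expansion (derive1n n f) c' & c' 0%N = n`!%:R * c n.
Proof.
elim: n f c => [|n IH] f c fc.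
  by exists c => //; rewrite fact0 mul1r.
have [c' fc' c'0] := IH _ _ (power_expansion_derive1 fc).
by exists c'; rewrite ?derive1Sn // c'0 mulrA -natrM mulnC -factS.
Qed.

Lemma power_expansion_cvg0 (f : R[i]^o -> R[i]^o) (c : nat -> R[i]) : power_expansion f c ->
  f s @[s --> (0 : R[i]^o)^'] --> (c 0%N : R[i]^o).
Proof.
move=> [C [K [C0 K0 cC fC]]]; apply/cvgrPdist_le => e e0.
have eE : e = (complex.Re e)%:C by rewrite RRe_real // gtr0_real.
have e0' : 0 < complex.Re e by rewrite -ltcR -eE.
pose eta : R := Num.min (1 / 4 / K) (complex.Re e / K / (C + 1)).
have eta0 : 0 < eta by rewrite lt_min !divr_gt0 //=; lra.
near=> h.
have heta : cabs h < eta.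
  rewrite -ltcR -cabsE; near: h; apply: dnbhs0_lt; by rewrite ltcR.
move: heta; rewrite lt_min !ltr_pdivlMr //; last by lra.
move=> /andP[h1 h2].
rewrite eE cabsE lecR -cabsN opprB.
have hK : cabs h * K <= 1 / 4 by lra.
have := fC h hK 1%N; rewrite big_ord1 expr0 mulr1 expr1 => /le_trans; apply.
have : 0 <= cabs h * K by rewrite mulr_ge0 ?cabs_ge0 // ltW.
lra.
Unshelve. all: by end_near.
Qed.

(** [Dop] is defined by a limit at 0 of the iterated derivative, not by its value
    at 0; both agree since the derivative again has an expansion. *)
Lemma Dop_power_expansion (phi : R[i] -> R[i]) (c : nat -> R[i]) (n : nat) :
  power_expansion (fun s => (1 - s)^-1 * phi s) c -> Dop n%:Z phi = c n.
Proof.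
move=> pc; rewrite /Dop; apply/(@cvg_lim (R[i]^o)); first exact: norm_hausdorff.
have [c' fc' c'0] := power_expansion_derive1n n pc.
have -> : c n = (n`!%:R)^-1 * c' 0%N.
  by rewrite c'0 mulrA mulVf ?mul1r // pnatr_eq0 -lt0n fact_gt0.
by apply: cvgMr; exact: power_expansion_cvg0.
Qed.

End PowerSeries.

(** * The complex exponential *)

Section ComplexExp.
Context {R : realType}.
Implicit Types z w : R[i].

Lemma cexpD z w : cexp (z + w) = cexp z * cexp w.
Proof.
rewrite /cexp Re_add Im_add expRD cosD sinD; apply: complex_ext; rewrite ?Re_mul ?Im_mul /=; ring.
Qed.

Lemma cexp0 : cexp (0 : R[i]) = 1.
Proof. by rewrite /cexp /= expR0 cos0 sin0 mul1r. Qed.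

Lemma cabs_cexp z : cabs (cexp z) = expR (complex.Re z).
Proof.
rewrite /cexp cabsM cabs_real ger0_norm ?expR_ge0 //.
by rewrite [X in _ * X]/cabs normc_def /= cos2Dsin2 sqrtr1 mulr1.
Qed.

Lemma cabs_cexp_le1 z : complex.Re z <= 0 -> cabs (cexp z) <= 1.
Proof. by move=> z0; rewrite cabs_cexp -expR0 ler_expR. Qed.

Lemma cexpMn z n : cexp (n%:R * z) = cexp z ^+ n.
Proof.
elim: n => [|n IH]; first by rewrite mul0r cexp0.
by rewrite -addn1 natrD mulrDl mul1r cexpD IH exprD.
Qed.

Lemma cexp_sum n (F : 'I_n -> R[i]) : cexp (\sum_(i < n) F i) = \prod_(i < n) cexp (F i).
Proof. by elim/big_rec2: _ => [|i x y _ <-]; rewrite ?cexp0 // cexpD. Qed.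

Lemma cabsX_le1 z n : cabs z <= 1 -> cabs (z ^+ n) <= 1.
Proof. by move=> z1; rewrite cabsX exprn_ile1 // cabs_ge0. Qed.

Lemma cabsM_le1 z w : cabs z <= 1 -> cabs w <= 1 -> cabs (z * w) <= 1.
Proof. by move=> z1 w1; rewrite cabsM mulr_ile1 // cabs_ge0. Qed.

End ComplexExp.

(** * Complex-valued measurable functions *)

Section CMeasurable.
Context d (T : measurableType d) (R : realType).
Implicit Types f g : T -> R[i].

(** [R[i]] carries no sigma-algebra, so measurability is required of the two
    coordinates, in accordance with the definition of [cintegral]. *)
Definition cmeas f :=
  measurable_fun setT (fun x => complex.Re (f x)) /\
  measurable_fun setT (fun x => complex.Im (f x)).

Lemma cmeas_cst (z : R[i]) : cmeas (fun=> z).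
Proof. by split; exact: measurable_cst. Qed.

Lemma cmeasD f g : cmeas f -> cmeas g -> cmeas (fun x => f x + g x).
Proof.
move=> [f1 f2] [g1 g2]; split.
  by under eq_fun do rewrite Re_add; exact: measurable_funD.
by under eq_fun do rewrite Im_add; exact: measurable_funD.
Qed.

Lemma cmeasN f : cmeas f -> cmeas (fun x => - f x).
Proof.
move=> [f1 f2]; split.
  by under eq_fun do rewrite Re_opp; exact: measurable_funN.
by under eq_fun do rewrite Im_opp; exact: measurable_funN.
Qed.

Lemma cmeasB f g : cmeas f -> cmeas g -> cmeas (fun x => f x - g x).
Proof. by move=> mf mg; apply: cmeasD => //; exact: cmeasN. Qed.

Lemma cmeasM f g : cmeas f -> cmeas g -> cmeas (fun x => f x * g x).
Proof.
move=> [f1 f2] [g1 g2]; split.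
  by under eq_fun do rewrite Re_mul; apply: measurable_funB; exact: measurable_funM.
by under eq_fun do rewrite Im_mul; apply: measurable_funD; exact: measurable_funM.
Qed.

Lemma cmeas_sum n (F : 'I_n -> T -> R[i]) : (forall i, cmeas (F i)) ->
  cmeas (fun x => \sum_(i < n) F i x).
Proof.
elim: n F => [|n IH] F mF.
  by under eq_fun do rewrite big_ord0; exact: cmeas_cst.
under eq_fun do rewrite big_ord_recr /=.
by apply: cmeasD => //; exact: IH.
Qed.

Lemma cmeas_real (r : T -> R) : measurable_fun setT r -> cmeas (fun x => (r x)%:C).
Proof. by move=> mr; split => //; exact: measurable_cst. Qed.

Lemma cmeas_cexp f : cmeas f -> cmeas (fun x => cexp (f x)).
Proof.
move=> [f1 f2]; apply: cmeasM.
  by apply: cmeas_real; exact: measurableT_comp.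
split => /=.
  by apply: (measurableT_comp _ f2); apply: continuous_measurable_fun; exact: continuous_cos.
by apply: (measurableT_comp _ f2); apply: continuous_measurable_fun; exact: continuous_sin.
Qed.

Lemma cmeas_nat (F : nat -> R[i]) (X : T -> nat) : measurable_fun setT X ->
  cmeas (fun x => F (X x)).
Proof.
move=> mX; split.
  exact: (@measurableT_comp _ _ _ _ _ _ (fun n => complex.Re (F n)) _ X).
exact: (@measurableT_comp _ _ _ _ _ _ (fun n => complex.Im (F n)) _ X).
Qed.

Lemma cmeas_bool (b : T -> bool) : measurable_fun setT b ->
  cmeas (fun x => (b x)%:R).
Proof.
move=> mb; split.
  exact: (@measurableT_comp _ _ _ _ _ _ (fun c : bool => complex.Re (c%:R : R[i])) _ b).
exact: (@measurableT_comp _ _ _ _ _ _ (fun c : bool => complex.Im (c%:R : R[i])) _ b).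
Qed.

End CMeasurable.

Lemma cmeas_comp d d' (T : measurableType d) (T' : measurableType d') (R : realType)
  (f : T' -> R[i]) (g : T -> T') : measurable_fun setT g -> cmeas f ->
  cmeas (fun x => f (g x)).
Proof.
move=> mg [f1 f2]; split.
  exact: (measurableT_comp f1 mg).
exact: (measurableT_comp f2 mg).
Qed.

(** * Integration of complex-valued functions *)

Section CIntegral.
Context d (T : measurableType d) (R : realType) (mu : {measure set T -> \bar R}).
Implicit Types f g : T -> R[i].

Definition cintble f :=
  mu.-integrable setT (EFin \o (fun x => complex.Re (f x))) /\
  mu.-integrable setT (EFin \o (fun x => complex.Im (f x))).

Local Notation cI := (cintegral mu setT).

Lemma cintble_cmeas f : cintble f -> cmeas f.
Proof.
by move=> [f1 f2]; split; apply/measurable_EFinP; [exact: measurable_int f1|exact: measurable_int f2].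
Qed.

Lemma cintble_le f (h : T -> R) : cmeas f -> mu.-integrable setT (EFin \o h) ->
  (forall x, cabs (f x) <= h x) -> cintble f.
Proof.
move=> [f1 f2] ih fh; split.
  apply: le_integrable ih => //; first exact/measurable_EFinP.
  move=> x _ /=; rewrite lee_fin; apply: (le_trans (Re_le_cabs _)).
  by apply: (le_trans (fh x)); exact: ler_norm.
apply: le_integrable ih => //; first exact/measurable_EFinP.
move=> x _ /=; rewrite lee_fin; apply: (le_trans (Im_le_cabs _)).
by apply: (le_trans (fh x)); exact: ler_norm.
Qed.

Lemma measurable_cabs f : cmeas f -> measurable_fun setT (fun x => cabs (f x)).
Proof.
move=> [f1 f2]; rewrite (_ : (fun x => _) = (fun x => Num.sqrt (complex.Re (f x) ^+ 2 + complex.Im (f x) ^+ 2))).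
  apply: (@measurableT_comp _ _ _ _ _ _ (@Num.sqrt R)).
    by apply: continuous_measurable_fun; exact: sqrt_continuous.
  by apply: measurable_funD; exact: measurable_funX.
by apply/funext => x; rewrite /cabs normc_def.
Qed.

Lemma cintble_cabs f : cintble f -> mu.-integrable setT (EFin \o (fun x => cabs (f x))).
Proof.
move=> if_; have [f1 f2] := if_.
have i1 := integrable_norm f1; have i2 := integrable_norm f2.
have := integrableD measurableT i1 i2; apply: le_integrable => //.
  by apply/measurable_EFinP/measurable_cabs/cintble_cmeas.
move=> x _ /=; rewrite lee_fin ger0_norm ?cabs_ge0 //.
by apply: (le_trans (cabs_le_ReIm _)); exact: ler_norm.
Qed.

Lemma cintbleD f g : cintble f -> cintble g -> cintble (fun x => f x + g x).
Proof.
move=> [f1 f2] [g1 g2]; split.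
  have := integrableD measurableT f1 g1; apply: eq_integrable => // x _ /=.
  by rewrite Re_add.
have := integrableD measurableT f2 g2; apply: eq_integrable => // x _ /=.
by rewrite Im_add.
Qed.

Lemma cintbleZ (c : R[i]) f : cintble f -> cintble (fun x => c * f x).
Proof.
move=> if_; apply: (@cintble_le _ (fun x => cabs c * cabs (f x))).
- by apply: cmeasM; [exact: cmeas_cst|exact: cintble_cmeas].
- have := integrableZl measurableT (cabs c) (cintble_cabs if_).
  by apply: eq_integrable.
- by move=> x; rewrite cabsM.
Qed.

Lemma cintble_sum n (F : 'I_n -> T -> R[i]) : (forall i, cintble (F i)) ->
  cintble (fun x => \sum_(i < n) F i x).
Proof.
elim: n F => [|n IH] F iF.
  under eq_fun do rewrite big_ord0.
  by split; under eq_fun do rewrite /=; exact: integrable0.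
under eq_fun do rewrite big_ord_recr /=.
by apply: cintbleD => //; exact: IH.
Qed.

Lemma eq_cI f g : f =1 g -> cI f = cI g.
Proof. by move=> /funext ->. Qed.

Lemma cID f g : cintble f -> cintble g -> cI (fun x => f x + g x) = cI f + cI g.
Proof.
move=> [f1 f2] [g1 g2]; rewrite /cintegral; apply: complex_ext; rewrite ?Re_add ?Im_add /=.
  by rewrite -RintegralD //; congr Rintegral; apply/funext => x; rewrite Re_add.
by rewrite -RintegralD //; congr Rintegral; apply/funext => x; rewrite Im_add.
Qed.

Lemma cIZ (c : R[i]) f : cintble f -> cI (fun x => c * f x) = c * cI f.
Proof.
move=> [f1 f2].
have j1 (r : R) : mu.-integrable setT (EFin \o (fun x => r * complex.Re (f x))).
  by have := integrableZl measurableT r f1; apply: eq_integrable.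
have j2 (r : R) : mu.-integrable setT (EFin \o (fun x => r * complex.Im (f x))).
  by have := integrableZl measurableT r f2; apply: eq_integrable.
rewrite /cintegral; apply: complex_ext; rewrite ?Re_mul ?Im_mul /=.
  by rewrite -!RintegralZl // -RintegralB //; congr Rintegral; apply/funext => x; rewrite Re_mul.
by rewrite -!RintegralZl // -RintegralD //; congr Rintegral; apply/funext => x; rewrite Im_mul.
Qed.

Lemma cIN f : cintble f -> cI (fun x => - f x) = - cI f.
Proof.
move=> i; rewrite -mulN1r -cIZ //; apply: eq_cI => x; by rewrite mulN1r.
Qed.

Lemma cintbleN f : cintble f -> cintble (fun x => - f x).
Proof. by move=> /(cintbleZ (-1)); under eq_fun do rewrite mulN1r. Qed.

Lemma cintbleB f g : cintble f -> cintble g -> cintble (fun x => f x - g x).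
Proof. by move=> i j; apply: cintbleD => //; exact: cintbleN. Qed.

Lemma cIB f g : cintble f -> cintble g -> cI (fun x => f x - g x) = cI f - cI g.
Proof. by move=> i j; rewrite cID ?cIN //; exact: cintbleN. Qed.

Lemma cI0 : cI (fun=> 0) = 0.
Proof. by rewrite /cintegral /= Rintegral_cst // mul0r. Qed.

Lemma cI_sum n (F : 'I_n -> T -> R[i]) : (forall i, cintble (F i)) ->
  cI (fun x => \sum_(i < n) F i x) = \sum_(i < n) cI (F i).
Proof.
elim: n F => [|n IH] F iF.
  rewrite big_ord0 -[RHS]cI0; apply: eq_cI => x; exact: big_ord0.
rewrite big_ord_recr /= -IH // -cID //; last exact: cintble_sum.
by apply: eq_cI => x; rewrite big_ord_recr.
Qed.

Lemma cI_real (r : T -> R) : cI (fun x => (r x)%:C) = (Rintegral mu setT r)%:C.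
Proof. by rewrite /cintegral /= Rintegral_cst // mul0r. Qed.

(** Multiplying [f] by a unit complex number makes its integral a nonnegative
    real, which is then bounded by the integral of the real part. *)
Lemma cabs_cI f : cintble f -> cabs (cI f) <= Rintegral mu setT (fun x => cabs (f x)).
Proof.
move=> if_.
have [->|I0] := eqVneq (cI f) 0.
  by rewrite cabs0; apply: Rintegral_ge0 => x _; exact: cabs_ge0.
pose c := (cI f)^-1 * (cabs (cI f))%:C.
have cc : cabs c = 1.
  by rewrite /c cabsM cabsV cabs_real ger0_norm ?cabs_ge0 // mulVf // cabs_eq0.
have E : (cabs (cI f))%:C = cI (fun x => c * f x).
  by rewrite cIZ // /c mulrAC mulVf // mul1r.
have ic := cintbleZ c if_.
have -> : cabs (cI f) = complex.Re (cI (fun x => c * f x)) by rewrite -E.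
rewrite /cintegral /=; apply: le_Rintegral => //.
- by case: ic.
- exact: cintble_cabs.
- by move=> x _; rewrite (le_trans (ler_norm _)) // (le_trans (Re_le_cabs _)) // cabsM cc mul1r.
Qed.

Lemma cabs_cI_le f (h : T -> R) : cmeas f -> mu.-integrable setT (EFin \o h) ->
  (forall x, cabs (f x) <= h x) -> cabs (cI f) <= Rintegral mu setT h.
Proof.
move=> mf ih fh; have if_ := cintble_le mf ih fh.
apply: (le_trans (cabs_cI if_)); apply: le_Rintegral => //.
exact: cintble_cabs.
Qed.

(** Dominated convergence.  In the applications each point is reached by finitely
    many terms, so pointwise convergence is stated as eventual equality. *)
Lemma cI_cvg (F : nat -> T -> R[i]) f (h : T -> R) :
  (forall n, cmeas (F n)) -> cmeas f -> mu.-integrable setT (EFin \o h) ->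
  (forall n x, cabs (F n x) <= h x) ->
  (forall x, exists N, forall n, (N <= n)%N -> F n x = f x) ->
  forall e : R, 0 < e -> exists N, forall n, (N <= n)%N -> cabs (cI (F n) - cI f) <= e.
Proof.
move=> mF mf ih Fh Ff e e0.
have fh x : cabs (f x) <= h x by have [N HN] := Ff x; rewrite -(HN N) //.
have key (p : R[i] -> R) : (forall z, `|p z| <= cabs z) ->
   (forall n, measurable_fun setT (fun x => p (F n x))) -> measurable_fun setT (fun x => p (f x)) ->
   Rintegral mu setT (fun x => p (F n x)) @[n --> \oo] --> Rintegral mu setT (fun x => p (f x)).
  move=> pz mpF mpf.
  have [] := @dominated_convergence _ _ _ mu setT measurableT
    (fun n x => (p (F n x))%:E) (fun x => (p (f x))%:E) (EFin \o h).
  - by move=> n; exact/measurable_EFinP.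
  - exact/measurable_EFinP.
  - apply: aeW => x _; apply: cvg_near_cst; have [N HN] := Ff x.
    by exists N => // n /= /HN ->.
  - exact: ih.
  - by apply: aeW => x n _ /=; rewrite lee_fin (le_trans (pz _)).
  move=> ipf _ H; apply: fine_cvg; rewrite fineK //.
  exact: integrable_fin_num.
have := key (fun z => complex.Re z) (@Re_le_cabs R) (fun n => (mF n).1) mf.1.
move=> /cvgrPdist_le /(_ (e / 2)) []; first by rewrite divr_gt0.
move=> N1 _ H1.
have := key (fun z => complex.Im z) (@Im_le_cabs R) (fun n => (mF n).2) mf.2.
move=> /cvgrPdist_le /(_ (e / 2)) []; first by rewrite divr_gt0.
move=> N2 _ H2.
exists (maxn N1 N2) => n; rewrite geq_max => /andP[n1 n2].
rewrite cabsBC; apply: (le_trans (cabs_le_ReIm _)).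
rewrite Re_add Im_add Re_opp Im_opp /cintegral /=.
by have := H1 n n1; have := H2 n n2; rewrite /=; lra.
Qed.

End CIntegral.

Section CLim.
Context d (T : measurableType d) (R : realType).

(** The exit index is a minimum over all indices; functions of it are measurable
    as pointwise eventually constant limits. *)
Lemma cmeas_lim (F : nat -> T -> R[i]) (f : T -> R[i]) : (forall n, cmeas (F n)) ->
  (forall x, exists N, forall n, (N <= n)%N -> F n x = f x) -> cmeas f.
Proof.
move=> mF Ff; split.
  apply: (measurable_fun_cvg (fun n => (mF n).1)) => x _; apply: cvg_near_cst; have [N HN] := Ff x.
  by exists N => // n /= /HN ->.
apply: (measurable_fun_cvg (fun n => (mF n).2)) => x _; apply: cvg_near_cst; have [N HN] := Ff x.
by exists N => // n /= /HN ->.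
Qed.

Lemma cintegral_restrict (mu : {measure set T -> \bar R}) (D : set T) (f : T -> R[i]) :
  cintegral mu D f = cintegral mu setT (fun x => if x \in D then f x else 0).
Proof.
rewrite /cintegral !(Rintegral_mkcond _ D); congr (_ +i* _); congr Rintegral;
  by apply/funext => x; rewrite patchE; case: ifP.
Qed.

End CLim.

(** * Bounded functions, Fubini's theorem and image laws *)

Section Bounded.
Context d (T : measurableType d) (R : realType).
Implicit Types f g : T -> R[i].

Definition bmeas f := cmeas f /\ exists C : R, forall x, cabs (f x) <= C.

Lemma bmeas_cst (z : R[i]) : bmeas (fun=> z).
Proof. by split; [exact: cmeas_cst|exists (cabs z)]. Qed.

Lemma bmeasD f g : bmeas f -> bmeas g -> bmeas (fun x => f x + g x).
Proof.
move=> [mf [C fC]] [mg [D gD]]; split; first exact: cmeasD.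
by exists (C + D) => x; rewrite (le_trans (cabsD _ _)) // lerD.
Qed.

Lemma bmeasM f g : bmeas f -> bmeas g -> bmeas (fun x => f x * g x).
Proof.
move=> [mf [C fC]] [mg [D gD]]; split; first exact: cmeasM.
by exists (C * D) => x; rewrite cabsM ler_pM // cabs_ge0.
Qed.

Lemma bmeas_prod (I : eqType) (s : seq I) (F : I -> T -> R[i]) : (forall i, bmeas (F i)) ->
  bmeas (fun x => \prod_(i <- s) F i x).
Proof.
move=> mF; elim: s => [|i s IH].
  by under eq_fun do rewrite big_nil; exact: bmeas_cst.
by under eq_fun do rewrite big_cons; exact: bmeasM.
Qed.

Lemma bmeas_expn (z : R[i]) (X : T -> nat) : cabs z <= 1 -> measurable_fun setT X ->
  bmeas (fun x => z ^+ X x).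
Proof.
move=> z1 mX; split; first exact: (cmeas_nat (fun n => z ^+ n)).
by exists 1 => x; exact: cabsX_le1.
Qed.

Lemma bmeas_bool (b : T -> bool) : measurable_fun setT b -> bmeas (fun x => (b x)%:R : R[i]).
Proof.
move=> mb; split; first exact: cmeas_bool.
by exists 1 => x; case: (b x); rewrite ?cabs1 // cabs0.
Qed.

Lemma bmeas_cexp f : cmeas f -> (forall x, complex.Re (f x) <= 0) -> bmeas (fun x => cexp (f x)).
Proof.
move=> mf f0; split; first exact: cmeas_cexp.
by exists 1 => x; exact: cabs_cexp_le1.
Qed.

End Bounded.

Lemma bmeas_comp d d' (T : measurableType d) (T' : measurableType d') (R : realType)
  (f : T' -> R[i]) (g : T -> T') : measurable_fun setT g -> bmeas f ->
  bmeas (fun x => f (g x)).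
Proof. by move=> mg [mf [C fC]]; split; [exact: cmeas_comp|exists C]. Qed.

Section Expectation.
Context d (T : measurableType d) (R : realType) (P : probability T R).
Local Notation cE := (cintegral P setT).

Lemma integrable_cst (C : R) : P.-integrable setT (EFin \o cst C).
Proof. exact: finite_measure_integrable_cst. Qed.

Lemma bmeas_cintble f : bmeas f -> cintble P f.
Proof. by move=> [mf [C fC]]; exact: cintble_le mf (integrable_cst C) fC. Qed.

Lemma cabs_cE_le f (C : R) : cmeas f -> (forall x, cabs (f x) <= C) -> cabs (cE f) <= C.
Proof.
move=> mf fC; apply: (le_trans (cabs_cI_le mf (integrable_cst C) fC)).
by rewrite Rintegral_cst //= probability_setT mulr1.
Qed.

Lemma cE_cst (z : R[i]) : cE (fun=> z) = z.
Proof. by apply: complex_ext; rewrite /cintegral /= Rintegral_cst //= probability_setT mulr1. Qed.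

Lemma eq_cE_full_event (f g : T -> R[i]) (N : set T) : bmeas f -> bmeas g -> measurable N ->
  P N = 1%E -> (forall x, N x -> f x = g x) -> cE f = cE g.
Proof.
move=> [[f1 f2] _] [[g1 g2] _] mN PN fg.
have PNC : P (~` N) = 0%E by rewrite probability_setC // PN subee.
have ae (p : R[i] -> R) : ae_eq P setT (fun x => (p (f x))%:E) (fun x => (p (g x))%:E).
  exists (~` N); split; [exact: measurableC|exact: PNC|].
  by move=> x /= /not_implyP [_ h] Nx; apply: h; rewrite fg.
rewrite /cintegral; apply: complex_ext => /=; congr fine; apply: ae_eq_integral => //; try exact/measurable_EFinP.
Qed.

End Expectation.

Lemma bmeas_cintble_prod d1 d2 (T1 : measurableType d1) (T2 : measurableType d2) (R : realType)
  (P1 : probability T1 R) (P2 : probability T2 R) (f : T1 * T2 -> R[i]) :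
  bmeas f -> cintble (P1 \x P2)%E f.
Proof. exact: (bmeas_cintble (P1 \x P2)%E). Qed.

Section CFubini.
Context d1 d2 (T1 : measurableType d1) (T2 : measurableType d2) (R : realType).
Variables (m1 : {sigma_finite_measure set T1 -> \bar R}).
Variables (m2 : {sigma_finite_measure set T2 -> \bar R}).
Implicit Types f : T1 * T2 -> R[i].

(* Integrability of every section, not just of almost every one, makes the inner
   integral a finite number everywhere, as a real-valued integral requires. *)
Let fubini_R1 (g : T1 * T2 -> R) :
  (m1 \x m2)%E.-integrable setT (EFin \o g) ->
  (forall x, m2.-integrable setT (EFin \o (fun y => g (x, y)))) ->
  m1.-integrable setT (EFin \o (fun x => Rintegral m2 setT (fun y => g (x, y)))) /\
  Rintegral m1 setT (fun x => Rintegral m2 setT (fun y => g (x, y))) =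
  Rintegral (m1 \x m2)%E setT g.
Proof.
move=> ig igx.
have E : EFin \o (fun x => Rintegral m2 setT (fun y => g (x, y))) =
         fubini_F m2 (EFin \o g).
  by apply/funext => x; rewrite /= /Rintegral fineK //; exact: integrable_fin_num (igx x).
split; first by rewrite E; exact: integrable_fubini_F.
by rewrite /Rintegral -integral12_prod_meas1 // -E.
Qed.

Let fubini_R2 (g : T1 * T2 -> R) :
  (m1 \x m2)%E.-integrable setT (EFin \o g) ->
  (forall y, m1.-integrable setT (EFin \o (fun x => g (x, y)))) ->
  Rintegral m2 setT (fun y => Rintegral m1 setT (fun x => g (x, y))) =
  Rintegral (m1 \x m2)%E setT g.
Proof.
move=> ig igx.
have E : EFin \o (fun y => Rintegral m1 setT (fun x => g (x, y))) =
         fubini_G m1 (EFin \o g).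
  by apply/funext => x; rewrite /= /Rintegral fineK //; exact: integrable_fin_num (igx x).
by rewrite /Rintegral -integral21_prod_meas1 // -E.
Qed.

Lemma cI_fubini1 f : cintble (m1 \x m2)%E f ->
  (forall x, cintble m2 (fun y => f (x, y))) ->
  cintegral m1 setT (fun x => cintegral m2 setT (fun y => f (x, y))) =
  cintegral (m1 \x m2)%E setT f.
Proof.
move=> [f1 f2] fx; rewrite /cintegral /=.
have [_ ->] := fubini_R1 f1 (fun x => (fx x).1).
by have [_ ->] := fubini_R1 f2 (fun x => (fx x).2).
Qed.

Lemma cintble_fubini1 f : cintble (m1 \x m2)%E f ->
  (forall x, cintble m2 (fun y => f (x, y))) ->
  cintble m1 (fun x => cintegral m2 setT (fun y => f (x, y))).
Proof.
move=> [f1 f2] fx; split.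
  by have [] := fubini_R1 f1 (fun x => (fx x).1).
by have [] := fubini_R1 f2 (fun x => (fx x).2).
Qed.

Lemma cI_fubini2 f : cintble (m1 \x m2)%E f ->
  (forall y, cintble m1 (fun x => f (x, y))) ->
  cintegral m2 setT (fun y => cintegral m1 setT (fun x => f (x, y))) =
  cintegral (m1 \x m2)%E setT f.
Proof.
move=> [f1 f2] fx; rewrite /cintegral /=.
have -> := fubini_R2 f1 (fun x => (fx x).1).
by have -> := fubini_R2 f2 (fun x => (fx x).2).
Qed.

End CFubini.

Section Pushforward.
Context d1 d2 (T1 : measurableType d1) (T2 : measurableType d2) (R : realType).
Variables (P : probability T1 R) (X : {mfun T1 >-> T2}).

Lemma cE_distribution (f : T2 -> R[i]) : bmeas f ->
  cintegral (distribution P X) setT f = cintegral P setT (fun w => f (X w)).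
Proof.
move=> bf; have [f1 f2] := bf.1.
have [j1 j2] := bmeas_cintble P (bmeas_comp (measurable_funPT X) bf).
rewrite /cintegral /Rintegral /distribution; apply: complex_ext => /=; congr fine.
  by rewrite integral_pushforward //; exact/measurable_EFinP.
by rewrite integral_pushforward //; exact/measurable_EFinP.
Qed.
End Pushforward.

(** * Independence *)

Section JointLaw.
Context d d1 d2 (Omega : measurableType d) (E1 : measurableType d1) (E2 : measurableType d2).
Context (R : realType) (P : probability Omega R).

(** The joint law of [(X, Y)] is the product of the two laws by uniqueness of the
    product measure, and Fubini's theorem for it gives the iterated
    expectation. *)
Lemma cE_indep (X : Omega -> E1) (Y : Omega -> E2) (f : E1 * E2 -> R[i]) :
  measurable_fun setT X -> measurable_fun setT Y ->
  (forall A B, measurable A -> measurable B ->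
     P (X @^-1` A `&` Y @^-1` B) = (P (X @^-1` A) * P (Y @^-1` B))%E) ->
  bmeas f ->
  cintegral P setT (fun w => f (X w, Y w)) =
  cintegral P setT (fun w1 => cintegral P setT (fun w2 => f (X w1, Y w2))).
Proof.
move=> mX mY XY bf.
pose X' : {mfun Omega >-> E1} := HB.pack X (isMeasurableFun.Build _ _ _ _ X mX).
pose Y' : {mfun Omega >-> E2} := HB.pack Y (isMeasurableFun.Build _ _ _ _ Y mY).
pose Z w := (X w, Y w).
have mZ : measurable_fun setT Z by exact: measurable_fun_pair.
pose Z' : {mfun Omega >-> (E1 * E2)%type} := HB.pack Z (isMeasurableFun.Build _ _ _ _ Z mZ).
rewrite -[LHS](@cE_distribution _ _ _ _ _ P Z' f bf).
have bx x : bmeas (fun y => f (x, y)).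
  by apply: (bmeas_comp _ bf); exact: pair1_measurable.
have -> : cintegral (distribution P Z') setT f =
    cintegral (distribution P X' \x distribution P Y')%E setT f.
  rewrite /cintegral /Rintegral; apply: complex_ext => /=; congr fine;
    apply: eq_measure_integral => A mA _ /=; apply/esym;
    apply: product_measure_unique => // B C mB mC; exact: XY.
rewrite -cI_fubini1; last 2 first.
- exact: bmeas_cintble_prod.
- by move=> x; apply: bmeas_cintble.
rewrite (@cE_distribution _ _ _ _ _ P X' (fun x => cintegral (distribution P Y') setT (fun y => f (x, y)))).
  by congr cintegral; apply/funext => w1; rewrite (@cE_distribution _ _ _ _ _ P Y' (fun y => f (X w1, y))).
split.
  apply: cintble_cmeas; apply: (@cintble_fubini1 _ _ _ _ _ (distribution P X') (distribution P Y') f).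
    exact: bmeas_cintble_prod.
  by move=> x; exact: bmeas_cintble.
by have [C fC] := bf.2; exists C => x; apply: cabs_cE_le => //; exact: (bx x).1.
Qed.

End JointLaw.

Lemma bigsetI_seq (I : eqType) (U : Type) (s : seq I) (F : I -> set U) :
  \big[setI/setT]_(i <- s) F i = [set w | forall i, i \in s -> F i w].
Proof.
elim: s => [|i s IH]; first by rewrite big_nil; apply/seteqP; split.
rewrite big_cons IH; apply/seteqP; split => [w [Fi Fs] j|w Fs].
  by rewrite in_cons => /predU1P[->|/Fs].
by split => [|j js]; apply: Fs; rewrite in_cons ?eqxx // js orbT.
Qed.

Section SigmaIndep.
Context d (Omega : measurableType d) (R : realType) (P : probability Omega R).

(** The identity map into [Omega] with a smaller sigma-algebra is a random
    variable that generates it.  Independence of sigma-algebras thereby becomes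
    independence of two random variables. *)
Lemma measurable_to_sub (G : set (set Omega)) : G `<=` measurable ->
  measurable_fun setT (fun w : Omega => (w : g_sigma_algebraType G)).
Proof.
move=> Gm _ B mB; rewrite setTI.
exact: (smallest_sub (@sigma_algebra_measurable _ Omega) Gm).
Qed.

(** For families of random variables: [f] may depend on all variables of the first
    family through its first argument and on all those of the second through
    its second one. *)
Lemma cE_indep_sigma (G1 G2 : set (set Omega))
    (f : g_sigma_algebraType G1 * g_sigma_algebraType G2 -> R[i]) :
  G1 `<=` measurable -> G2 `<=` measurable ->
  (forall C D, <<s G1 >> C -> <<s G2 >> D -> P (C `&` D) = (P C * P D)%E) ->
  bmeas f ->
  cintegral P setT (fun w => f (w, w)) =
  cintegral P setT (fun w1 => cintegral P setT (fun w2 => f (w1, w2))).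
Proof.
move=> G1m G2m H bf.
exact: (cE_indep (measurable_to_sub G1m) (measurable_to_sub G2m) H bf).
Qed.

Lemma measurable_sub (G : set (set Omega)) d' (E : measurableType d') (X : Omega -> E) :
  (forall B, measurable B -> G (X @^-1` B)) ->
  measurable_fun setT (X : g_sigma_algebraType G -> E).
Proof. by move=> H _ B mB; rewrite setTI; apply: sub_sigma_algebra; exact: H. Qed.

Section Mutual.
Context (I : eqType) d' (E : measurableType d') (X : I -> Omega -> E).
Hypothesis mX : forall i, measurable_fun setT (X i).
Hypothesis iX : mutually_independent P X.

Let G (J : seq I) := [set C | exists2 B : I -> set E, (forall i, measurable (B i)) &
  C = \big[setI/setT]_(i <- J) (X i @^-1` B i)].

Let Gm J : G J `<=` measurable.
Proof.
move=> _ [B mB ->]; elim/big_ind : _ => //; first exact: measurableI.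
by move=> i _; rewrite -[_ @^-1` _]setTI; exact: mX.
Qed.

Let GI J : setI_closed (G J).
Proof.
move=> _ _ [B mB ->] [C mC ->]; exists (fun i => B i `&` C i).
  by move=> i; exact: measurableI.
by rewrite -big_split /=; apply: eq_bigr => i _; rewrite preimage_setI.
Qed.

Let GT J : G J setT.
Proof. by exists (fun=> setT) => //; rewrite big1 // => i _; rewrite preimage_setT. Qed.

(** Mutual independence is given on the finite intersections [G J], a pi-system;
    the restriction of [P] to [X i @^-1` A] and the multiple of [P] by the
    probability of that event agree there, hence on the generated
    sigma-algebra. *)
Let G_indep i J A D : uniq (i :: J) -> measurable A -> <<s G J >> D ->
  P (X i @^-1` A `&` D) = (P (X i @^-1` A) * P D)%E.
Proof.
move=> uJ mA GD.
have mXA : measurable (X i @^-1` A) by rewrite -[_ @^-1` _]setTI; exact: mX.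
pose r : {nonneg R} := NngNum (fine_ge0 (measure_ge0 P (X i @^-1` A))).
have rE : r%:num%:E = P (X i @^-1` A) by rewrite /= fineK // fin_num_measure.
have := @g_sigma_algebra_measure_unique _ R Omega (G J) (@Gm J) (fun=> setT) (fun=> GT J)
   _ (mrestr P mXA) (mscale r P) (@GI J).
rewrite bigcup_const; last by exists 0%N.
move=> /(_ erefl); rewrite /mrestr /mscale /= -/(r%:num) => H.
rewrite setIC -rE; apply: H => //; last first.
  by move=> _; rewrite /mrestr setTI (le_lt_trans (probability_le1 P mXA)) // ltry.
move=> _ [B mB ->]; rewrite /mrestr /mscale rE setIC.
pose B' k := if k == i then A else B k.
have mB' k : measurable (B' k) by rewrite /B'; case: ifP.
have uJ' := uJ; move: uJ => /= /andP[iJ uJ].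
have eB : \big[setI/setT]_(j <- J) (X j @^-1` B j) = \big[setI/setT]_(j <- J) (X j @^-1` B' j).
  by apply: eq_big_seq => j jJ; rewrite /B'; case: eqP => // ji; rewrite -ji jJ in iJ.
have := iX uJ' mB'; rewrite !big_cons -iX // -eB {1 2}/B' eqxx => ->.
by congr (_ * _)%E; rewrite eB.
Qed.

(** By induction on [J]: the product over the tail is measurable for the
    sigma-algebra generated by the tail, of which [X i] is independent. *)
Lemma cE_prod_indep (J : seq I) (f : I -> E -> R[i]) : uniq J ->
  (forall i, bmeas (f i)) ->
  cintegral P setT (fun w => \prod_(i <- J) f i (X i w)) =
  \prod_(i <- J) cintegral P setT (fun w => f i (X i w)).
Proof.
move=> uJ bf; elim: J uJ => [|i J IH] uJ.
  by rewrite big_nil; under eq_fun do rewrite big_nil; exact: cE_cst.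
rewrite big_cons; under eq_fun do rewrite big_cons.
have GX j : j \in J -> bmeas (fun w : g_sigma_algebraType (G J) => f j (X j w)).
  move=> jJ; apply: (@bmeas_comp _ _ _ _ _ (f j) (X j : g_sigma_algebraType (G J) -> E)) => //.
  apply: measurable_sub => B mB; exists (fun k => if k == j then B else setT).
    by move=> k; case: ifP.
  rewrite bigsetI_seq; apply/seteqP; split => [w Bw k /= kJ|w /= /(_ j jJ)].
    by case: eqP => // ->.
  by rewrite eqxx.
have bJ : bmeas (fun w : g_sigma_algebraType (G J) => \prod_(j <- J) f j (X j w)).
  under eq_fun do rewrite big_seq big_mkcond /=.
  apply: (@bmeas_prod _ (g_sigma_algebraType (G J)) _ _ J (fun j w => if j \in J then f j (X j w) else 1)) => j.
  by have [/GX//|_] := boolP (j \in J); exact: bmeas_cst.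
have h := @cE_indep _ _ _ Omega E (g_sigma_algebraType (G J)) R P (X i) (fun w => w)
  (fun p => f i p.1 * \prod_(j <- J) f j (X j p.2)) (mX i) (measurable_to_sub (@Gm J)).
rewrite [LHS]h.
- have {}IH := IH (andP uJ).2.
  rewrite /= -IH -[RHS]mulrC -cIZ; last first.
    by apply: bmeas_cintble; apply: bmeas_comp (bf i).
  congr cintegral; apply/funext => w1; rewrite mulrC -cIZ //.
  by apply: bmeas_cintble; apply: bmeas_prod => j; apply: bmeas_comp (bf j).
- by move=> A B mA mB; exact: (G_indep uJ mA mB).
- apply: bmeasM; first by apply: bmeas_comp (bf i); exact: measurable_fst.
  by apply: (@bmeas_comp _ _ _ _ _ (fun w : g_sigma_algebraType (G J) => \prod_(j <- J) f j (X j w)) snd) => //; exact: measurable_snd.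
Qed.

End Mutual.
End SigmaIndep.

(** * Paths of the counting and marked processes *)

Section Paths.
Context d (Omega : measurableType d) (R : realType) (T : nat -> Omega -> R).
Hypothesis T_ord : forall k w, T k w <= T k.+1 w.
Hypothesis T_lf : forall w, T k w @[k --> \oo] --> +oo.

Local Notation N := (counting_process T).

Let T_mono w : {homo (T ^~ w) : m n / (m <= n)%N >-> m <= n}.
Proof. by apply: homo_leq => [//|x y z|k]; [exact: le_trans|exact: T_ord]. Qed.

(* The points are ordered and tend to infinity, so those in [0, r] are the first
   ones; the number of them is the value of the counting process. *)
Let initial_segment r w : exists n, forall k, (T k w <= r) = (k < n)%N.
Proof.
have : exists n, r < T n w.
  have /cvgryPgt /(_ r) [n _ Hn] := T_lf w.
  by exists n; apply: (Hn n); exact: leqnn.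
move=> /ex_minnP [n rn nmin]; exists n => k.
case: (ltnP k n) => [kn|nk].
  by rewrite leNgt; apply/negP => /nmin; rewrite leqNgt kn.
by apply/negbTE; rewrite -ltNge; apply: (lt_le_trans rn); exact: T_mono.
Qed.

Let marked_process_segment (a : nat -> Omega -> nat) r w n :
  (forall k, (T k w <= r) = (k < n)%N) -> marked_process T a r w = (\sum_(k < n) a k w)%N.
Proof.
move=> H; rewrite /marked_process.
have -> : [set k | T k w <= r] = `I_n by apply/seteqP; split => k /=; rewrite H.
by rewrite -fsbig_ord.
Qed.

(** The duality of points and counts through which all pathwise properties are
    derived. *)
Lemma counting_processP r w k : (T k w <= r) = (k < N r w)%N.
Proof.
have [n Hn] := initial_segment r w; rewrite Hn; congr (_ < _)%N.
by rewrite /counting_process (marked_process_segment _ Hn) sum1_card card_ord.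
Qed.

Lemma marked_processE (a : nat -> Omega -> nat) r w :
  marked_process T a r w = (\sum_(k < N r w) a k w)%N.
Proof. by apply: marked_process_segment => k; exact: counting_processP. Qed.

Lemma counting_process_mono w r r' : r <= r' -> (N r w <= N r' w)%N.
Proof.
move=> rr'; rewrite leqNgt; apply/negP => h.
by move: (h); rewrite -counting_processP => /le_trans /(_ rr'); rewrite counting_processP ltnn.
Qed.

Lemma marked_process_mono a w r r' : r <= r' ->
  (marked_process T a r w <= marked_process T a r' w)%N.
Proof.
move=> rr'; rewrite !marked_processE -!(big_mkord xpredT (a ^~ w)).
by rewrite [leqRHS](@big_cat_nat _ _ _ (N r w)) ?counting_process_mono //= leq_addr.
Qed.

(** Right continuity along the rationals: the process is constant up to the next
    point. *)
Lemma marked_process_right a w r : exists2 q : rat, r < ratr q &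
  marked_process T a (ratr q) w = marked_process T a r w.
Proof.
have rT : r < T (N r w) w by rewrite ltNge counting_processP ltnn.
have [q] := rat_in_itvoo rT; rewrite in_itv /= => /andP[rq qT].
exists q => //; rewrite !marked_processE; suff -> : N (ratr q) w = N r w by [].
apply/eqP; rewrite eqn_leq [X in _ && X]counting_process_mono ?(ltW rq) // andbT.
by rewrite leqNgt -counting_processP -ltNge.
Qed.

End Paths.

(** * Measurability of integer-valued functions *)

Section MeasurableNat.
Context d (Omega : measurableType d).

Lemma measurable_nat_leP (X : Omega -> nat) :
  (forall j, measurable [set w | (X w <= j)%N]) -> measurable_fun setT X.
Proof.
move=> H _ B _; rewrite setTI.
have mE j : measurable [set w | X w = j].
  case: j => [|j].
    by rewrite (_ : [set w | _] = [set w | (X w <= 0)%N]) //; apply/seteqP; split => w /=; [move=> ->|rewrite leqn0 => /eqP].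
  rewrite (_ : [set w | _] = [set w | (X w <= j.+1)%N] `\` [set w | (X w <= j)%N]).
    exact: measurableD.
  apply/seteqP; split => w /= => [->|[h1 h2]]; first by rewrite leqnn ltnn.
  by apply/eqP; rewrite eqn_leq h1 ltnNge; apply/negP.
rewrite (_ : X @^-1` B = \bigcup_(j in B) [set w | X w = j]); first exact: bigcup_measurable.
by apply/seteqP; split => [w Bw|w [j Bj /= Xj]]; [exists (X w)|rewrite /= Xj].
Qed.

(** This applies to the partial sums of the marks, with the counting process as the
    index. *)
Lemma measurable_nat_select d' (E : measurableType d') (X : Omega -> nat) (F : nat -> Omega -> E) :
  measurable_fun setT X -> (forall n, measurable_fun setT (F n)) ->
  measurable_fun setT (fun w => F (X w) w).
Proof.
move=> mX mF _ B mB; rewrite setTI.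
rewrite (_ : _ @^-1` B = \bigcup_n (X @^-1` [set n] `&` F n @^-1` B)).
  apply: bigcupT_measurable => n; apply: measurableI.
    by rewrite -[_ @^-1` _]setTI; exact: mX.
  by rewrite -[_ @^-1` _]setTI; exact: mF.
apply/seteqP; split => [w /= Bw|w [n _ [/= <-]]] //.
by exists (X w).
Qed.

Lemma measurable_sum_ord (n : nat) (a : nat -> Omega -> nat) :
  (forall k, measurable_fun setT (a k)) ->
  measurable_fun setT (fun w => \sum_(k < n) a k w)%N.
Proof.
move=> ma; elim: n => [|n IH].
  by under eq_fun do rewrite big_ord0; exact: measurable_cst.
by under eq_fun do rewrite big_ord_recr /=; exact: measurable_fun_addn.
Qed.

Context (R : realType) (T : nat -> Omega -> R) (a : nat -> Omega -> nat).
Hypothesis T_ord : forall k w, T k w <= T k.+1 w.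
Hypothesis T_lf : forall w, T k w @[k --> \oo] --> +oo.
Hypothesis mT : forall k, measurable_fun setT (T k).
Hypothesis ma : forall k, measurable_fun setT (a k).

Lemma measurable_counting_process r : measurable_fun setT (counting_process T r).
Proof.
apply: measurable_nat_leP => j.
rewrite (_ : [set w | _] = T j @^-1` `]r, +oo[); first by rewrite -[_ @^-1` _]setTI; exact: mT.
by apply/seteqP; split => w /=; rewrite in_itv /= andbT leqNgt -counting_processP // -ltNge.
Qed.

Lemma measurable_marked_process r : measurable_fun setT (marked_process T a r).
Proof.
have -> : marked_process T a r = (fun w => (\sum_(k < counting_process T r w) a k w)%N).
  by apply/funext => w; exact: marked_processE.
apply: (@measurable_nat_select _ _ _ (fun n w => \sum_(k < n) a k w)%N).
  exact: measurable_counting_process.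
by move=> n; exact: measurable_sum_ord.
Qed.

End MeasurableNat.

(** Monotonicity and right continuity express [A r w <= j] by countably many
    conditions: there is a rational [q > r] with [A q w <= j]. *)
Lemma measurable_right_continuous (R : realType) d (Omega : measurableType d) (A : R -> Omega -> nat) :
  (forall r, measurable_fun setT (A r)) ->
  (forall w r r', r <= r' -> (A r w <= A r' w)%N) ->
  (forall w r, exists2 q : rat, r < ratr q & A (ratr q) w = A r w) ->
  measurable_fun setT (fun p : R * Omega => A p.1 p.2).
Proof.
move=> mA A_mono A_right; apply: measurable_nat_leP => j.
rewrite (_ : [set p | _] = \bigcup_(q : rat) (`]-oo, (ratr q)[ `*` [set w | (A (ratr q) w <= j)%N])).
  apply: bigcupT_measurable_rat => q; apply: measurableX => //.
  by rewrite (_ : [set w | _] = A (ratr q) @^-1` [set n | (n <= j)%N]) // -[_ @^-1` _]setTI; exact: mA.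
apply/seteqP; split => [[r w] /= Arj|[r w] [q _ [/= rq Aq]]].
  have [q rq Aq] := A_right w r; exists q => //; split => /=; rewrite ?Aq //.
by apply: leq_trans Aq; apply: A_mono; move: rq; rewrite in_itv /= => /ltW.
Qed.

(** * The probability generating function of Poisson increments *)

Section SameLaw.
Context d (Omega : measurableType d) (R : realType) (P : probability Omega R).

Lemma cE_same_law d' (E : measurableType d') (X Y : Omega -> E) (f : E -> R[i]) :
  measurable_fun setT X -> measurable_fun setT Y -> identically_distributed P X Y ->
  bmeas f -> cintegral P setT (fun w => f (X w)) = cintegral P setT (fun w => f (Y w)).
Proof.
move=> mX mY XY bf.
pose X' : {mfun Omega >-> E} := HB.pack X (isMeasurableFun.Build _ _ _ _ X mX).
pose Y' : {mfun Omega >-> E} := HB.pack Y (isMeasurableFun.Build _ _ _ _ Y mY).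
rewrite -(@cE_distribution _ _ _ _ _ P X' f bf) -(@cE_distribution _ _ _ _ _ P Y' f bf).
rewrite /cintegral /Rintegral; apply: complex_ext => /=; congr fine;
  by apply: eq_measure_integral => A mA _ /=; exact: XY.
Qed.

Lemma nat_same_law (X Y : Omega -> nat) :
  measurable_fun setT X -> measurable_fun setT Y ->
  (forall n, P [set w | X w = n] = P [set w | Y w = n]) -> identically_distributed P X Y.
Proof.
move=> mX mY XY B _.
have E (Z : Omega -> nat) : Z @^-1` B = \bigcup_(n in B) [set w | Z w = n].
  by apply/seteqP; split => [w Bw|w [n Bn /= Zn]]; [exists (Z w)|rewrite /= Zn].
have mE (Z : Omega -> nat) n : measurable_fun setT Z -> measurable [set w | Z w = n].
  by move=> mZ; rewrite (_ : [set w | _] = Z @^-1` [set n]) // -[_ @^-1` _]setTI; exact: mZ.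
have tI (Z : Omega -> nat) : trivIset B (fun n => [set w | Z w = n]).
  by move=> i j _ _ [w [/= <- <-]].
rewrite !E !measure_bigcup //; try by move=> n _; exact: mE.
by apply: eq_eseriesr => n _; exact: XY.
Qed.

End SameLaw.

Section ExpansionBounds.
Context {R : realType}.

(** From [expR x >= 1 + x] and [(1 - x + x ^+ 2) (1 + x) = 1 + x ^+ 3]. *)
Lemma expRN_le_sq (x : R) : 0 <= x -> expR (- x) <= 1 - x + x ^+ 2.
Proof.
move=> x0; have h := expR_ge1Dx x.
have e0 := expR_gt0 x; rewrite expRN -[leLHS]mul1r ler_pdivrMr //.
apply: (@le_trans _ _ ((1 - x + x ^+ 2) * (1 + x))).
  have -> : (1 - x + x ^+ 2) * (1 + x) = 1 + x ^+ 3 by ring.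
  by rewrite lerDl exprn_ge0.
rewrite ler_wpM2l //.
have -> : 1 - x + x ^+ 2 = (x - 1 / 2) ^+ 2 + 3 / 4 by field.
by rewrite addr_ge0 // sqr_ge0.
Qed.

Lemma expRN_ge (x : R) : 1 - x <= expR (- x).
Proof. exact: expR_ge1Dx. Qed.

Lemma cabs_subX_le (a b : R[i]) n : cabs a <= 1 -> cabs b <= 1 ->
  cabs (a ^+ n - b ^+ n) <= n%:R * cabs (a - b).
Proof.
move=> a1 b1; elim: n => [|n IH]; first by rewrite !expr0 subrr cabs0 mul0r.
have -> : a ^+ n.+1 - b ^+ n.+1 = a * (a ^+ n - b ^+ n) + (a - b) * b ^+ n by rewrite !exprS; ring.
apply: (le_trans (cabsD _ _)); rewrite !cabsM -addn1 natrD mulrDl mul1r.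
apply: lerD.
  apply: (le_trans _ IH); rewrite -[leRHS]mul1r ler_wpM2r ?cabs_ge0 //.
by rewrite -[leRHS]mulr1 ler_wpM2l ?cabs_ge0 // cabsX_le1.
Qed.

Lemma is_derive_Re_cexp (c : R[i]) (t : R) :
  is_derive t 1 (fun t : R => complex.Re (cexp (c * t%:C))) (complex.Re (c * cexp (c * t%:C))).
Proof.
have E : (fun t : R => complex.Re (cexp (c * t%:C))) =
  (expR \o (fun t => complex.Re c * t)) * (cos \o (fun t => complex.Im c * t)).
  apply/funext => r; transitivity (expR (complex.Re c * r) * cos (complex.Im c * r)) => //.
  by rewrite /cexp; case: (c) => p q /=; rewrite !mulr0 subr0 add0r mul0r subr0.
rewrite E.
have d1 : is_derive t 1 (expR \o (fun t => complex.Re c * t)) (expR (complex.Re c * t) * complex.Re c).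
  apply: is_derive1_comp; apply: is_derive_eq; by rewrite scaler1.
have d2 : is_derive t 1 (cos \o (fun t => complex.Im c * t)) (- sin (complex.Im c * t) * complex.Im c).
  apply: is_derive1_comp; apply: is_derive_eq; by rewrite scaler1.
apply: is_derive_eq; rewrite /GRing.scale /= /cexp; clear; case: c => p q /=; rewrite !(mulr0, subr0, add0r); ring.
Qed.

Lemma is_derive_Im_cexp (c : R[i]) (t : R) :
  is_derive t 1 (fun t : R => complex.Im (cexp (c * t%:C))) (complex.Im (c * cexp (c * t%:C))).
Proof.
have E : (fun t : R => complex.Im (cexp (c * t%:C))) =
  (expR \o (fun t => complex.Re c * t)) * (sin \o (fun t => complex.Im c * t)).
  apply/funext => r; transitivity (expR (complex.Re c * r) * sin (complex.Im c * r)) => //.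
  by rewrite /cexp; case: (c) => p q /=; rewrite !mulr0 subr0 add0r mul0r addr0.
rewrite E.
have d1 : is_derive t 1 (expR \o (fun t => complex.Re c * t)) (expR (complex.Re c * t) * complex.Re c).
  apply: is_derive1_comp; apply: is_derive_eq; by rewrite scaler1.
have d2 : is_derive t 1 (sin \o (fun t => complex.Im c * t)) (cos (complex.Im c * t) * complex.Im c).
  apply: is_derive1_comp; apply: is_derive_eq; by rewrite scaler1.
apply: is_derive_eq; rewrite /GRing.scale /= /cexp; clear; case: c => p q /=; rewrite !(mulr0, subr0, add0r); ring.
Qed.

Lemma is_derive0_bound (f : R -> R) (l e : R) : is_derive (0 : R) (1 : R) f l -> 0 < e ->
  exists2 dlt : R, 0 < dlt & forall h, 0 < h -> h < dlt -> `|f h - f 0 - l * h| <= e * h.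
Proof.
move=> [df fl] e0.
have := df; rewrite /derivable => /cvg_ex [l' H].
have ll' : l' = l by rewrite -fl; apply/esym/cvg_lim.
move: H; rewrite {}ll' => /cvgrPdist_le /(_ e e0).
rewrite /dnbhs /within /= => -[dlt /= d0 H]; exists dlt => // h h0 hd.
have := H h; rewrite /= sub0r normrN gtr0_norm // => /(_ hd); rewrite gt_eqF // => /(_ isT).
rewrite addr0 /GRing.scale /= mulr1 => H2.
have -> : f h - f 0 - l * h = - (l - h^-1 * (f h - f 0)) * h by field; rewrite gt_eqF.
by rewrite normrM normrN (gtr0_norm h0) ler_wpM2r // ltW.
Qed.

(** The remainder is [o(h)], from the derivatives of the two coordinates at 0. *)
Lemma cexp_first_order (c : R[i]) (e : R) : 0 < e ->
  exists2 dlt : R, 0 < dlt & forall h, 0 < h -> h < dlt ->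
    cabs (cexp (c * h%:C) - 1 - c * h%:C) <= e * h.
Proof.
move=> e0; have e20 : 0 < e / 2 by rewrite divr_gt0.
have [d1 d10 H1] := is_derive0_bound (is_derive_Re_cexp c 0) e20.
have [d2 d20 H2] := is_derive0_bound (is_derive_Im_cexp c 0) e20.
exists (Num.min d1 d2); first by rewrite lt_min d10.
move=> h h0; rewrite lt_min => /andP[hd1 hd2].
apply: (le_trans (cabs_le_ReIm _)).
have := H1 h h0 hd1; have := H2 h h0 hd2.
have RE : complex.Re (c * h%:C) = complex.Re c * h by rewrite Re_mul /= mulr0 subr0.
have IE : complex.Im (c * h%:C) = complex.Im c * h by rewrite Im_mul /= mulr0 add0r.
rewrite mulr0 cexp0 mulr1 !Re_add !Im_add !Re_opp !Im_opp RE IE.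
have -> : complex.Im (1 : R[i]) = 0 by [].
have -> : complex.Re (1 : R[i]) = 1 by [].
lra.
Qed.

End ExpansionBounds.

Section Indicator.
Context d (Omega : measurableType d) (R : realType) (P : probability Omega R).

Lemma measurable_set_bool (b : Omega -> bool) : measurable_fun setT b -> measurable [set w | b w].
Proof. by move=> mb; rewrite (_ : [set w | b w] = setT `&` b @^-1` [set true]); [exact: mb|rewrite setTI; apply/seteqP; split => w]. Qed.

Lemma Rintegral_bool (b : Omega -> bool) : measurable_fun setT b ->
  Rintegral P setT (fun w => (b w)%:R) = fine (P [set w | b w]).
Proof.
move=> mb; have mB := measurable_set_bool mb; rewrite /Rintegral; congr fine.
rewrite -[in RHS](setIT [set w | b w]) -integral_indic //; apply: eq_integral => w _.
by rewrite indicE; case: (boolP (b w)) => bw; [rewrite mem_set|rewrite memNset //; apply/negP].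
Qed.

Lemma cE_bool (b : Omega -> bool) : measurable_fun setT b ->
  cintegral P setT (fun w => (b w)%:R : R[i]) = (fine (P [set w | b w]))%:C.
Proof.
move=> mb; rewrite -Rintegral_bool // -cI_real; apply: eq_cI => w.
by rewrite rmorph_nat.
Qed.

Lemma cabs_cE_bool_le (b : Omega -> bool) (f : Omega -> R[i]) : measurable_fun setT b -> cmeas f ->
  (forall w, cabs (f w) <= (b w)%:R) -> cabs (cintegral P setT f) <= fine (P [set w | b w]).
Proof.
move=> mb mf fb; rewrite -Rintegral_bool //; apply: cabs_cI_le => //.
have := integrable_cst P 1; apply: le_integrable => //.
  by apply/measurable_EFinP; exact: (@measurableT_comp _ _ _ _ _ _ (fun c : bool => c%:R : R) _ b).
by move=> w _ /=; rewrite lee_fin normr1; case: (b w); rewrite ?normr1 ?normr0.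
Qed.

End Indicator.

Section Poisson.
Context d (Omega : measurableType d) (R : realType) (P : probability Omega R).
Context (lambda : R) (T : nat -> Omega -> R).
Hypothesis mT : forall k, measurable_fun setT (T k).
Hypothesis hT : poisson_points P lambda T.
Hypothesis lambda_gt0 : 0 < lambda.
Local Notation N := (counting_process T).
Local Notation cE := (cintegral P setT).

Lemma measurable_N r : measurable_fun setT (N r).
Proof. by case: hT => *; exact: measurable_counting_process. Qed.

Lemma measurable_count_increment r s : measurable_fun setT (fun w => N r w - N s w)%N.
Proof. by apply: measurable_fun_subn; exact: measurable_N. Qed.

(** Split according to [X = 0], [X = 1] and [X > 1].  The last event has the
    probability [1 - e^-x - x e^-x], of order [x ^ 2], and the first two give the
    linear part. *)
Lemma poisson_pgf_first_order (X : Omega -> nat) (z : R[i]) (x : R) : measurable_fun setT X ->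
  cabs z <= 1 -> 0 < x -> (forall n, P [set w | X w = n] = (poisson_pmf x n)%:E) ->
  cabs (cE (fun w => z ^+ X w) - (1 - x%:C * (1 - z))) <= 3 * x ^+ 2.
Proof.
move=> mX z1 x0 XP.
have mb0 : measurable_fun setT (fun w => X w == 0%N).
  by apply: measurable_fun_eqn => //; exact: measurable_cst.
have mb1 : measurable_fun setT (fun w => X w == 1%N).
  by apply: measurable_fun_eqn => //; exact: measurable_cst.
have mb2 : measurable_fun setT (fun w => (1 < X w)%N).
  by apply: measurable_fun_ltn => //; exact: measurable_cst.
pose p n := poisson_pmf x n.
have p0E : p 0%N = expR (- x) by rewrite /p /poisson_pmf x0 expr0 mul1r fact0 invr1 mul1r.
have p1E : p 1%N = x * expR (- x) by rewrite /p /poisson_pmf x0 expr1 factS fact0 muln1 invr1 mulr1.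
have ebn n : fine (P [set w | X w == n]) = p n.
  by rewrite (_ : [set w | X w == n] = [set w | X w = n]) ?XP //; apply/seteqP; split => w /= /eqP.
pose p2 := fine (P [set w | (1 < X w)%N]).
have i0 : bmeas (fun w => (X w == 0%N)%:R : R[i]) by exact: bmeas_bool.
have i1 : bmeas (fun w => (X w == 1%N)%:R : R[i]) by exact: bmeas_bool.
have i2 : bmeas (fun w => (1 < X w)%N%:R : R[i]) by exact: bmeas_bool.
have tot : p 0%N + p 1%N + p2 = 1.
  apply: complexI; rewrite !rmorphD /= -!ebn -!cE_bool // -!cID; try exact: bmeas_cintble.
    by rewrite -[RHS](cE_cst P); apply: eq_cI => w; case: (X w) => [|[|n]] /=; rewrite ?addr0 ?add0r.
  by apply: bmeas_cintble; exact: bmeasD.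
have i3 : bmeas (fun w => z ^+ X w * (1 < X w)%N%:R).
  by apply: bmeasM => //; exact: bmeas_expn.
have -> : cE (fun w => z ^+ X w) = (p 0%N)%:C + z * (p 1%N)%:C + cE (fun w => z ^+ X w * (1 < X w)%N%:R).
  rewrite -!ebn -!cE_bool // -cIZ; last exact: bmeas_cintble.
  have i1' : bmeas (fun w => z * (X w == 1%N)%:R) by apply: bmeasM => //; exact: bmeas_cst.
  rewrite -!cID; try exact: bmeas_cintble; last by apply: bmeas_cintble; exact: bmeasD.
  apply: eq_cI => w; case: (X w) => [|[|n]] /=.
    by rewrite expr0 !mulr0 !addr0.
  by rewrite expr1 mulr1 mulr0 add0r addr0.
  by rewrite mulr0 !add0r mulr1.
have b3 : cabs (cE (fun w => z ^+ X w * (1 < X w)%N%:R)) <= p2.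
  apply: cabs_cE_bool_le => //; first exact: i3.1.
  move=> w; rewrite cabsM cabs_nat -[leRHS]mul1r ler_wpM2r //; exact: cabsX_le1.
have -> : (p 0%N)%:C + z * (p 1%N)%:C + cE (fun w => z ^+ X w * (1 < X w)%N%:R) - (1 - x%:C * (1 - z))
  = (p 0%N - 1 + x)%:C + z * (p 1%N - x)%:C + cE (fun w => z ^+ X w * (1 < X w)%N%:R).
  by rewrite !rmorphD !rmorphN /=; ring.
have h1 := expRN_ge x; have h2 := expRN_le_sq (ltW x0).
apply: (le_trans (cabsD _ _)).
have c1 : cabs ((p 0%N - 1 + x)%:C + z * (p 1%N - x)%:C) <= x ^+ 2 + x ^+ 2.
  apply: (le_trans (cabsD _ _)); apply: lerD.
    rewrite cabs_real p0E ger0_norm; lra.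
  rewrite cabsM cabs_real p1E -[leRHS]mul1r ler_pM ?cabs_ge0 ?normr_ge0 //.
  have e1 : expR (- x) <= 1 by rewrite expR_le1 oppr_le0 ltW.
  have -> : x * expR (- x) - x = - (x * (1 - expR (- x))) by ring.
  rewrite normrN ger0_norm ?mulr_ge0 ?(ltW x0) ?subr_ge0 // expr2 ler_wpM2l ?(ltW x0) //; lra.
have : p2 <= x ^+ 2 by rewrite -(addKr (p 0%N + p 1%N) p2) tot p0E p1E; nra.
lra.
Qed.

(** The subtraction of [N 0 w] is void only almost surely. *)
Definition count_pgf (z : R[i]) (h : R) := cE (fun w => z ^+ (N h w - N 0 w)%N).

Lemma count_pgf0 z : count_pgf z 0 = 1.
Proof. by rewrite /count_pgf; under eq_fun do rewrite subnn expr0; exact: cE_cst. Qed.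

Lemma count_increment_pgf z s r : cabs z <= 1 -> 0 <= s -> s <= r ->
  cE (fun w => z ^+ (N r w - N s w)%N) = count_pgf z (r - s).
Proof.
move=> z1 s0; rewrite le_eqVlt => /predU1P[->|sr].
  by rewrite subrr count_pgf0; under eq_fun do rewrite subnn expr0; exact: cE_cst.
apply: (@cE_same_law _ _ _ P _ _ (fun w => (N r w - N s w)%N) (fun w => (N (r - s) w - N 0 w)%N) (fun n => z ^+ n)).
- exact: measurable_count_increment.
- exact: measurable_count_increment.
- apply: nat_same_law; [exact: measurable_count_increment|exact: measurable_count_increment|].
  by move=> n; rewrite (poisson_law hT) // (poisson_law hT) // ?subr0 ?subr_gt0.
- by apply: bmeas_expn => //; exact: measurable_id.
Qed.

(** Three consecutive increments: up to the time [t], from [t] to the last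
    observation before the exit, and from there to the exit. *)
Lemma count_increments3_pgf z1 z2 z3 r1 r2 r3 : cabs z1 <= 1 -> cabs z2 <= 1 -> cabs z3 <= 1 ->
  0 <= r1 -> r1 <= r2 -> r2 <= r3 ->
  cE (fun w => z1 ^+ (N r1 w - N 0 w) * z2 ^+ (N r2 w - N r1 w) * z3 ^+ (N r3 w - N r2 w)) =
  count_pgf z1 r1 * count_pgf z2 (r2 - r1) * count_pgf z3 (r3 - r2).
Proof.
move=> h1 h2 h3 r10 r12 r23.
pose rr i := nth r3 [:: 0; r1; r2] i.
pose zz i := nth (1 : R[i]) [:: z1; z2; z3] i.
have zz1 i : cabs (zz i) <= 1 by rewrite /zz; case: i => [|[|[|[|i]]]] //=; rewrite ?cabs1 // nth_nil cabs1.
have rr0 : 0 <= rr 0%N by [].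
have rrm i : rr i <= rr i.+1 by case: i => [|[|[|i]]] //=; rewrite /rr /= ?nth_nil.
(* Beyond the three intervals of interest the sequence of times is constant, so
   the remaining increments are trivial. *)
have ind := poisson_independent_increments hT rr0 rrm.
have := @cE_prod_indep _ _ _ P nat _ nat _ _ ind [:: 0; 1; 2]%N (fun i n => zz i ^+ n) isT.
rewrite !big_cons !big_nil /= => H.
transitivity (cE (fun w => \prod_(i <- [:: 0; 1; 2]%N) (zz i ^+ (N (rr i.+1) w - N (rr i) w)))).
  by apply: eq_cI => w; rewrite !big_cons big_nil mulr1 mulrA.
rewrite H.
- have e0 := count_increment_pgf h1 (lexx 0) r10; rewrite subr0 in e0.
  have mul3 (a b c a' b' c' : R[i]) : a = a' -> b = b' -> c = c' -> a * (b * (c * 1)) = a' * b' * c'.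
    by move=> -> -> ->; rewrite mulr1 mulrA.
  exact: (mul3 _ _ _ _ _ _ e0 (count_increment_pgf h2 r10 r12) (count_increment_pgf h3 (le_trans r10 r12) r23)).
- by move=> i; exact: measurable_count_increment.
- by move=> i; apply: bmeas_expn => //; exact: measurable_id.
Qed.

Lemma count_pgfD z h1 h2 : cabs z <= 1 -> 0 <= h1 -> 0 <= h2 -> count_pgf z (h1 + h2) = count_pgf z h1 * count_pgf z h2.
Proof.
move=> z1 h10 h20.
have := @count_increments3_pgf z z 1 h1 (h1 + h2) (h1 + h2) z1 z1 _ h10 _ (lexx _).
rewrite cabs1 lerDl => /(_ (lexx _) h20); rewrite subrr count_pgf0 mulr1 addrAC subrr add0r => <-.
apply: eq_cI => w; rewrite expr1n mulr1 -exprD; congr (_ ^+ _).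
have m1 : (N 0 w <= N h1 w)%N by case: hT => *; exact: counting_process_mono.
have m2 : (N h1 w <= N (h1 + h2) w)%N by case: hT => *; apply: counting_process_mono => //; rewrite lerDl.
by rewrite addnC addnBA // subnK.
Qed.

Lemma cabs_count_pgf_le1 z h : cabs z <= 1 -> cabs (count_pgf z h) <= 1.
Proof.
move=> z1; apply: cabs_cE_le; last by move=> w; exact: cabsX_le1.
by apply: (cmeas_nat (fun n => z ^+ n)); exact: measurable_count_increment.
Qed.

Lemma count_pgfMn z h n : cabs z <= 1 -> 0 <= h -> count_pgf z (n%:R * h) = count_pgf z h ^+ n.
Proof.
move=> z1 h0; elim: n => [|n IH]; first by rewrite mul0r count_pgf0.
by rewrite -addn1 natrD mulrDl mul1r count_pgfD ?mulr_ge0 // IH exprD.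
Qed.

Lemma Re_1B_ge0 (z : R[i]) : cabs z <= 1 -> 0 <= complex.Re (1 - z).
Proof.
move=> z1; have := Re_le_cabs z; rewrite ler_norml Re_add Re_opp => /andP[_].
have -> : complex.Re (1 : R[i]) = 1 by [].
lra.
Qed.

Lemma Re_poisson_exponent (z : R[i]) (h : R) : cabs z <= 1 -> 0 <= h ->
  complex.Re (- (lambda%:C * (1 - z)) * h%:C) <= 0.
Proof.
move=> z1 h0; have := Re_1B_ge0 z1; set u := 1 - z => u0.
rewrite !Re_mul /= !mulr0 Re_opp Re_mul /= mul0r !subr0 mulNr oppr_le0.
by rewrite !mulr_ge0 // ltW.
Qed.

(** The function of time [count_pgf z] is multiplicative and has modulus at most
    1, as has the exponential.  Dividing [t] into [n] equal parts, the [n]-th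
    powers of the two values at [t / n] differ by at most [n] times the
    difference of these values, and that difference is [o(1 / n)] by the
    first-order expansions. *)
Lemma count_pgfE z t : cabs z <= 1 -> 0 <= t -> count_pgf z t = cexp (- (lambda%:C * (1 - z)) * t%:C).
Proof.
move=> z1; rewrite le_eqVlt => /predU1P[<-|t0]; first by rewrite count_pgf0 mulr0 cexp0.
set c := - (lambda%:C * (1 - z)).
apply: cabs_eq_le => e e0.
have et0 : 0 < e / 2 / t by rewrite !divr_gt0.
have [dl dl0 H] := cexp_first_order c et0.
(* [n] makes the step [h] small enough for [cexp_first_order], and makes the
   quadratic error of [poisson_pgf_first_order], summed over [n] steps, at most
   [e / 2]. *)
pose n := (maxn (Num.bound (t / dl)) (Num.bound (6 * lambda ^+ 2 * t ^+ 2 / e))).+1.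
have n0 : 0 < n%:R :> R by rewrite ltr0n.
have hn1 : t / dl < n%:R.
  apply: (lt_le_trans (archi_boundP _)); first by rewrite divr_ge0 // ltW.
  by rewrite ler_nat leqW // leq_maxl.
have hn2 : 6 * lambda ^+ 2 * t ^+ 2 / e < n%:R.
  apply: (lt_le_trans (archi_boundP _)); first by rewrite divr_ge0 ?(ltW e0) // !mulr_ge0 ?exprn_ge0 // ltW.
  by rewrite ler_nat leqW // leq_maxr.
pose h := t / n%:R.
have h0 : 0 < h by rewrite divr_gt0.
have th : t = n%:R * h by rewrite /h mulrC divfK // gt_eqF.
have hd : h < dl by rewrite /h ltr_pdivrMr // mulrC -ltr_pdivrMr.
rewrite {1}th (count_pgfMn _ z1 (ltW h0)).
have -> : c * t%:C = n%:R * (c * h%:C) by rewrite th rmorphM rmorph_nat mulrCA.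
rewrite cexpMn.
have c1 : cabs (cexp (c * h%:C)) <= 1 by apply: cabs_cexp_le1; exact: Re_poisson_exponent z1 (ltW h0).
apply: (le_trans (cabs_subX_le _ (cabs_count_pgf_le1 _ z1) c1)).
have lh0 : 0 < lambda * h by rewrite mulr_gt0.
have := @poisson_pgf_first_order (fun w => N h w - N 0 w)%N z (lambda * h) (measurable_count_increment _ _) z1 lh0.
rewrite -/(count_pgf z h) => F.
have {}F : cabs (count_pgf z h - (1 - (lambda * h)%:C * (1 - z))) <= 3 * (lambda * h) ^+ 2.
  by apply: F => k; rewrite (poisson_law hT) // subr0.
have {}H := H h h0 hd.
have E : count_pgf z h - cexp (c * h%:C) = (count_pgf z h - (1 - (lambda * h)%:C * (1 - z)))
   - (cexp (c * h%:C) - 1 - c * h%:C).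
  by rewrite /c [(lambda * h)%:C]rmorphM /=; ring.
have {}E : cabs (count_pgf z h - cexp (c * h%:C)) <= 3 * (lambda * h) ^+ 2 + e / 2 / t * h.
  by rewrite E; apply: (le_trans (cabsB _ _)); exact: lerD.
apply: (le_trans (ler_wpM2l (ltW n0) E)); rewrite mulrDr.
have -> : n%:R * (e / 2 / t * h) = e / 2 by rewrite [in LHS]th; field; rewrite !gt_eqF.
have -> : n%:R * (3 * (lambda * h) ^+ 2) = 3 * lambda ^+ 2 * t ^+ 2 / n%:R.
  by rewrite /h; field; rewrite gt_eqF.
have : 3 * lambda ^+ 2 * t ^+ 2 / n%:R <= e / 2.
  rewrite ler_pdivrMr //; move: hn2; rewrite ltr_pdivrMr //.
  have -> : 6 * lambda ^+ 2 * t ^+ 2 = 2 * (3 * lambda ^+ 2 * t ^+ 2) by ring.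
  set q := 3 * _ * _; lra.
lra.
Qed.

End Poisson.

(** * The marked process at fixed and at independent random times *)

Section Generators.
Context d (Omega : measurableType d).

Definition generators (I : Type) d' (E : measurableType d') (X : I -> Omega -> E) :=
  [set C | exists i B, measurable B /\ C = X i @^-1` B].

Lemma generators_measurable (I : Type) d' (E : measurableType d') (X : I -> Omega -> E) :
  (forall i, measurable_fun setT (X i)) -> generators X `<=` measurable.
Proof. by move=> mX _ [i [B [mB ->]]]; rewrite -[_ @^-1` _]setTI; exact: mX. Qed.

Lemma measurable_generators (I : Type) d' (E : measurableType d') (X : I -> Omega -> E) i :
  measurable_fun setT (X i : g_sigma_algebraType (generators X) -> E).
Proof. by apply: measurable_sub => B mB; exists i, B. Qed.

End Generators.

Section Compound.
Context d (Omega : measurableType d) (R : realType) (P : probability Omega R).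
Context (lambda : R) (T : nat -> Omega -> R) (a : nat -> Omega -> nat).
Hypothesis mT : forall k, measurable_fun setT (T k).
Hypothesis ma : forall k, measurable_fun setT (a k).
Hypothesis hT : poisson_points P lambda T.
Hypothesis ha : position_independent_marking P T a.
Hypothesis lambda_gt0 : 0 < lambda.
Local Notation N := (counting_process T).
Local Notation A := (marked_process T a).
Local Notation cE := (cintegral P setT).
Local Notation g := (pgf P (a 1%N)).

Lemma cabs_pgf_le1 z : cabs z <= 1 -> cabs (g z) <= 1.
Proof.
move=> z1; apply: cabs_cE_le; last by move=> w; exact: cabsX_le1.
by apply: (cmeas_nat (fun n => z ^+ n)); exact: ma.
Qed.

Lemma pgf1 : g 1 = 1.
Proof.
by rewrite /pgf /cexpectation -[RHS](cE_cst P); apply: eq_cI => w; rewrite expr1n.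
Qed.

(** Only the monomials of positive degree change between 0 and [z]. *)
Lemma pgf_near0 z : cabs z <= 1 -> cabs (g z - g 0) <= cabs z.
Proof.
move=> z1.
have c0 : cabs (0 : R[i]) <= 1 by rewrite cabs0.
rewrite /pgf /cexpectation -cIB; try by apply: bmeas_cintble; exact: bmeas_expn.
apply: cabs_cE_le.
  by apply: cmeasB; [exact: (cmeas_nat (fun n => z ^+ n))|exact: (cmeas_nat (fun n => 0 ^+ n))].
move=> o; case: (a 1%N o) => [|n]; first by rewrite !expr0 subrr cabs0 cabs_ge0.
by rewrite expr0n subr0 exprS cabsM -[leRHS]mulr1 ler_wpM2l ?cabs_ge0 // cabsX_le1.
Qed.

Lemma marks_pgf k z : cabs z <= 1 -> cE (fun w => z ^+ a k w) = g z.
Proof.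
move=> z1; apply: (@cE_same_law _ _ _ P _ _ (a k) (a 1%N) (fun n => z ^+ n)) => //.
  exact: (marks_same_law ha).
by apply: bmeas_expn => //; exact: measurable_id.
Qed.

Let S (n : nat) (w : Omega) := (\sum_(k < n) a k w)%N.

Let S_sub n m w : (n <= m)%N -> (S m w - S n w)%N = (\sum_(n <= k < m) a k w)%N.
Proof.
move=> nm; rewrite /S -!(big_mkord xpredT (a ^~ w)).
by rewrite (@big_cat_nat _ _ _ n) //= addKn.
Qed.

Lemma marks_blocks_pgf z1 z2 z3 n1 n2 n3 : cabs z1 <= 1 -> cabs z2 <= 1 -> cabs z3 <= 1 ->
  (n1 <= n2)%N -> (n2 <= n3)%N ->
  cE (fun w => z1 ^+ S n1 w * z2 ^+ (S n2 w - S n1 w) * z3 ^+ (S n3 w - S n2 w)) =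
  g z1 ^+ n1 * g z2 ^+ (n2 - n1) * g z3 ^+ (n3 - n2).
Proof.
move=> h1 h2 h3 n12 n23.
pose ze k := if (k < n1)%N then z1 else if (k < n2)%N then z2 else z3.
have ze1 k : cabs (ze k) <= 1 by rewrite /ze; case: ifP => // _; case: ifP.
have split_prod (F : nat -> R[i]) (G : R[i] -> nat -> R[i]) :
    (forall k, F k = G (ze k) k) ->
  \prod_(0 <= k < n3) F k = \prod_(0 <= k < n1) G z1 k
    * \prod_(n1 <= k < n2) G z2 k * \prod_(n2 <= k < n3) G z3 k.
  move=> FG; rewrite (@big_cat_nat _ _ _ n2) //= (@big_cat_nat _ _ _ n1) //=.
  congr (_ * _ * _); apply: eq_big_nat => k /andP[k1 k2]; rewrite FG /ze.
  - by rewrite k2.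
  - by rewrite ltnNge k1 k2.
  - by rewrite ltnNge (leq_trans n12 k1) /= ltnNge k1.
transitivity (cE (fun w => \prod_(k <- index_iota 0 n3) ze k ^+ a k w)).
  apply: eq_cI => w.
  rewrite (split_prod (fun k => ze k ^+ a k w) (fun z k => z ^+ a k w)) //.
  by rewrite !S_sub // /S -(big_mkord xpredT (a ^~ w)) !expr_sum.
rewrite (@cE_prod_indep _ _ _ P nat _ nat a ma (marks_independent ha) (index_iota 0 n3) (fun k n => ze k ^+ n)); last 2 first.
- exact: iota_uniq.
- by move=> k; apply: bmeas_expn => //; exact: measurable_id.
rewrite (split_prod (fun k => cE (fun w => ze k ^+ a k w)) (fun z _ => g z)).
  by rewrite !prodr_const_nat subn0.
by move=> k; exact: marks_pgf.
Qed.

Lemma measurable_A r : measurable_fun setT (A r).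
Proof. by case: hT => *; exact: measurable_marked_process. Qed.

Lemma A_mono w r r' : r <= r' -> (A r w <= A r' w)%N.
Proof. by move=> rr; case: hT => *; exact: marked_process_mono. Qed.

(** Given the points, the increments of [A] are sums over consecutive blocks of
    marks; taking the expectation over the marks first replaces each [z] by
    [g z] and [A] by the counting process. *)
Lemma marked_increments_pgf z1 z2 z3 r1 r2 r3 : cabs z1 <= 1 -> cabs z2 <= 1 -> cabs z3 <= 1 ->
  0 <= r1 -> r1 <= r2 -> r2 <= r3 ->
  cE (fun w => z1 ^+ A r1 w * z2 ^+ (A r2 w - A r1 w) * z3 ^+ (A r3 w - A r2 w)) =
  cexp (- (lambda%:C * (1 - g z1)) * r1%:C) * cexp (- (lambda%:C * (1 - g z2)) * (r2 - r1)%:C)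
   * cexp (- (lambda%:C * (1 - g z3)) * (r3 - r2)%:C).
Proof.
move=> h1 h2 h3 r10 r12 r23.
have [T0 Tord Tlf _ _ _] := hT.
have mN r : measurable_fun setT (N r : g_sigma_algebraType (generators T) -> nat).
  apply: (@measurable_counting_process _ (g_sigma_algebraType (generators T)) R T) => // k.
  exact: measurable_generators.
have mS r : measurable_fun setT (fun p : g_sigma_algebraType (generators T) * g_sigma_algebraType (generators a) => S (N r p.1) p.2).
  apply: (@measurable_nat_select _ (g_sigma_algebraType (generators T) * g_sigma_algebraType (generators a))%type _ nat (fun p => N r p.1) (fun n p => S n p.2)).
    exact: (measurableT_comp (mN r) measurable_fst).
  move=> n; apply: (@measurable_sum_ord _ (g_sigma_algebraType (generators T) * g_sigma_algebraType (generators a))%type n (fun k p => a k p.2)) => k.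
  exact: (measurableT_comp (@measurable_generators _ _ _ _ _ a k) measurable_snd).
pose f (p : g_sigma_algebraType (generators T) * g_sigma_algebraType (generators a)) :=
  z1 ^+ S (N r1 p.1) p.2 * z2 ^+ (S (N r2 p.1) p.2 - S (N r1 p.1) p.2)
   * z3 ^+ (S (N r3 p.1) p.2 - S (N r2 p.1) p.2).
have bf : bmeas f.
  apply: bmeasM; first apply: bmeasM.
  - exact: bmeas_expn.
  - by apply: bmeas_expn => //; exact: measurable_fun_subn.
  - by apply: bmeas_expn => //; exact: measurable_fun_subn.
transitivity (cE (fun w => f (w, w))).
  by apply: eq_cI => w; rewrite /f /= /S !marked_processE.
rewrite cE_indep_sigma //; last 3 first.
- exact: generators_measurable.
- exact: generators_measurable.
- by move=> C D GC GD; rewrite setIC muleC; exact: (marks_indep_points ha).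
have g1 := cabs_pgf_le1 h1; have g2 := cabs_pgf_le1 h2; have g3 := cabs_pgf_le1 h3.
have mN' r : measurable_fun setT (N r) by exact: measurable_counting_process.
transitivity (cE (fun w => g z1 ^+ (N r1 w - N 0 w) * g z2 ^+ (N r2 w - N r1 w) * g z3 ^+ (N r3 w - N r2 w))).
  transitivity (cE (fun w => g z1 ^+ N r1 w * g z2 ^+ (N r2 w - N r1 w) * g z3 ^+ (N r3 w - N r2 w))).
    apply: eq_cI => w; rewrite /f /=; apply: marks_blocks_pgf => //; exact: counting_process_mono.
  apply: (@eq_cE_full_event _ _ _ P _ _ [set w | N 0 w = 0%N]).
  - by apply: bmeasM; first apply: bmeasM; apply: bmeas_expn => //; exact: measurable_fun_subn.
  - by apply: bmeasM; first apply: bmeasM; apply: bmeas_expn => //; exact: measurable_fun_subn.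
  - by rewrite (_ : [set w | _] = N 0 @^-1` [set 0%N]) // -[_ @^-1` _]setTI; exact: mN'.
  - exact: (poisson_at0 hT).
  - by move=> w /= ->; rewrite subn0.
have r21 : 0 <= r2 - r1 by rewrite subr_ge0.
have r32 : 0 <= r3 - r2 by rewrite subr_ge0.
exact: (etrans (count_increments3_pgf mT hT g1 g2 g3 r10 r12 r23)
  (congr2 *%R (congr2 *%R (count_pgfE mT hT lambda_gt0 g1 r10) (count_pgfE mT hT lambda_gt0 g2 r21))
    (count_pgfE mT hT lambda_gt0 g3 r32))).
Qed.

Section RandomTimes.
Context (tau : nat -> Omega -> R).
Hypothesis mtau : forall n, measurable_fun setT (tau n).
Hypothesis hindep : independent_families P tau A.
Local Notation Omtau := (g_sigma_algebraType (generators tau)).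

(** Conditioning on the observation times: [A] is jointly measurable for the product
    of the sigma-algebras of [tau] and of [A], so the expectation can be taken
    first over [A] with [tau] fixed, where the times are constants. *)
Lemma marked_random_increments_pgf (b : Omtau -> R[i]) (r1 r2 r3 : Omtau -> R) z1 z2 z3 :
  bmeas b -> measurable_fun setT r1 -> measurable_fun setT r2 -> measurable_fun setT r3 ->
  (forall w, 0 <= r1 w) -> (forall w, r1 w <= r2 w) -> (forall w, r2 w <= r3 w) ->
  cabs z1 <= 1 -> cabs z2 <= 1 -> cabs z3 <= 1 ->
  cE (fun w => b w * (z1 ^+ A (r1 w) w * z2 ^+ (A (r2 w) w - A (r1 w) w) * z3 ^+ (A (r3 w) w - A (r2 w) w))) =
  cE (fun w => b w * (cexp (- (lambda%:C * (1 - g z1)) * (r1 w)%:C)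
     * cexp (- (lambda%:C * (1 - g z2)) * (r2 w - r1 w)%:C)
     * cexp (- (lambda%:C * (1 - g z3)) * (r3 w - r2 w)%:C))).
Proof.
move=> bb m1 m2 m3 r10 r12 r23 h1 h2 h3.
have [T0 Tord Tlf _ _ _] := hT.
pose OA := g_sigma_algebraType (generators A).
have mA : measurable_fun setT (fun p : R * OA => A p.1 p.2).
  apply: (@measurable_right_continuous R _ OA A).
  - by move=> r; exact: measurable_generators.
  - by move=> w r r'; exact: A_mono.
  - by move=> w r; exact: marked_process_right.
have mAr r : measurable_fun setT r -> measurable_fun setT (fun p : Omtau * OA => A (r p.1) p.2).
  move=> mr; apply: (measurableT_comp mA (g := fun p : Omtau * OA => (r p.1, p.2))).
  apply: measurable_fun_pair; last exact: measurable_snd.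
  exact: (measurableT_comp mr measurable_fst).
pose f (p : Omtau * OA) := b p.1 * (z1 ^+ A (r1 p.1) p.2 * z2 ^+ (A (r2 p.1) p.2 - A (r1 p.1) p.2) * z3 ^+ (A (r3 p.1) p.2 - A (r2 p.1) p.2)).
have bf0 : bmeas (fun p : Omtau * OA => z1 ^+ A (r1 p.1) p.2 * z2 ^+ (A (r2 p.1) p.2 - A (r1 p.1) p.2) * z3 ^+ (A (r3 p.1) p.2 - A (r2 p.1) p.2)).
  apply: bmeasM; first apply: bmeasM.
  - by apply: bmeas_expn => //; exact: mAr.
  - by apply: bmeas_expn => //; apply: measurable_fun_subn; exact: mAr.
  - by apply: bmeas_expn => //; apply: measurable_fun_subn; exact: mAr.
have bf : bmeas f.
  apply: bmeasM => //; exact: (bmeas_comp (measurable_fst) bb).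
transitivity (cE (fun w => f (w, w))); first by [].
rewrite (@cE_indep_sigma _ _ _ P (generators tau) (generators A) f) //; last 2 first.
- exact: generators_measurable.
- by apply: generators_measurable => r; exact: measurable_A.
apply: eq_cI => w; rewrite /f /= cIZ ?marked_increments_pgf //.
apply: bmeas_cintble.
have mAw r : measurable_fun setT (A r) by exact: measurable_A.
apply: bmeasM; first apply: bmeasM.
- exact: bmeas_expn.
- by apply: bmeas_expn => //; exact: measurable_fun_subn.
- by apply: bmeas_expn => //; exact: measurable_fun_subn.
Qed.

End RandomTimes.
End Compound.

(** * Integrals over time *)

Section TimeIntegral.
Context {R : realType}.
Local Notation leb := (@lebesgue_measure R).

Lemma Rintegral_FTC (f F : R -> R) (r : R) : 0 <= r ->
  (forall t : R, is_derive t (1 : R) F (f t)) -> continuous f ->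
  Rintegral leb setT (fun t => ((0 <= t) && (t < r))%:R * f t) = F r - F 0.
Proof.
move=> r0 dF cf.
have cF : continuous F.
  by move=> t; apply: differentiable_continuous; apply/derivable1_diffP; exact: (@ex_derive _ _ _ _ _ _ _ (dF t)).
have -> : Rintegral leb setT (fun t => ((0 <= t) && (t < r))%:R * f t) = Rintegral leb `[0, r[ f.
  rewrite [RHS]Rintegral_mkcond; congr Rintegral; apply/funext => t; rewrite patchE.
  case: (boolP ((0 <= t) && (t < r))) => h; first by rewrite mem_set ?mul1r //= in_itv.
  by rewrite memNset ?mul0r //= in_itv; exact/negP.
rewrite /Rintegral integral_itv_bndo_bndc; last first.
  by apply/measurable_EFinP; apply: measurable_funTS; exact: continuous_measurable_fun.
move: r0; rewrite le_eqVlt => /predU1P[<-|r0].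
  by rewrite set_itv1 integral_set1 subrr.
rewrite (@continuous_FTC2 _ f F 0 r) //.
- exact: continuous_subspaceT.
- split.
  + by move=> t _; exact: (@ex_derive _ _ _ _ _ _ _ (dF t)).
  + by apply/cvg_at_right_filter; exact: cF.
  + by apply/cvg_at_left_filter; exact: cF.
- by move=> t _; rewrite derive1E; exact: (@derive_val _ _ _ _ _ _ _ (dF t)).
Qed.

Lemma continuous_Re_cexp (c : R[i]) : continuous (fun t : R => complex.Re (cexp (c * t%:C))).
Proof.
move=> t; apply: differentiable_continuous; apply/derivable1_diffP.
exact: (@ex_derive _ _ _ _ _ _ _ (is_derive_Re_cexp c t)).
Qed.

Lemma continuous_Im_cexp (c : R[i]) : continuous (fun t : R => complex.Im (cexp (c * t%:C))).
Proof.
move=> t; apply: differentiable_continuous; apply/derivable1_diffP.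
exact: (@ex_derive _ _ _ _ _ _ _ (is_derive_Im_cexp c t)).
Qed.

Lemma is_derive_lincomb (F G : R -> R) (p q b c t : R) :
  is_derive t (1 : R) F p -> is_derive t (1 : R) G q ->
  is_derive t (1 : R) (fun t => b * F t + c * G t) (b * p + c * q).
Proof.
move=> dF dG; exact: (is_deriveD (is_deriveZ b dF) (is_deriveZ c dG)).
Qed.

(** The fundamental theorem of calculus for each coordinate of the primitive
    [- c^-1 * cexp (- c * t)]. *)
Lemma cI_exp_segment (c : R[i]) (r : R) : c != 0 -> 0 <= r ->
  cintegral leb setT (fun t : R => ((0 <= t) && (t < r))%:R * cexp (- c * t%:C)) =
  c^-1 * (1 - cexp (- c * r%:C)).
Proof.
move=> c0 r0.
have bRe (b : bool) (z : R[i]) : complex.Re (b%:R * z) = b%:R * complex.Re z.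
  by case: b; rewrite ?mul1r ?mul0r.
have bIm (b : bool) (z : R[i]) : complex.Im (b%:R * z) = b%:R * complex.Im z.
  by case: b; rewrite ?mul1r ?mul0r.
pose k := - c^-1.
have kc (z : R[i]) : k * (- c * z) = z by rewrite /k mulrA mulrNN mulVf // mul1r.
have -> : c^-1 * (1 - cexp (- c * r%:C)) = k * cexp (- c * r%:C) - k * cexp (- c * 0%:C).
  by rewrite mulr0 cexp0 /k; ring.
rewrite /cintegral; apply: complex_ext; rewrite ?Re_add ?Im_add ?Re_opp ?Im_opp /=.
  under eq_fun do rewrite bRe.
  apply: (@Rintegral_FTC _ (fun t : R => complex.Re (k * cexp (- c * t%:C)))) => //; last exact: continuous_Re_cexp.
  move=> t.
  have -> : (fun t : R => complex.Re (k * cexp (- c * t%:C))) =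
    (fun t => complex.Re k * complex.Re (cexp (- c * t%:C)) + (- complex.Im k) * complex.Im (cexp (- c * t%:C))).
    by apply/funext => q; rewrite Re_mul; congr (_ + _); exact/esym/mulNr.
  have -> : complex.Re (cexp (- c * t%:C)) = complex.Re k * complex.Re (- c * cexp (- c * t%:C))
      + (- complex.Im k) * complex.Im (- c * cexp (- c * t%:C)) by rewrite [- complex.Im k * _]mulNr -Re_mul kc.
  exact: (is_derive_lincomb _ _ (is_derive_Re_cexp (- c) t) (is_derive_Im_cexp (- c) t)).
under eq_fun do rewrite bIm.
apply: (@Rintegral_FTC _ (fun t : R => complex.Im (k * cexp (- c * t%:C)))) => //; last exact: continuous_Im_cexp.
move=> t.
have -> : (fun t : R => complex.Im (k * cexp (- c * t%:C))) =
  (fun t => complex.Re k * complex.Im (cexp (- c * t%:C)) + complex.Im k * complex.Re (cexp (- c * t%:C))).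
  by apply/funext => q; rewrite Im_mul.
have -> : complex.Im (cexp (- c * t%:C)) = complex.Re k * complex.Im (- c * cexp (- c * t%:C))
    + complex.Im k * complex.Re (- c * cexp (- c * t%:C)) by rewrite -Im_mul kc.
exact: (is_derive_lincomb _ _ (is_derive_Im_cexp (- c) t) (is_derive_Re_cexp (- c) t)).
Qed.

(** The modulus of [exp (- theta t)] on the half-line for [Th = Re theta], which
    dominates all integrands in [t].  Written with the exponential density, its
    integral is known. *)
Definition damping (Th t : R) := Th^-1 * exponential_pdf Th t.

Lemma dampingE Th t : 0 < Th -> damping Th t = (0 <= t)%R%:R * expR (- Th * t).
Proof.
move=> Th0; rewrite /damping; case: (lerP 0 t) => t0.
  by rewrite exponential_pdfE // mulrA mulVf ?gt_eqF.
by rewrite lt0_exponential_pdf // mulr0 mul0r.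
Qed.

Lemma damping_ge0 Th t : 0 < Th -> 0 <= damping Th t.
Proof. by move=> Th0; rewrite dampingE // mulr_ge0 // expR_ge0. Qed.

Lemma integrable_damping Th : 0 < Th -> leb.-integrable setT (EFin \o damping Th).
Proof.
move=> Th0; have := integrableZl measurableT Th^-1 (integrable_exponential_pdf Th0).
by apply: eq_integrable.
Qed.

Lemma Rintegral_damping Th : 0 < Th -> Rintegral leb setT (damping Th) = Th^-1.
Proof.
move=> Th0; rewrite /damping RintegralZl //; last exact: integrable_exponential_pdf.
by rewrite /Rintegral integral_exponential_pdf // mulr1.
Qed.

Context d (Omega : measurableType d) (P : probability Omega R).

Lemma integrable_damping_prod Th : 0 < Th ->
  (leb \x P)%E.-integrable setT (EFin \o (fun p : R * Omega => damping Th p.1)).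
Proof.
move=> Th0.
have mh : measurable_fun setT (fun p : R * Omega => damping Th p.1).
  apply: (measurableT_comp (f := damping Th) _ measurable_fst).
  by apply/measurable_EFinP; exact: measurable_int (integrable_damping Th0).
apply/integrable12ltyP; first exact/measurable_EFinP.
under eq_integral => x _.
  rewrite (_ : (\int[P]_y _)%E = `|(damping Th x)%:E|%E); last first.
    by rewrite /= integral_cst //= probability_setT mule1.
  over.
by have /integrableP[] := integrable_damping Th0.
Qed.

Lemma Rintegral_damping_prod Th : 0 < Th ->
  Rintegral (leb \x P)%E setT (fun p : R * Omega => damping Th p.1) = Th^-1.
Proof.
move=> Th0; rewrite /Rintegral.
rewrite -(integral12_prod_meas1 (integrable_damping_prod Th0)) /fubini_F.
rewrite -(Rintegral_damping Th0) /Rintegral; congr fine; apply: eq_integral => x _.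
by rewrite /= integral_cst //= probability_setT mule1.
Qed.

End TimeIntegral.

(** * Geometric sums *)

Section Geometric.
Context {R : realType}.

Lemma cabs_geometric_tail (q : R[i]) (a : R[i]) : cabs q < 1 -> forall e : R, 0 < e ->
  exists N0, forall N, (N0 <= N)%N -> cabs (\sum_(m < N) a * q ^+ m - a / (1 - q)) <= e.
Proof.
move=> q1 e e0.
have q1' : 1 - q != 0 by rewrite subr_eq0; apply: contraTneq q1 => <-; rewrite cabs1 ltxx.
(* The remainder of the series is itself a geometric term. *)
have E N : \sum_(m < N) a * q ^+ m - a / (1 - q) = - (a / (1 - q)) * q ^+ N.
  have h : (1 - q) * \sum_(m < N) q ^+ m = 1 - q ^+ N.
    by rewrite -opprB mulNr -subrX1 opprB.
  have -> : \sum_(m < N) a * q ^+ m = a / (1 - q) * (1 - q ^+ N).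
    by rewrite -h -mulr_sumr mulrA divfK.
  by ring.
pose B := cabs (a / (1 - q)).
have B0 : 0 <= B by exact: cabs_ge0.
have : geometric (B : R) (cabs q) @ \oo --> (0 : R).
  by apply: cvg_geometric; rewrite ger0_norm ?cabs_ge0.
move=> /cvgrPdist_le /(_ e e0) [N0 _ H]; exists N0 => N NN.
have := H N NN; rewrite /= sub0r normrN => h.
by rewrite E cabsM cabsN cabsX -/B; apply: le_trans h; exact: ler_norm.
Qed.

(** With [i] and [j] two successive observed values, the index [k] runs over the
    thresholds [k.+1] that are crossed between them. *)
Lemma geometric_window (s : R[i]) i j L : s != 1 -> (i <= j)%N -> (j <= L)%N ->
  (s ^+ i - s ^+ j) / (1 - s) = \sum_(k < L) s ^+ k * ((i <= k) && (k < j))%N%:R.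
Proof.
move=> s1 ij jL.
have s0 : 1 - s != 0 by rewrite subr_eq0 eq_sym.
have W n : (n <= L)%N -> \sum_(k < L) s ^+ k * (k < n)%N%:R = (1 - s ^+ n) / (1 - s).
  move=> nL; have -> : \sum_(k < L) s ^+ k * (k < n)%N%:R = \sum_(k < n) s ^+ k.
    rewrite (big_ord_widen _ (fun k => s ^+ k) nL) [RHS]big_mkcond; apply: eq_bigr => k _.
    by case: ifP; rewrite ?mulr1 ?mulr0.
  have h : (1 - s) * \sum_(m < n) s ^+ m = 1 - s ^+ n.
    by rewrite -opprB mulNr -subrX1 opprB.
  by rewrite -h mulrAC divff // mul1r.
have -> : \sum_(k < L) s ^+ k * ((i <= k) && (k < j))%N%:R =
   \sum_(k < L) s ^+ k * (k < j)%N%:R - \sum_(k < L) s ^+ k * (k < i)%N%:R.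
  rewrite -sumrB; apply: eq_bigr => k _; rewrite -mulrBr; congr (_ * _).
  case: (ltnP k i) => ki; last by rewrite subr0.
  by rewrite (leq_trans ki ij) subrr.
rewrite !W // ?(leq_trans ij) //; field; exact: s0.
Qed.

End Geometric.

(* From here on integrals and generating functions are handled through the
   lemmas above only; unification must not unfold them. *)
#[local] Opaque cintegral pgf.

(* Regroupings of exponential factors, stated apart so that they are proved by
   computation in the exponents alone. *)
Section ExpMerge.
Context {R : realType}.

Lemma cexp_merge_first (th rz ro : R[i]) (r r1 r2 : R) : ro = 0 ->
  cexp (- th * r%:C) * (cexp (- rz * r%:C) * cexp (- ro * r1%:C) * cexp (- ro * r2%:C)) =
  cexp (- (th + rz) * r%:C).
Proof.
by move=> ->; rewrite oppr0 !mul0r !cexp0 !mulr1 -cexpD; congr cexp; ring.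
Qed.

Lemma cexp_merge_last (th rz ro : R[i]) (r r1 r2 : R) : ro = 0 ->
  cexp (- th * r%:C) * (cexp (- ro * r1%:C) * cexp (- ro * r2%:C) * cexp (- rz * r%:C)) =
  cexp (- (th + rz) * r%:C).
Proof.
by move=> ->; rewrite oppr0 !mul0r !cexp0 !mul1r -cexpD; congr cexp; ring.
Qed.

Lemma cexp_segment_split (th rz rz' : R[i]) (t r : R) :
  cexp (- th * t%:C) * (cexp (- rz' * t%:C) * cexp (- rz * (r - t)%:C)) =
  cexp (- rz * r%:C) * cexp (- (th + rz' - rz) * t%:C).
Proof. by rewrite -!cexpD; congr cexp; rewrite rmorphB /=; ring. Qed.

Lemma cexp_segment_ends (th w rz rz' : R[i]) (r : R) :
  cexp (- rz * r%:C) * cexp (- w * r%:C) * (1 - cexp (- (th + rz' - rz) * r%:C)) =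
  cexp (- (w + rz) * r%:C) - cexp (- (th + w + rz') * r%:C).
Proof. by rewrite -cexpD mulrBr mulr1 -cexpD; congr (cexp _ - cexp _); ring. Qed.

Lemma cexp_kernel_merge (i w x r1 r2 r3 : R[i]) (t r D : R) :
  i * cexp (- w * r%:C) * cexp (- x * D%:C) *
    (cexp (- r1 * t%:C) * cexp (- r2 * (r - t)%:C) * cexp (- r3 * D%:C)) =
  i * (cexp (- r1 * t%:C) * cexp (- r2 * (r - t)%:C) * cexp (- w * r%:C) * cexp (- (x + r3) * D%:C)).
Proof.
have -> : - (x + r3) * D%:C = - x * D%:C + - r3 * D%:C by ring.
by rewrite [cexp (_ + _)]cexpD; ring.
Qed.

End ExpMerge.

Section Observed.
Context d (Omega : measurableType d) (R : realType) (P : probability Omega R).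
Context (lambda : R) (T : nat -> Omega -> R) (a : nat -> Omega -> nat) (tau : nat -> Omega -> R).
Hypothesis mT : forall k, measurable_fun setT (T k).
Hypothesis ma : forall k, measurable_fun setT (a k).
Hypothesis mtau : forall n, measurable_fun setT (tau n).
Hypothesis hT : poisson_points P lambda T.
Hypothesis ha : position_independent_marking P T a.
Hypothesis htau : delayed_renewal P tau.
Hypothesis lambda_gt0 : 0 < lambda.
Local Notation A := (marked_process T a).
Hypothesis hindep : independent_families P tau A.
Local Notation cE := (cintegral P setT).
Local Notation leb := (@lebesgue_measure R).
Local Notation g := (pgf P (a 1%N)).
Local Notation Omtau := (g_sigma_algebraType (generators tau)).

(** The Laplace transform of [Delta n]. *)
Definition laplace_Delta n (c : R[i]) := cE (fun w => cexp (- c * (Delta tau n w)%:C)).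

(** The Laplace exponent of the compound Poisson process at [z]. *)
Definition mark_rate (z : R[i]) := lambda%:C * (1 - g z).

Lemma mark_rate1 : mark_rate 1 = 0.
Proof. by rewrite /mark_rate pgf1 subrr mulr0. Qed.

Lemma Re_mark_rate_ge0 z : cabs z <= 1 -> 0 <= complex.Re (mark_rate z).
Proof.
move=> z1; have := Re_1B_ge0 (cabs_pgf_le1 P ma z1); rewrite /mark_rate; set q := 1 - _ => q0.
by rewrite Re_mul /= mul0r subr0 mulr_ge0 // ltW.
Qed.

Lemma Re_expo_le0 (c : R[i]) (r : R) : 0 <= complex.Re c -> 0 <= r -> complex.Re (- c * r%:C) <= 0.
Proof. by move=> c0 r0; rewrite Re_mul Re_opp /= mulr0 subr0 mulNr oppr_le0 mulr_ge0. Qed.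

Lemma tauS n w : tau n.+1 w = tau n w + Delta tau n.+1 w.
Proof. by rewrite /Delta /tau_prev /=; ring. Qed.

Lemma tau0E w : tau 0%N w = Delta tau 0 w.
Proof. by rewrite /Delta /tau_prev /= subr0. Qed.

Lemma tau_sum n w : tau n w = \sum_(k < n.+1) Delta tau k w.
Proof.
elim: n => [|n IH]; first by rewrite big_ord1 tau0E.
by rewrite big_ord_recr /= -IH tauS.
Qed.

Lemma tau_ge0 n w : 0 <= tau n w.
Proof. by rewrite tau_sum; apply: sumr_ge0 => k _; exact: (Delta_ge0 htau). Qed.

Lemma tau_leS n w : tau n w <= tau n.+1 w.
Proof. by rewrite tauS lerDl (Delta_ge0 htau). Qed.

Lemma mtau_sub n : measurable_fun setT (tau n : Omtau -> R).
Proof. exact: measurable_generators. Qed.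

Lemma measurable_Delta_sub n : measurable_fun setT (Delta tau n : Omtau -> R).
Proof.
apply: measurable_funB; first exact: mtau_sub.
by case: n => [|n]; [exact: measurable_cst|exact: mtau_sub].
Qed.

Lemma measurable_Delta n : measurable_fun setT (Delta tau n).
Proof.
apply: measurable_funB; first exact: mtau.
by case: n => [|n]; [exact: measurable_cst|exact: mtau].
Qed.

Lemma bmeas_cexp_real dd (T' : measurableType dd) (c : R[i]) (r : T' -> R) : 0 <= complex.Re c ->
  measurable_fun setT r -> (forall w, 0 <= r w) -> bmeas (fun w => cexp (- c * (r w)%:C)).
Proof.
move=> c0 mr r0; apply: bmeas_cexp; last by move=> w; exact: Re_expo_le0.
by apply: cmeasM; [exact: cmeas_cst|exact: cmeas_real].
Qed.

(** Conditioning with two empty intervals after [tau 0]. *)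
Lemma gamma_first z th : cabs z <= 1 -> 0 <= complex.Re th ->
  gamma_ P A tau 0 z th = laplace_Delta 0 (th + mark_rate z).
Proof.
move=> z1 th0.
have c1 : cabs (1 : R[i]) <= 1 by rewrite cabs1.
have h := @marked_random_increments_pgf _ Omega R P lambda T a mT ma hT ha lambda_gt0 tau mtau hindep
  (fun w => cexp (- th * (Delta tau 0 w)%:C)) (tau 0%N) (tau 0%N) (tau 0%N) z 1 1.
rewrite /gamma_ /cexpectation /laplace_Delta.
transitivity (cE (fun w => cexp (- th * (Delta tau 0 w)%:C) * (z ^+ A (tau 0%N w) w * 1 ^+ (A (tau 0%N w) w - A (tau 0%N w) w) * 1 ^+ (A (tau 0%N w) w - A (tau 0%N w) w)))).
  by apply: eq_cI => w; rewrite /X_obs /A_obs /A_prev /= subn0 !expr1n !mulr1 mulrC.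
rewrite h //; last 5 first.
- by apply: bmeas_cexp_real => //; [exact: measurable_Delta_sub|move=> w; exact: (Delta_ge0 htau)].
- exact: mtau_sub.
- exact: mtau_sub.
- exact: mtau_sub.
- by move=> w; exact: tau_ge0.
by apply: eq_cI => w; rewrite tau0E; exact: (cexp_merge_first _ _ _ _ _ mark_rate1).
Qed.

(** Conditioning with the increment over [[tau n, tau n.+1]] alone. *)
Lemma gamma_next n z th : cabs z <= 1 -> 0 <= complex.Re th ->
  gamma_ P A tau n.+1 z th = laplace_Delta n.+1 (th + mark_rate z).
Proof.
move=> z1 th0.
have c1 : cabs (1 : R[i]) <= 1 by rewrite cabs1.
have h := @marked_random_increments_pgf _ Omega R P lambda T a mT ma hT ha lambda_gt0 tau mtau hindep
  (fun w => cexp (- th * (Delta tau n.+1 w)%:C)) (tau n) (tau n) (tau n.+1) 1 1 z.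
rewrite /gamma_ /cexpectation /laplace_Delta.
transitivity (cE (fun w => cexp (- th * (Delta tau n.+1 w)%:C) * (1 ^+ A (tau n w) w * 1 ^+ (A (tau n w) w - A (tau n w) w) * z ^+ (A (tau n.+1 w) w - A (tau n w) w)))).
  by apply: eq_cI => w; rewrite /X_obs /A_obs /A_prev /= !expr1n !mul1r mulrC.
rewrite h //; last 6 first.
- by apply: bmeas_cexp_real => //; [exact: measurable_Delta_sub|move=> w; exact: (Delta_ge0 htau)].
- exact: mtau_sub.
- exact: mtau_sub.
- exact: mtau_sub.
- by move=> w; exact: tau_ge0.
- by move=> w; exact: tau_leS.
by apply: eq_cI => w; rewrite tauS addrAC subrr add0r; exact: (cexp_merge_last _ _ _ _ _ mark_rate1).
Qed.

(** The absolute value makes the exponential bounded on the whole line; it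
    coincides with the identity on the values of [Delta]. *)
Lemma laplace_Delta_same n c : 0 <= complex.Re c -> laplace_Delta n.+1 c = laplace_Delta 1 c.
Proof.
move=> c0.
have E k : laplace_Delta k c = cE (fun w => cexp (- c * (`|Delta tau k w|)%:C)).
  by apply: eq_cI => w; rewrite ger0_norm // (Delta_ge0 htau).
rewrite !E.
apply: (@cE_same_law _ _ _ P _ _ (Delta tau n.+1) (Delta tau 1) (fun r : R => cexp (- c * `|r|%:C))).
- exact: measurable_Delta.
- exact: measurable_Delta.
- exact: (Delta_same_law htau).
- by apply: bmeas_cexp_real => //; exact: normr_measurable.
Qed.

(** [tau m] is the sum of [Delta 0], ..., [Delta m]; the first of them has its own
    law, the others share the law of [Delta 1]. *)
Lemma renewal_laplace m c c' : 0 <= complex.Re c -> 0 <= complex.Re c' ->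
  cE (fun w => cexp (- c * (tau m w)%:C) * cexp (- c' * (Delta tau m.+1 w)%:C)) =
  laplace_Delta 0 c * laplace_Delta 1 c ^+ m * laplace_Delta 1 c'.
Proof.
move=> c0 c'0.
pose f k (r : R) := cexp (- (if (k <= m)%N then c else c') * `|r|%:C).
have bf k : bmeas (f k).
  by rewrite /f; apply: bmeas_cexp_real => //; case: ifP.
have H := @cE_prod_indep _ _ _ P nat _ R (Delta tau) measurable_Delta (Delta_independent htau) (index_iota 0 m.+2) f (iota_uniq _ _) bf.
transitivity (cE (fun w => \prod_(k <- index_iota 0 m.+2) f k (Delta tau k w))).
  apply: eq_cI => w; rewrite big_mkord big_ord_recr /= /f ltnn ger0_norm ?(Delta_ge0 htau) //.
  congr (_ * _); rewrite tau_sum rmorph_sum /= mulr_sumr cexp_sum; apply: eq_bigr => k _.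
  by rewrite -ltnS ltn_ord ger0_norm // (Delta_ge0 htau).
rewrite H big_mkord big_ord_recr /= big_ord_recl /=.
have E k : cE (fun w => f k (Delta tau k w)) = laplace_Delta k (if (k <= m)%N then c else c').
  by apply: eq_cI => w; rewrite /f ger0_norm // (Delta_ge0 htau).
rewrite !E /= ltnn laplace_Delta_same //; congr (_ * _ * _).
rewrite -[in RHS](card_ord m) -prodr_const; apply: eq_bigr => k _.
by rewrite E /bump /= add1n ltn_ord laplace_Delta_same.
Qed.

Lemma measurable_A_joint : measurable_fun setT (fun p : R * Omega => A p.1 p.2).
Proof.
have [T0 Tord Tlf _ _ _] := hT.
apply: measurable_right_continuous.
- by move=> r; exact: (measurable_A mT ma hT).
- by move=> w r r'; exact: (A_mono _ hT).
- by move=> w r; exact: marked_process_right.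
Qed.

Lemma measurable_A_obs n : measurable_fun setT (A_obs A tau n).
Proof.
apply: (measurableT_comp measurable_A_joint (g := fun w => (tau n w, w))).
exact: measurable_fun_pair.
Qed.

Lemma A_obs_mono w : {homo (fun n => A_obs A tau n w) : n m / (n <= m)%N}.
Proof.
apply: homo_leq => [//|n m p|n]; first exact: leq_trans.
by apply: (A_mono _ hT); exact: tau_leS.
Qed.

Lemma cintble_damped (Th : R) (f : R -> R[i]) : 0 < Th -> cmeas f ->
  (forall t, cabs (f t) <= damping Th t) -> cintble leb f.
Proof.
move=> Th0 mf fh.
by have H := @cintble_le _ _ _ leb f _ mf (integrable_damping Th0); exact: H.
Qed.

Section Term.
Context (theta u v w x y s : R[i]).
Hypothesis (hu : cabs u <= 1) (hv : cabs v <= 1) (hy : cabs y <= 1) (hs : cabs s <= 1).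
Hypothesis (hw : 0 <= complex.Re w) (hx : 0 <= complex.Re x) (htheta : 0 < complex.Re theta).

(** [t] ranges over the part of the time axis on which the functional at exit index
    [m.+1] is supported. *)
Definition window (m : nat) (t : R) (o : Omega) : bool := (0 <= t) && (t < tau m o).

(** The integrand of the functional, apart from [exp (- theta t)], when the exit
    index is [m.+1]. *)
Definition obs_weight (m : nat) (t : R) (o : Omega) : R[i] :=
  (window m t o)%:R *
  (u ^+ A_obs A tau m o * v ^+ A_obs A tau m.+1 o
   * cexp (- w * (tau m o)%:C - x * (Delta tau m.+1 o)%:C) * y ^+ A t o).

Local Notation z := (u * v * s).
Local Notation z' := (u * v * y * s).

Let hz : cabs z <= 1. Proof. by rewrite !cabsM_le1. Qed.
Let hz' : cabs z' <= 1. Proof. by rewrite !cabsM_le1. Qed.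
Let hvs : cabs (v * s) <= 1. Proof. by rewrite !cabsM_le1. Qed.

Let base m t o := (window m t o)%:R * cexp (- w * (tau m o)%:C) * cexp (- x * (Delta tau m.+1 o)%:C).

(* [t] is replaced by [min (|t|, tau m)], with which it coincides in the window,
   so that the three times are ordered for every [t]. *)
Let inner m t o (z3 : R[i]) := base m t o *
  (z' ^+ A (Num.min `|t| (tau m o)) o * z ^+ (A (tau m o) o - A (Num.min `|t| (tau m o)) o)
   * z3 ^+ (A (tau m.+1 o) o - A (tau m o) o)).

(* With [i <= j <= k] the values of [A] at [t], [tau m] and [tau m.+1], the
   exponents of [u], [v], [y] and [s] are collected on the increments [i],
   [j - i] and [k - j]; the factor [s ^+ k] turns [v] into [v * s]. *)
Let weight_split m t o : obs_weight m t o * (s ^+ A_obs A tau m o - s ^+ A_obs A tau m.+1 o) =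
  inner m t o v - inner m t o (v * s).
Proof.
rewrite /obs_weight /inner /base; case: (boolP (window m t o)) => [/andP[t0 tt]|_]; last by rewrite !mul0r subrr.
rewrite ger0_norm // (min_l (ltW tt)) cexpD [- x * _]mulNr /A_obs.
have ij : (A t o <= A (tau m o) o)%N by apply: (A_mono _ hT); exact: ltW.
have jk : (A (tau m o) o <= A (tau m.+1 o) o)%N by apply: (A_mono _ hT); exact: tau_leS.
move: ij jk; set i := A t o; set j := A (tau m o) o; set k := A (tau m.+1 o) o => ij jk.
rewrite -{1 2 3}(subnK jk) -[in u ^+ _](subnK ij) -[in s ^+ j](subnK ij) -(subnK ij).
rewrite !exprD !addnK; set p := (j - i)%N; set q := (k - _)%N.
rewrite !exprMn; ring.
Qed.

(* The conditional expectation of [inner] given the observation times, for [t] in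
   the window, [r = tau m] and [D = Delta m.+1]. *)
Let kern t r D (b : R[i]) := cexp (- mark_rate z' * t%:C) * cexp (- mark_rate z * (r - t)%:C) * cexp (- w * r%:C) *
  cexp (- (x + b) * D%:C).

Let measurable_window dd (T' : measurableType dd) (rt rm : T' -> R) :
  measurable_fun setT rt -> measurable_fun setT rm ->
  measurable_fun setT (fun o => (0 <= rt o) && (rt o < rm o)).
Proof.
move=> mt mr; apply: measurable_and.
  by apply: measurable_fun_ler => //; exact: measurable_cst.
exact: measurable_fun_ltr.
Qed.

Let bmeas_base dd (T' : measurableType dd) t (rm rD : T' -> R) :
  measurable_fun setT rm -> measurable_fun setT rD -> (forall o, 0 <= rm o) -> (forall o, 0 <= rD o) ->
  bmeas (fun o => ((0 <= t) && (t < rm o))%:R * cexp (- w * (rm o)%:C) * cexp (- x * (rD o)%:C)).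
Proof.
move=> mr mD r0 D0; apply: bmeasM; first apply: bmeasM.
- by apply: bmeas_bool; apply: measurable_window => //; exact: measurable_cst.
- exact: bmeas_cexp_real.
- exact: bmeas_cexp_real.
Qed.

Let Delta0 n o : 0 <= Delta tau n o. Proof. exact: (Delta_ge0 htau). Qed.

Let measurable_A_random (r : Omega -> R) : measurable_fun setT r -> measurable_fun setT (fun o => A (r o) o).
Proof.
move=> mr; apply: (measurableT_comp measurable_A_joint (g := fun o => (r o, o))).
exact: measurable_fun_pair.
Qed.

Let measurable_min (t : R) dd (T' : measurableType dd) (r : T' -> R) : measurable_fun setT r ->
  measurable_fun setT (fun o => Num.min `|t| (r o)).
Proof. by move=> mr; apply: measurable_minr => //; exact: measurable_cst. Qed.

Let bmeas_inner m t z3 : cabs z3 <= 1 -> bmeas (fun o => inner m t o z3).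
Proof.
move=> h3; rewrite /inner; apply: bmeasM.
  by apply: bmeas_base => //; [exact: measurable_Delta|move=> o; exact: tau_ge0].
have mA1 : measurable_fun setT (fun o => A (Num.min `|t| (tau m o)) o).
  by apply: measurable_A_random; exact: measurable_min.
have mA2 k : measurable_fun setT (fun o => A (tau k o) o) by exact: measurable_A_random.
apply: bmeasM; first apply: bmeasM.
- exact: bmeas_expn.
- by apply: bmeas_expn => //; exact: measurable_fun_subn.
- by apply: bmeas_expn => //; exact: measurable_fun_subn.
Qed.

Let cE_inner m t z3 : cabs z3 <= 1 ->
  cE (fun o => inner m t o z3) = cE (fun o => (window m t o)%:R * kern t (tau m o) (Delta tau m.+1 o) (mark_rate z3)).
Proof.
move=> h3.
have := @marked_random_increments_pgf _ Omega R P lambda T a mT ma hT ha lambda_gt0 tau mtau hindep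
  (base m t) (fun o => Num.min `|t| (tau m o)) (tau m) (tau m.+1) z' z z3.
move=> H; rewrite [LHS]H //; first last.
- by move=> o; exact: tau_leS.
- by move=> o; rewrite ge_min lexx orbT.
- by move=> o; rewrite le_min normr_ge0 tau_ge0.
- exact: mtau_sub.
- exact: mtau_sub.
- by apply: measurable_min; exact: mtau_sub.
- apply: bmeas_base => //; first exact: mtau_sub.
    exact: measurable_Delta_sub.
  by move=> o; exact: tau_ge0.
apply: eq_cI => o; rewrite /base; case: (boolP (window m t o)) => [/andP[t0 tt]|_]; last first.
  have Z (e1 e2 e3 e4 : R[i]) : false%:R * e1 * e2 * e3 = false%:R * e4 by rewrite !mul0r.
  exact: Z.
have mn : Num.min `|t| (tau m o) = t by rewrite ger0_norm // (min_l (ltW tt)).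
have dd : tau m.+1 o - tau m o = Delta tau m.+1 o by [].
rewrite mn dd; exact: cexp_kernel_merge.
Qed.

(** [1 - s] times the integrand that exit at index [m.+1] contributes to the
    generating function over the thresholds. *)
Definition obs_term m (p : R * Omega) := cexp (- theta * p.1%:C) *
  (obs_weight m p.1 p.2 * (s ^+ A_obs A tau m p.2 - s ^+ A_obs A tau m.+1 p.2)).

(* [obs_term] after the expectation given the observation times: a difference of
   two such functions, with [b] the Laplace exponent at [v] and at [v * s]. *)
Let iterm m b (p : R * Omega) := cexp (- theta * p.1%:C) *
  ((window m p.1 p.2)%:R * kern p.1 (tau m p.2) (Delta tau m.+1 p.2) b).

Let measurable_snd_of dd (E : measurableType dd) (X : Omega -> E) : measurable_fun setT X ->
  measurable_fun setT (fun p : R * Omega => X p.2).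
Proof. by move=> mX; exact: (measurableT_comp mX measurable_snd). Qed.

Lemma cmeas_obs_weight m : cmeas (fun p : R * Omega => obs_weight m p.1 p.2).
Proof.
rewrite /obs_weight; apply: cmeasM.
  apply: cmeas_bool; apply: measurable_window; first exact: measurable_fst.
  exact: (measurable_snd_of (mtau m)).
apply: cmeasM; last exact: (cmeas_nat (fun n => y ^+ n) measurable_A_joint).
apply: cmeasM; first apply: cmeasM.
- exact: (cmeas_nat (fun n => u ^+ n) (measurable_snd_of (measurable_A_obs m))).
- exact: (cmeas_nat (fun n => v ^+ n) (measurable_snd_of (measurable_A_obs m.+1))).
- apply: cmeas_cexp; apply: cmeasB; apply: cmeasM; try exact: cmeas_cst.
    by apply: cmeas_real; exact: (measurable_snd_of (mtau m)).
  by apply: cmeas_real; exact: (measurable_snd_of (measurable_Delta m.+1)).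
Qed.

Lemma cmeas_cexp_time : cmeas (fun p : R * Omega => cexp (- theta * p.1%:C)).
Proof.
by apply: cmeas_cexp; apply: cmeasM; [exact: cmeas_cst|apply: cmeas_real; exact: measurable_fst].
Qed.

Lemma cabs_obs_weight_le m t o : cabs (obs_weight m t o) <= (window m t o)%:R.
Proof.
rewrite /obs_weight; case: (window m t o); last by rewrite mul0r cabs0.
rewrite mul1r; apply: cabsM_le1; last exact: cabsX_le1.
apply: cabsM_le1; first by apply: cabsM_le1; exact: cabsX_le1.
apply: cabs_cexp_le1; rewrite Re_add Re_opp.
have := Re_expo_le0 hw (tau_ge0 m o); have := Re_expo_le0 hx (Delta0 m.+1 o).
set r1 := complex.Re (- w * _); rewrite [- x * _]mulNr Re_opp; lra.
Qed.

Lemma cabs_time_window m t o : cabs (cexp (- theta * t%:C)) * (window m t o)%:R <= damping (complex.Re theta) t.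
Proof.
rewrite dampingE // cabs_cexp Re_mul Re_opp /= mulr0 subr0 mulrC ler_wpM2r ?expR_ge0 //.
by rewrite ler_nat /window; case: (0 <= t); case: (t < _).
Qed.

Let cmeas_iterm m b : cmeas (iterm m b).
Proof.
apply: cmeasM; first exact: cmeas_cexp_time.
apply: cmeasM.
  apply: cmeas_bool; apply: measurable_window; first exact: measurable_fst.
  exact: (measurable_snd_of (mtau m)).
have mt : measurable_fun setT (fun p : R * Omega => p.1) by exact: measurable_fst.
have mr := measurable_snd_of (mtau m).
have ce (c : R[i]) (q : R * Omega -> R) : measurable_fun setT q -> cmeas (fun p => cexp (- c * (q p)%:C)).
  by move=> mq; apply: cmeas_cexp; apply: cmeasM; [exact: cmeas_cst|exact: cmeas_real].
apply: cmeasM; [apply: cmeasM; [apply: cmeasM|]|].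
- exact: ce.
- by apply: ce; exact: measurable_funB.
- exact: ce.
- by apply: ce; exact: (measurable_snd_of (measurable_Delta m.+1)).
Qed.

Let cabs_iterm m b p : 0 <= complex.Re b -> cabs (iterm m b p) <= damping (complex.Re theta) p.1.
Proof.
case: p => t o b0; rewrite /iterm cabsM.
apply: le_trans (cabs_time_window m t o); rewrite ler_wpM2l ?cabs_ge0 //=.
case: (boolP (window m t o)) => [/andP[t0 tt]|_]; last by rewrite mul0r cabs0.
rewrite mul1r /kern; apply: cabsM_le1; [apply: cabsM_le1; [apply: cabsM_le1|]|];
  apply: cabs_cexp_le1; apply: Re_expo_le0 => //.
- exact: Re_mark_rate_ge0.
- exact: Re_mark_rate_ge0.
- by rewrite subr_ge0 ltW.
- exact: tau_ge0.
- by rewrite Re_add addr_ge0.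
Qed.

Let cintble_iterm m b : 0 <= complex.Re b -> cintble (leb \x P)%E (iterm m b).
Proof.
move=> b0.
have H := @cintble_le _ _ _ (leb \x P)%E (iterm m b) _ (cmeas_iterm m b) (integrable_damping_prod P htheta).
by apply: H => p; exact: cabs_iterm.
Qed.

Let cintble_iterm_P m b t : 0 <= complex.Re b -> cintble P (fun o => iterm m b (t, o)).
Proof.
move=> b0; apply: bmeas_cintble; split.
  by apply: (cmeas_comp _ (cmeas_iterm m b)); exact: pair1_measurable.
by exists (damping (complex.Re theta) t) => o; exact: (cabs_iterm m (t, o) b0).
Qed.

Let cintble_iterm_leb m b o : 0 <= complex.Re b -> cintble leb (fun t => iterm m b (t, o)).
Proof.
move=> b0; apply: (cintble_damped htheta).
  by apply: (cmeas_comp _ (cmeas_iterm m b)); exact: pair2_measurable.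
by move=> t; exact: (cabs_iterm m (t, o) b0).
Qed.

Let D := theta + mark_rate z' - mark_rate z.
Hypothesis hD : 0 < complex.Re D.

Let iterm_time m b o : cintegral leb setT (fun t => iterm m b (t, o)) =
  D^-1 * ((cexp (- (w + mark_rate z) * (tau m o)%:C) - cexp (- (theta + w + mark_rate z') * (tau m o)%:C))
          * cexp (- (x + b) * (Delta tau m.+1 o)%:C)).
Proof.
pose K := cexp (- mark_rate z * (tau m o)%:C) * cexp (- w * (tau m o)%:C) * cexp (- (x + b) * (Delta tau m.+1 o)%:C).
have D0 : D != 0 by apply: contraTneq hD => ->; rewrite ltxx.
have -> : (fun t => iterm m b (t, o)) = (fun t => K * ((window m t o)%:R * cexp (- D * t%:C))).
  apply/funext => t; rewrite /iterm /K /kern /=.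
  have E := cexp_segment_split theta (mark_rate z) (mark_rate z') t (tau m o); rewrite -/D in E.
  move: E; set e1 := cexp (- theta * _); set e2 := cexp (- mark_rate z' * _); set e3 := cexp (- mark_rate z * (_ - _)%:C).
  set e4 := cexp (- mark_rate z * _); set e5 := cexp (- D * _); set e6 := cexp (- w * _); set e7 := cexp (- (x + b) * _).
  set i := _%:R => E.
  have -> : e1 * (i * (e2 * e3 * e6 * e7)) = (e1 * (e2 * e3)) * i * e6 * e7 by ring.
  by rewrite E; ring.
rewrite cIZ; last first.
  apply: (cintble_damped hD).
  - apply: cmeasM.
      by apply: cmeas_bool; apply: measurable_window => //; exact: measurable_cst.
    by apply: cmeas_cexp; apply: cmeasM; [exact: cmeas_cst|exact: cmeas_real].
  - move=> t; rewrite cabsM cabs_nat dampingE // cabs_cexp Re_mul Re_opp /= mulr0 subr0 ler_wpM2r ?expR_ge0 //.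
    by rewrite ler_nat /window; case: (0 <= t); case: (t < _).
rewrite /window cI_exp_segment ?tau_ge0 // /K.
have := cexp_segment_ends theta w (mark_rate z) (mark_rate z') (tau m o); rewrite -/D => <-.
by ring.
Qed.

Let cI_iterm m b : 0 <= complex.Re b -> cintegral (leb \x P)%E setT (iterm m b) =
  D^-1 * ((laplace_Delta 0 (w + mark_rate z) * laplace_Delta 1 (w + mark_rate z) ^+ m
           - laplace_Delta 0 (theta + w + mark_rate z') * laplace_Delta 1 (theta + w + mark_rate z') ^+ m) * laplace_Delta 1 (x + b)).
Proof.
move=> b0; rewrite -cI_fubini2; [|exact: cintble_iterm|by move=> o; exact: cintble_iterm_leb].
have hc : 0 <= complex.Re (w + mark_rate z) by rewrite Re_add addr_ge0 // Re_mark_rate_ge0.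
have hc' : 0 <= complex.Re (theta + w + mark_rate z').
  by rewrite !Re_add; apply: addr_ge0; [apply: addr_ge0 => //; exact: ltW|exact: Re_mark_rate_ge0].
have hb : 0 <= complex.Re (x + b) by rewrite Re_add addr_ge0.
have bc c : 0 <= complex.Re c -> bmeas (fun o => cexp (- c * (tau m o)%:C) * cexp (- (x + b) * (Delta tau m.+1 o)%:C)).
  move=> c0; apply: bmeasM; apply: bmeas_cexp_real => //; last exact: measurable_Delta.
  by move=> o; exact: tau_ge0.
pose F c o := cexp (- c * (tau m o)%:C) * cexp (- (x + b) * (Delta tau m.+1 o)%:C).
have iF c : 0 <= complex.Re c -> cintble P (F c) by move=> c0; apply: bmeas_cintble; exact: bc.
have EF c : 0 <= complex.Re c -> cE (F c) = laplace_Delta 0 c * laplace_Delta 1 c ^+ m * laplace_Delta 1 (x + b).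
  by move=> c0; exact: renewal_laplace.
transitivity (cE (fun o => D^-1 * (F (w + mark_rate z) o - F (theta + w + mark_rate z') o))).
  by apply: eq_cI => o; rewrite iterm_time [X in D^-1 * X]mulrBl.
have alg (k e1 e2 p q r : R[i]) : e1 = p * r -> e2 = q * r -> k * (e1 - e2) = k * ((p - q) * r).
  by move=> -> ->; rewrite mulrBl.
apply: (etrans (cIZ D^-1 (cintbleB (iF _ hc) (iF _ hc')))).
apply: (etrans (congr1 (fun e => D^-1 * e) (cIB (iF _ hc) (iF _ hc')))).
exact: (alg _ _ _ _ _ _ (EF _ hc) (EF _ hc')).
Qed.

(** For fixed [t], the expectation given the observation times replaces [inner] by
    exponentials of [t], [tau m] and [Delta m.+1].  The order of integration is
    then exchanged: the integral over [t] is elementary and produces the divisor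
    [D], and the remaining expectation factorises by [renewal_laplace]. *)
Lemma cI_obs_term m : cintegral (leb \x P)%E setT (obs_term m) =
  (laplace_Delta 1 (x + mark_rate v) - laplace_Delta 1 (x + mark_rate (v * s))) / D *
  (laplace_Delta 0 (w + mark_rate z) * laplace_Delta 1 (w + mark_rate z) ^+ m
   - laplace_Delta 0 (theta + w + mark_rate z') * laplace_Delta 1 (theta + w + mark_rate z') ^+ m).
Proof.
have rv := Re_mark_rate_ge0 hv; have rvs := Re_mark_rate_ge0 hvs.
have hpow m' : bmeas (fun o => s ^+ A_obs A tau m' o).
  by apply: bmeas_expn => //; exact: measurable_A_obs.
have ct : cmeas (obs_term m).
  apply: cmeasM; first exact: cmeas_cexp_time.
  apply: cmeasM; first exact: cmeas_obs_weight.
  apply: cmeasB.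
    exact: (cmeas_nat (fun n => s ^+ n) (measurable_snd_of (measurable_A_obs m))).
  exact: (cmeas_nat (fun n => s ^+ n) (measurable_snd_of (measurable_A_obs m.+1))).
have bt p : cabs (obs_term m p) <= 2 * damping (complex.Re theta) p.1.
  case: p => t o; rewrite /obs_term cabsM cabsM mulrA mulrC ler_pM ?cabs_ge0 ?mulr_ge0 ?cabs_ge0 //.
    by apply: (le_trans (cabsB _ _)); apply: lerD; exact: cabsX_le1.
  apply: le_trans (cabs_time_window m t o); rewrite ler_wpM2l ?cabs_ge0 //; exact: cabs_obs_weight_le.
have it : cintble (leb \x P)%E (obs_term m).
  have H := @cintble_le _ _ _ (leb \x P)%E (obs_term m) (fun p => 2 * damping (complex.Re theta) p.1) ct.
  apply: H => //.
  by have := integrableZl measurableT 2 (integrable_damping_prod P htheta); apply: eq_integrable.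
have itP t : cintble P (fun o => obs_term m (t, o)).
  apply: bmeas_cintble; split; first by apply: (cmeas_comp _ ct); exact: pair1_measurable.
  by exists (2 * damping (complex.Re theta) t) => o; exact: (bt (t, o)).
have algf (n1 n2 k e : R[i]) : k^-1 * (e * n1) - k^-1 * (e * n2) = (n1 - n2) / k * e by ring.
have iv := cintble_iterm m rv; have ivs := cintble_iterm m rvs.
have E0 := etrans (cIB iv ivs) (congr2 (fun a b => a - b) (cI_iterm m rv) (cI_iterm m rvs)).
have {}E0 := etrans E0 (algf _ _ _ _).
apply: (etrans _ E0).
have ivP t := cintbleB (cintble_iterm_P m t rv) (cintble_iterm_P m t rvs).
apply: (etrans (esym (cI_fubini1 it itP))).
apply: (etrans _ (cI_fubini1 (cintbleB iv ivs) ivP)).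
apply: eq_cI => t; pose q := cexp (- theta * t%:C).
pose kb b o := (window m t o)%:R * kern t (tau m o) (Delta tau m.+1 o) b.
have bk b : 0 <= complex.Re b -> cintble P (kb b).
  move=> b0; have := cintbleZ (cexp (theta * t%:C)) (cintble_iterm_P m t b0).
  have E o : cexp (theta * t%:C) * iterm m b (t, o) = kb b o.
    have alg (e1 e2 e3 : R[i]) : e1 * e2 = 1 -> e1 * (e2 * e3) = e3 by move=> h; rewrite mulrA h mul1r.
    by apply: alg; rewrite -cexpD mulNr subrr cexp0.
  by under eq_fun do rewrite E.
have iin z3 : cabs z3 <= 1 -> cintble P (fun o => inner m t o z3).
  by move=> h3; apply: bmeas_cintble; exact: bmeas_inner.
have E1 : cE (fun o => obs_term m (t, o)) = q * (cE (fun o => inner m t o v) - cE (fun o => inner m t o (v * s))).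
  rewrite -(cIB (iin _ hv) (iin _ hvs)) -(cIZ q (cintbleB (iin _ hv) (iin _ hvs))).
  by apply: eq_cI => o; rewrite /obs_term /= weight_split.
apply: (etrans E1).
have alg2 (k e1 e2 f1 f2 : R[i]) : e1 = f1 -> e2 = f2 -> k * (e1 - e2) = k * f1 - k * f2.
  by move=> -> ->; rewrite mulrBr.
apply: (etrans (alg2 q _ _ _ _ (cE_inner m t hv) (cE_inner m t hvs))).
apply: (etrans _ (esym (cIB (cintble_iterm_P m t rv) (cintble_iterm_P m t rvs)))).
exact: (esym (congr2 (fun a b => a - b) (cIZ q (bk _ rv)) (cIZ q (bk _ rvs)))).
Qed.

End Term.
End Observed.

(** * The exit index *)

Lemma cabs_triangle4 (R : realType) (p q r t : R[i]) (b e : R) :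
  cabs (q - t) <= e / 2 -> cabs (q - r) <= b -> cabs (p - r) <= e / 2 -> cabs (p - t) <= b + e.
Proof.
move=> h1 h2 h3; have -> : p - t = (p - r) + ((q - t) - (q - r)) by ring.
by apply: (le_trans (cabsD _ _)); have := cabsB (q - t) (q - r); lra.
Qed.

(** Two geometric series with a common factor [n].  Their ratios need only be small
    when [n] does not vanish, which covers the degenerate case in which the
    process never increases between two observations. *)
Lemma cabs_geometric_difference (R : realType) (n a q a' q' : R[i]) :
  (n != 0 -> cabs q < 1 /\ cabs q' < 1) -> forall e : R, 0 < e ->
  exists N0, forall N, (N0 <= N)%N ->
    cabs (\sum_(m < N) n * (a * q ^+ m - a' * q' ^+ m) - n * (a / (1 - q) - a' / (1 - q'))) <= e.
Proof.
move=> nq e e0; have [->|n0] := eqVneq n 0.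
  exists 0%N => N _; rewrite mul0r subr0 big1 ?cabs0 ?ltW // => i _; by rewrite mul0r.
have [q1 q1'] := nq n0.
have cn : 0 < cabs n by rewrite cabs_gt0.
have e1 : 0 < e / 2 / cabs n by rewrite !divr_gt0.
have [N1 H1] := cabs_geometric_tail a q1 e1; have [N2 H2] := cabs_geometric_tail a' q1' e1.
exists (maxn N1 N2) => N; rewrite geq_max => /andP[NN1 NN2].
have -> : \sum_(m < N) n * (a * q ^+ m - a' * q' ^+ m) - n * (a / (1 - q) - a' / (1 - q')) =
  n * ((\sum_(m < N) a * q ^+ m - a / (1 - q)) - (\sum_(m < N) a' * q' ^+ m - a' / (1 - q'))).
  by rewrite -mulr_sumr sumrB -mulrBr; congr (_ * _); ring.
rewrite cabsM mulrC -ler_pdivlMr //; apply: (le_trans (cabsB _ _)).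
have := H1 N NN1; have := H2 N NN2; lra.
Qed.

Section Exit.
Context d (Omega : measurableType d) (R : realType) (P : probability Omega R).
Context (lambda : R) (T : nat -> Omega -> R) (a : nat -> Omega -> nat) (tau : nat -> Omega -> R).
Hypothesis mT : forall k, measurable_fun setT (T k).
Hypothesis ma : forall k, measurable_fun setT (a k).
Hypothesis mtau : forall n, measurable_fun setT (tau n).
Hypothesis hT : poisson_points P lambda T.
Hypothesis ha : position_independent_marking P T a.
Hypothesis htau : delayed_renewal P tau.
Hypothesis lambda_gt0 : 0 < lambda.
Local Notation A := (marked_process T a).
Hypothesis hindep : independent_families P tau A.
Local Notation cE := (cintegral P setT).
Local Notation leb := (@lebesgue_measure R).
Local Notation g := (pgf P (a 1%N)).
Local Notation Ltr := (laplace_Delta P tau).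
Local Notation rate := (mark_rate P lambda a).
Local Notation gamma := (gamma_ P A tau 1).

Lemma measurable_X_obs1 : measurable_fun setT (X_obs A tau 1).
Proof. exact: (measurable_fun_subn (measurable_A_obs mT ma mtau hT 1) (measurable_A_obs mT ma mtau hT 0)). Qed.

(** If [X_1 = 0] almost surely, [gamma z c] does not depend on [z].  Otherwise, on an
    event of positive probability [z ^+ X_1] has modulus at most [|z| < 1],
    which bounds the expectation away from 1. *)
Lemma gamma_dichotomy (z1 z2 c z c' : R[i]) : cabs z1 <= 1 -> cabs z2 <= 1 -> 0 <= complex.Re c ->
  gamma z1 c - gamma z2 c != 0 -> cabs z < 1 -> 0 <= complex.Re c' -> cabs (gamma z c') < 1.
Proof.
move=> h1 h2 c0 ne hz c'0.
pose X := X_obs A tau 1.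
have mX : measurable_fun setT X by exact: measurable_X_obs1.
have mX0 : measurable_fun setT (fun o => X o == 0%N).
  by apply: measurable_fun_eqn => //; exact: measurable_cst.
have mS := measurable_set_bool mX0.
have be (e : R[i]) : 0 <= complex.Re e -> bmeas (fun o => cexp (- e * (Delta tau 1 o)%:C)).
  move=> e0; apply: bmeas_cexp_real => //; first exact: measurable_Delta.
  by move=> o; exact: (Delta_ge0 htau).
have bg (zz e : R[i]) : cabs zz <= 1 -> 0 <= complex.Re e -> bmeas (fun o => zz ^+ X o * cexp (- e * (Delta tau 1 o)%:C)).
  by move=> hzz e0; apply: bmeasM; [exact: bmeas_expn|exact: be].
have [P1|P1] := eqVneq (P [set o | X o == 0%N]) 1%E.
  case/negP: ne; rewrite subr_eq0; apply/eqP.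
  apply: (eq_cE_full_event (N := [set o | X o == 0%N])) => //; [exact: bg|exact: bg|].
  by move=> o /= /eqP; rewrite /X => ->; rewrite !expr0.
have p0 : fine (P [set o | X o == 0%N]) < 1.
  rewrite -lte_fin fineK ?fin_num_measure // lt_neqAle P1 /=; exact: probability_le1.
(* [h o] is 1 where [X] vanishes and [|z|] elsewhere. *)
pose h o := cabs z + (1 - cabs z) * (X o == 0%N)%:R.
have ib : P.-integrable setT (EFin \o (fun o => (X o == 0%N)%:R : R)).
  have := integrable_cst P 1; apply: le_integrable => //.
    by apply/measurable_EFinP; exact: (@measurableT_comp _ _ _ _ _ _ (fun c : bool => c%:R : R) _ (fun o => X o == 0%N)).
  by move=> o _ /=; rewrite lee_fin normr1; case: (X o == 0%N); rewrite ?normr1 ?normr0.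
have ib2 : P.-integrable setT (EFin \o (fun o => (1 - cabs z) * (X o == 0%N)%:R : R)).
  by have := integrableZl measurableT (1 - cabs z) ib; apply: eq_integrable.
have ih : P.-integrable setT (EFin \o h).
  by have := integrableD measurableT (integrable_cst P (cabs z)) ib2; apply: eq_integrable.
have Eh : Rintegral P setT h = cabs z + (1 - cabs z) * fine (P [set o | X o == 0%N]).
  rewrite /h RintegralD //; last exact: (integrable_cst P (cabs z)).
  by rewrite Rintegral_cst //= probability_setT mulr1 RintegralZl // Rintegral_bool.
have := @cabs_cI_le _ _ _ P _ h (bg z c' (ltW hz) c'0).1 ih.
move=> H; apply: (@le_lt_trans _ _ (Rintegral P setT h)).
  apply: H => o; rewrite cabsM /h cabsX.
  apply: (@le_trans _ _ (cabs z ^+ X o * 1)).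
    rewrite ler_wpM2l ?exprn_ge0 ?cabs_ge0 //; apply: cabs_cexp_le1.
    by apply: Re_expo_le0 => //; exact: (Delta_ge0 htau).
  rewrite mulr1; case: (X o) => [|n] /=; first by rewrite expr0 mulr1 addrCA subrr addr0.
  rewrite mulr0 addr0 exprS -[leRHS]mulr1 ler_wpM2l ?cabs_ge0 //.
  by rewrite exprn_ile1 ?cabs_ge0 // ltW.
rewrite Eh; have := cabs_ge0 z; set r := cabs z; set p := fine _ => r0.
have : (1 - r) * p < (1 - r) * 1 by rewrite ltr_pM2l // subr_gt0.
lra.
Qed.

Section Functional.
Context (theta u v w x y : R[i]).
Hypothesis (hu : cabs u <= 1) (hv : cabs v <= 1) (hy : cabs y <= 1).
Hypothesis (hw : 0 <= complex.Re w) (hx : 0 <= complex.Re x) (htheta : 0 < complex.Re theta).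
Local Notation weight := (obs_weight T a tau u v w x y).
Local Notation Th := (complex.Re theta).

Let exit_integrand k (r : R) o : R[i] :=
  if exit_index k.+1 (A_obs A tau ^~ o) is Some n then
    u ^+ A_prev A tau n o * v ^+ A_obs A tau n o
    * cexp (- w * (tau_prev tau n o)%:C - x * (Delta tau n o)%:C)
    * y ^+ A r o * (r < tau_prev tau n o)%R%:R
  else 0.

Let exit_part k (p : R * Omega) : R[i] :=
  cexp (- theta * p.1%:C) * ((0 <= p.1)%R%:R * exit_integrand k p.1 p.2).

(* Exit at index [m.+1] for the threshold [k.+1]. *)
Let crossing k m o := (A_obs A tau m o <= k)%N && (k < A_obs A tau m.+1 o)%N.

(* [exit_part] restricted to exit indices at most [N]. *)
Let exit_upto k N (p : R * Omega) : R[i] :=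
  cexp (- theta * p.1%:C) * \sum_(m < N) (crossing k m p.2)%:R * weight m p.1 p.2.

Let A_mono o n m : (n <= m)%N -> (A_obs A tau n o <= A_obs A tau m o)%N.
Proof. by move=> nm; exact: (A_obs_mono _ hT htau). Qed.

(* At most one term of the sum is nonzero, the one that precedes the exit index; if
   the exit index is 0 or infinite there is none. *)
Let exit_upto_eventually k p : exists N, forall n, (N <= n)%N -> exit_upto k n p = exit_part k p.
Proof.
case: p => t o; rewrite /exit_upto /exit_part /exit_integrand /exit_index /=.
case: pselect => [h|h].
  case: ex_minnP => -[|m] km mmin.
    exists 0%N => n _; rewrite big1 => [|i _]; last first.
      by rewrite /crossing leqNgt (leq_trans km (A_mono _ (leq0n i))) /= mul0r.
    by rewrite mulr0 /tau_prev /=; case: ltP; case: leP => //=; rewrite ?(mulr0, mul0r) // => t1 t2; have := lt_le_trans t2 t1; rewrite ltxx.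
  have Am : (A_obs A tau m o <= k)%N.
    by rewrite leqNgt; apply/negP => /mmin; rewrite ltnn.
  exists m.+1 => n mn; congr (_ * _).
  rewrite (bigD1 (Ordinal mn)) //= big1 ?addr0 => [|i im]; last first.
    rewrite /crossing; case: (ltngtP i m) => [im'|im'|im'].
    - by rewrite [X in _ && X]ltnNge (leq_trans (A_mono _ im') Am) andbF mul0r.
    - by rewrite leqNgt (leq_trans km (A_mono _ im')) /= mul0r.
    - by case/eqP: im; apply: val_inj.
  rewrite /crossing Am km mul1r /obs_weight /window /A_prev /tau_prev /=.
  case: (0 <= t); rewrite ?mul0r // !mul1r /=.
  by case: (t < tau m o); rewrite ?mulr1 ?mul1r ?mulr0 ?mul0r.
exists 0%N => n _; rewrite mulr0 big1 ?mulr0 // => i _.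
by rewrite /crossing [X in _ && X]ltnNge; case: (boolP (A_obs A tau i.+1 o <= k)%N) => h2; rewrite ?andbF ?mul0r //; case: h; exists i.+1; rewrite ltnNge.
Qed.

(* A level is crossed at most once: the sum telescopes. *)
Let crossing_sum_le1 k N o : \sum_(m < N) (crossing k m o)%:R <= 1 :> R.
Proof.
have -> : \sum_(m < N) (crossing k m o)%:R =
   (k < A_obs A tau N o)%N%:R - (k < A_obs A tau 0 o)%N%:R :> R.
  elim: N => [|N IH]; first by rewrite big_ord0 subrr.
  rewrite big_ord_recr /= IH /crossing addrAC; congr (_ - _).
  have h2 := A_mono o (leqnSn N).
  case: (ltnP k (A_obs A tau N o)) => h1 /=; last by rewrite add0r.
  by rewrite (leq_trans h1 h2) addr0.
by rewrite lerBlDr (@le_trans _ _ 1) ?lerDl //; case: (k < _)%N.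
Qed.

Let cabs_weight_nonneg m t o : cabs (weight m t o) <= (0 <= t)%R%:R.
Proof.
apply: (le_trans (cabs_obs_weight_le T a htau hu hv hy hw hx m t o)).
by rewrite ler_nat /window; case: (0 <= t); case: (t < _).
Qed.

Let cabs_exit_upto k N p : cabs (exit_upto k N p) <= damping Th p.1.
Proof.
case: p => t o; rewrite /exit_upto cabsM dampingE //= cabs_cexp Re_mul Re_opp /= mulr0 subr0 mulrC.
rewrite ler_wpM2r ?expR_ge0 //.
apply: (@le_trans _ _ (\sum_(m < N) (crossing k m o)%:R * (0 <= t)%R%:R)).
  apply: cabs_sum_le => m; rewrite cabsM cabs_nat ler_wpM2l //; exact: cabs_weight_nonneg.
by rewrite -mulr_suml -[leRHS]mul1r ler_wpM2r // crossing_sum_le1.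
Qed.

Let measurable_crossing k m : measurable_fun setT (crossing k m).
Proof.
apply: measurable_and.
  by apply: measurable_fun_leq; [exact: (measurable_A_obs mT ma mtau hT)|exact: measurable_cst].
by apply: measurable_fun_ltn; [exact: measurable_cst|exact: (measurable_A_obs mT ma mtau hT)].
Qed.

Let cmeas_exit_upto k N : cmeas (exit_upto k N).
Proof.
apply: cmeasM; first exact: cmeas_cexp_time.
apply: (@cmeas_sum _ _ _ N (fun m p => (crossing k m p.2)%:R * weight m p.1 p.2)) => m.
apply: cmeasM; last exact: (cmeas_obs_weight mT ma mtau hT).
by apply: cmeas_bool; exact: (measurableT_comp (measurable_crossing k m) measurable_snd).
Qed.

Let cmeas_exit_part k : cmeas (exit_part k).
Proof. exact: (cmeas_lim (cmeas_exit_upto k) (exit_upto_eventually k)). Qed.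

Let cabs_exit_part k p : cabs (exit_part k p) <= damping Th p.1.
Proof.
by have [N HN] := exit_upto_eventually k p; rewrite -(HN N (leqnn N)); exact: cabs_exit_upto.
Qed.

Let cintble_damped_prod (f : R * Omega -> R[i]) : cmeas f -> (forall p, cabs (f p) <= damping Th p.1) ->
  cintble (leb \x P)%E f.
Proof.
move=> mf fh.
by have H := @cintble_le _ _ _ (leb \x P)%E f _ mf (integrable_damping_prod P htheta); exact: H.
Qed.

Let cI_damped_le (c : R) (f : R * Omega -> R[i]) : cmeas f -> 0 <= c ->
  (forall p, cabs (f p) <= c * damping Th p.1) ->
  cabs (cintegral (leb \x P)%E setT f) <= c / Th.
Proof.
move=> mf c0 fh.
have ic : (leb \x P)%E.-integrable setT (EFin \o (fun p : R * Omega => c * damping Th p.1)).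
  by have := integrableZl measurableT c (integrable_damping_prod P htheta); apply: eq_integrable.
have H := @cabs_cI_le _ _ _ (leb \x P)%E f _ mf ic fh.
apply: (le_trans H); rewrite RintegralZl //; last exact: integrable_damping_prod.
by rewrite (Rintegral_damping_prod P htheta).
Qed.

(* The iterated integral in the definition of [G1] is a single integral over the
   product of the half-line and the probability space. *)
Let G1E k : G1 P k.+1 A tau theta u v w x y = cintegral (leb \x P)%E setT (exit_part k).
Proof.
have bt p := cabs_exit_part k p.
have ii := cintble_damped_prod (cmeas_exit_part k) bt.
have iP t : cintble P (fun o => exit_part k (t, o)).
  apply: bmeas_cintble; split; first by apply: (cmeas_comp _ (cmeas_exit_part k)); exact: pair1_measurable.
  by exists (damping Th t) => o; exact: (bt (t, o)).
apply: (etrans _ (cI_fubini1 ii iP)).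
rewrite /G1 cintegral_restrict; apply: eq_cI => t.
case: (lerP 0 t) => t0; last first.
  rewrite memNset /=; last by rewrite in_itv /= andbT; apply/negP; rewrite -ltNge.
  rewrite -(cI0 P); apply: eq_cI => o; rewrite /exit_part /= leNgt t0 /=.
  by set e := cexp _; set f := exit_integrand _ _ _; rewrite mul0r mulr0.
rewrite mem_set /=; last by rewrite in_itv /= andbT.
have E o : exit_part k (t, o) = cexp (- theta * t%:C) * exit_integrand k t o.
  by rewrite /exit_part /= t0 mul1r.
have ie : cintble P (exit_integrand k t).
  have := cintbleZ (cexp (theta * t%:C)) (iP t).
  have E2 o : cexp (theta * t%:C) * exit_part k (t, o) = exit_integrand k t o.
    have alg (e1 e2 e3 : R[i]) : e1 * e2 = 1 -> e1 * (e2 * e3) = e3 by move=> h; rewrite mulrA h mul1r.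
    by rewrite E; apply: alg; rewrite -cexpD mulNr subrr cexp0.
  by under eq_fun do rewrite E2.
apply: (etrans (esym (cIZ (cexp (- theta * t%:C)) ie))).
by apply: eq_cI => o; rewrite E.
Qed.

Lemma cabs_G1_le k : cabs (G1 P k.+1 A tau theta u v w x y) <= 1 / Th.
Proof.
rewrite G1E; apply: (@cI_damped_le 1) => // p; rewrite mul1r; exact: cabs_exit_part.
Qed.

Section GeneratingFunction.
Context (s : R[i]).
Hypothesis hs : cabs s <= 1 / 2.
Local Notation z := (u * v * s).
Local Notation z' := (u * v * y * s).
Local Notation D := (theta + rate z' - rate z).
Hypothesis hD : 0 < complex.Re D.

Let s1 : s != 1.
Proof. by apply: contraTneq hs => ->; rewrite cabs1 -ltNge; lra. Qed.

Let hs1 : cabs s <= 1. Proof. by apply: (le_trans hs); lra. Qed.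

Let term m := obs_term T a tau theta u v w x y s m.

(* The integrands of the generating function over the first [K] thresholds, and
   over all of them, when only exit indices at most [N] are counted. *)
Let windows K N p := \sum_(k < K) s ^+ k * exit_upto k N p.
Let all_windows N p := (1 - s)^-1 * \sum_(m < N) term m p.

(* For a fixed outcome, finitely many thresholds are crossed up to the index [N]. *)
Let all_windowsE N p L : (A_obs A tau N p.2 <= L)%N -> all_windows N p = windows L N p.
Proof.
move=> NL; rewrite /all_windows /windows /exit_upto /term /obs_term.
set e := cexp _.
have -> : \sum_(k < L) s ^+ k * (e * \sum_(m < N) (crossing k m p.2)%:R * weight m p.1 p.2) =
  e * \sum_(m < N) weight m p.1 p.2 * \sum_(k < L) s ^+ k * (crossing k m p.2)%:R.
  rewrite mulr_sumr; under [RHS]eq_bigr do rewrite mulr_sumr mulr_sumr.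
  rewrite exchange_big /=; apply: eq_bigr => k _; rewrite !mulr_sumr; apply: eq_bigr => m _.
  by set r := weight _ _ _; ring.
rewrite mulr_sumr mulr_sumr; apply: eq_bigr => m _.
have mN : (m < N)%N by [].
rewrite -(geometric_window s1 (A_mono p.2 (leqnSn m))); last exact: leq_trans (A_mono p.2 mN) NL.
by set r := weight _ _ _; ring.
Qed.

(* The thresholds from [K] on contribute at most the tail of a geometric series of
   ratio [|s| <= 1 / 2], whatever [N] is. *)
Let cabs_windows_tail K N p : cabs (windows K N p - all_windows N p) <= 2 * cabs s ^+ K * damping Th p.1.
Proof.
rewrite (@all_windowsE N p (K + A_obs A tau N p.2)) ?leq_addl //.
rewrite cabsBC /windows big_split_ord /= addrAC subrr add0r.
set L := A_obs _ _ _ _.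
have d0 : 0 <= damping Th p.1 by exact: damping_ge0.
apply: (@le_trans _ _ (\sum_(j < L) cabs s ^+ K * damping Th p.1 * cabs s ^+ j)).
  apply: cabs_sum_le => j; rewrite cabsM cabsX exprD mulrAC.
  apply: ler_wpM2r; first by rewrite exprn_ge0 ?cabs_ge0.
  by apply: ler_wpM2l; [rewrite exprn_ge0 ?cabs_ge0|exact: cabs_exit_upto].
rewrite -mulr_sumr; have -> : 2 * cabs s ^+ K * damping Th p.1 = cabs s ^+ K * damping Th p.1 * 2 by ring.
apply: ler_wpM2l; first by rewrite mulr_ge0 ?exprn_ge0 ?cabs_ge0.
by apply: geometric_sum_le => //; exact: cabs_ge0.
Qed.

(** [(1 - s)^-1 * B1 * (B2 - B3)] in terms of Laplace transforms of the [Delta n]. *)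
Definition generating_function : R[i] := (1 - s)^-1 * ((Ltr 1 (x + rate v) - Ltr 1 (x + rate (v * s))) / D *
  (Ltr 0 (w + rate z) / (1 - Ltr 1 (w + rate z))
   - Ltr 0 (theta + w + rate z') / (1 - Ltr 1 (theta + w + rate z')))).

Let cmeas_term m : cmeas (term m).
Proof.
apply: cmeasM; first exact: cmeas_cexp_time.
apply: cmeasM; first exact: (cmeas_obs_weight mT ma mtau hT).
have mA n : measurable_fun setT (fun p : R * Omega => A_obs A tau n p.2).
  have mo : measurable_fun setT (A_obs A tau n) by exact: (measurable_A_obs mT ma mtau hT).
  exact: (measurableT_comp mo measurable_snd).
by apply: cmeasB; exact: (cmeas_nat (fun n => s ^+ n)).
Qed.

Let cintble_term m : cintble (leb \x P)%E (term m).
Proof.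
have ic : (leb \x P)%E.-integrable setT (EFin \o (fun p : R * Omega => 2 * damping Th p.1)).
  by have := integrableZl measurableT 2 (integrable_damping_prod P htheta); apply: eq_integrable.
have H := @cintble_le _ _ _ (leb \x P)%E (term m) _ (cmeas_term m) ic.
apply: H => -[t o]; rewrite /term /obs_term cabsM cabsM mulrA mulrC ler_pM ?cabs_ge0 ?mulr_ge0 ?cabs_ge0 //.
  by apply: (le_trans (cabsB _ _)); apply: lerD; exact: cabsX_le1.
by rewrite dampingE //= cabs_cexp Re_mul Re_opp /= mulr0 subr0 mulrC ler_wpM2r ?expR_ge0.
Qed.

Let cI_all_windows N : cintegral (leb \x P)%E setT (all_windows N) =
  (1 - s)^-1 * \sum_(m < N) (Ltr 1 (x + rate v) - Ltr 1 (x + rate (v * s))) / D *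
  (Ltr 0 (w + rate z) * Ltr 1 (w + rate z) ^+ m
   - Ltr 0 (theta + w + rate z') * Ltr 1 (theta + w + rate z') ^+ m).
Proof.
have it := @cintble_sum _ _ _ (leb \x P)%E N (fun m => term m) (fun m => cintble_term m).
apply: (etrans (cIZ _ it)); congr (_ * _).
apply: (etrans (cI_sum (fun m : 'I_N => cintble_term m))); apply: eq_bigr => m _.
exact: (cI_obs_term mT ma mtau hT ha htau lambda_gt0 hindep hu hv hy hs1 hw hx htheta hD).
Qed.

Let cmeas_windows K N : cmeas (windows K N).
Proof.
apply: (@cmeas_sum _ _ _ K (fun k p => s ^+ k * exit_upto k N p)) => k.
by apply: cmeasM; [exact: cmeas_cst|exact: cmeas_exit_upto].
Qed.

Let cmeas_all_windows N : cmeas (all_windows N).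
Proof.
apply: cmeasM; first exact: cmeas_cst.
by apply: (@cmeas_sum _ _ _ N (fun m p => term m p)) => m; exact: cmeas_term.
Qed.

(** For a large number [n] of observations, the integral of [windows K n] is close to
    the sum over the first [K] thresholds by dominated convergence, that of
    [all_windows n] is close to the closed form by summation of geometric series,
    and the two differ by at most [2 |s|^K / Re theta] for all [n]. *)
Lemma cabs_generating_function_tail K :
  cabs (generating_function - \sum_(k < K) G1 P k.+1 A tau theta u v w x y * s ^+ k) <= 2 * cabs s ^+ K / Th.
Proof.
apply/ler_addgt0Pr => e e0.
have e20 : 0 < e / 2 by rewrite divr_gt0.
have ub : 0 < cabs (1 - s)^-1 by rewrite cabs_gt0 invr_eq0 subr_eq0 eq_sym.
have e1 : 0 < e / 2 / cabs (1 - s)^-1 by rewrite divr_gt0.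
have rv := @Re_mark_rate_ge0 _ _ _ P _ _ ma lambda_gt0.
have [hz hz' hvs] : [/\ cabs z <= 1, cabs z' <= 1 & cabs (v * s) <= 1].
  by split; do ?apply: cabsM_le1.
have lz (c : R[i]) : cabs c <= 1 -> cabs (c * s) < 1.
  move=> c1; rewrite cabsM; apply: (@le_lt_trans _ _ (1 * (1 / 2))); last by lra.
  by apply: ler_pM; rewrite ?cabs_ge0.
have hgam zz c : cabs zz <= 1 -> 0 <= complex.Re c -> gamma zz c = Ltr 1 (c + rate zz).
  by move=> h1 h2; exact: (gamma_next mT ma mtau hT ha htau lambda_gt0 hindep).
have hthw : 0 <= complex.Re (theta + w) by rewrite Re_add addr_ge0 // ltW.
have fst_ne0 (p q : R[i]) : p / q != 0 -> p != 0 by rewrite mulf_eq0 negb_or => /andP[].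
have sub_ne0 (p q p' q' : R[i]) : p = p' -> q = q' -> p' - q' != 0 -> p - q != 0 by move=> -> ->.
have lt1_eq (p q : R[i]) : p = q -> cabs p < 1 -> cabs q < 1 by move=> ->.
have dich : (Ltr 1 (x + rate v) - Ltr 1 (x + rate (v * s))) / D != 0 ->
    cabs (Ltr 1 (w + rate z)) < 1 /\ cabs (Ltr 1 (theta + w + rate z')) < 1.
  move=> /fst_ne0 /(sub_ne0 _ _ _ _ (hgam v x hv hx) (hgam (v * s) x hvs hx)) ne; split.
    apply: (lt1_eq _ _ (hgam z w hz hw)); apply: (gamma_dichotomy hv hvs hx ne) => //.
    by apply: lz; exact: cabsM_le1.
  apply: (lt1_eq _ _ (hgam z' (theta + w) hz' hthw)); apply: (gamma_dichotomy hv hvs hx ne) => //.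
  by apply: lz; do 2?apply: cabsM_le1.
have [N1 HN1] := cabs_geometric_difference (Ltr 0 (w + rate z)) (Ltr 0 (theta + w + rate z')) dich e1.
pose f p := \sum_(k < K) s ^+ k * exit_part k p.
have mf : cmeas f.
  apply: (@cmeas_sum _ _ _ K (fun k p => s ^+ k * exit_part k p)) => k.
  by apply: cmeasM; [exact: cmeas_cst|exact: cmeas_exit_part].
have ic : (leb \x P)%E.-integrable setT (EFin \o (fun p : R * Omega => 2 * damping Th p.1)).
  by have := integrableZl measurableT 2 (integrable_damping_prod P htheta); apply: eq_integrable.
have bw n p : cabs (windows K n p) <= 2 * damping Th p.1.
  apply: (@le_trans _ _ (\sum_(k < K) cabs s ^+ k * damping Th p.1)).
    apply: cabs_sum_le => k; rewrite cabsM cabsX.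
    by apply: ler_wpM2l; [rewrite exprn_ge0 ?cabs_ge0|exact: cabs_exit_upto].
  rewrite -mulr_suml; apply: ler_wpM2r; first exact: damping_ge0.
  by apply: geometric_sum_le => //; exact: cabs_ge0.
have ev p : exists N, forall n, (N <= n)%N -> windows K n p = f p.
  rewrite /windows /f; elim: K {mf f bw} => [|K' [N0 IH]].
    by exists 0%N => n _; rewrite !big_ord0.
  have [N2 H2] := exit_upto_eventually K' p; exists (maxn N0 N2) => n; rewrite geq_max => /andP[n0 n2].
  by rewrite !big_ord_recr /= IH // H2.
have [N2 HN2] := @cI_cvg _ _ _ (leb \x P)%E (fun n => windows K n) f _ (cmeas_windows K) mf ic bw ev (e / 2) e20.
pose n := maxn N1 N2.
have {}HN1 := HN1 n (leq_maxl _ _); have {}HN2 := HN2 n (leq_maxr _ _).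
have ef : cintegral (leb \x P)%E setT f = \sum_(k < K) G1 P k.+1 A tau theta u v w x y * s ^+ k.
  have ik (k : 'I_K) : cintble (leb \x P)%E (exit_part k).
    exact: (cintble_damped_prod (cmeas_exit_part k) (cabs_exit_part k)).
  apply: (etrans (cI_sum (fun k : 'I_K => cintbleZ (s ^+ k) (ik k)))); apply: eq_bigr => k _.
  by apply: (etrans (cIZ (s ^+ k) (ik k))); rewrite G1E mulrC.
rewrite -ef.
have i1 : cintble (leb \x P)%E (windows K n).
  have H := @cintble_le _ _ _ (leb \x P)%E (windows K n) _ (cmeas_windows K n) ic; exact: H.
have i2 : cintble (leb \x P)%E (all_windows n).
  exact: (cintbleZ _ (@cintble_sum _ _ _ (leb \x P)%E n (fun m => term m) (fun m => cintble_term m))).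
have H3 : cabs (cintegral (leb \x P)%E setT (windows K n) - cintegral (leb \x P)%E setT (all_windows n)) <= 2 * cabs s ^+ K / Th.
  rewrite -(cIB i1 i2); apply: (@cI_damped_le (2 * cabs s ^+ K)).
  - exact: (cmeasB (cmeas_windows K n) (cmeas_all_windows n)).
  - by rewrite mulr_ge0 ?exprn_ge0 ?cabs_ge0.
  - by move=> p; exact: cabs_windows_tail.
have H4 : cabs (generating_function - cintegral (leb \x P)%E setT (all_windows n)) <= e / 2.
  rewrite cI_all_windows /generating_function -mulrBr cabsM cabsBC mulrC -ler_pdivlMr //.
exact: (cabs_triangle4 HN2 H3 H4).
Qed.

End GeneratingFunction.
End Functional.
End Exit.

(** * The functional as a coefficient *)

Theorem theorem3p1 (R : realType) (d : measure_display)
    (Omega : measurableType d) (P : probability Omega R)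
    (lambda : R) (T : nat -> {RV P >-> R}) (a : nat -> {RV P >-> nat})
    (tau : nat -> {RV P >-> R}) (M : nat) (theta u v w x y : R[i])
    (A := marked_process T a)
    (g := pgf P (a 1%N))
    (gamma0 := gamma_ P A tau 0)
    (gamma := gamma_ P A tau 1)
    (B1 := fun s : R[i] =>
      (gamma v x - gamma (v * s) x)
      / (theta + lambda%:C * g (u * v * s) - lambda%:C * g (u * v * y * s)))
    (B2 := fun s : R[i] =>
      gamma0 (u * v * s) w / (1 - gamma (u * v * s) w))
    (B3 := fun s : R[i] =>
      gamma0 (u * v * y * s) (theta + w)
      / (1 - gamma (u * v * y * s) (theta + w)))
    (hlambda : 0 < lambda)
    (hT : poisson_points P lambda T)
    (ha : position_independent_marking P T a)
    (htau : delayed_renewal P tau)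
    (hindep : independent_families P tau A)
    (hM : (0 < M)%N)
    (hu : `|u| <= 1) (hv : `|v| <= 1) (hy : `|y| <= 1)
    (hw : 0 <= complex.Re w) (hx : 0 <= complex.Re x)
    (htheta : 0 < complex.Re theta) :
  G1 P M A tau theta u v w x y
  = Dop (M%:Z - 1) (fun s => B1 s * (B2 s - B3 s)).
Proof.
have mT k : measurable_fun setT (T k : Omega -> R) by exact: measurable_funPT.
have ma k : measurable_fun setT (a k : Omega -> nat) by exact: measurable_funPT.
have mtau n : measurable_fun setT (tau n : Omega -> R) by exact: measurable_funPT.
have le1 (z : R[i]) : `|z| <= 1 -> cabs z <= 1 by rewrite cabsE -[1 in X in X -> _]/(1%:C) lecR.
move: hu hv hy => /le1 {}hu /le1 {}hv /le1 {}hy.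
case: M hM => // k _; rewrite -addn1 PoszD addrK addn1.
apply/esym; apply: (@Dop_power_expansion _ _ (fun j => G1 P j.+1 A tau theta u v w x y)).
pose Th := complex.Re theta; pose K := 1 + lambda / Th.
have lTh : 0 <= lambda / Th by rewrite divr_ge0 ?ltW.
have K1 : 1 <= K by rewrite /K lerDl.
have Th1 : 0 < Th^-1 by rewrite invr_gt0.
(* [K] is chosen so that [K |s| <= 1 / 4] implies both [|s| <= 1 / 4] and
   [lambda |s| <= Th / 4]; the latter keeps the real part of the divisor of [B1]
   positive, since that divisor differs from [theta] by at most
   [2 lambda |s|]. *)
exists (2 / Th), K; split.
- by rewrite divr_ge0 // ltW.
- exact: lt_le_trans K1.
- move=> j; have := cabs_G1_le mT ma mtau hT htau hu hv hy hw hx htheta j.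
  move=> /le_trans; apply; rewrite -/Th.
  have K1j : 1 <= K ^+ j by rewrite exprn_ege1.
  nra.
move=> s sK N.
have s0 := cabs_ge0 s.
have ls : lambda * cabs s <= Th / 4.
  have h : cabs s * (lambda / Th) <= 1 / 4 by move: sK; rewrite /K; nra.
  have -> : lambda * cabs s = cabs s * (lambda / Th) * Th by field; rewrite gt_eqF.
  by apply: (@le_trans _ _ (1 / 4 * Th)); [rewrite ler_pM2r|lra].
have s4 : cabs s <= 1 / 4 by move: sK; nra.
have hs : cabs s <= 1 / 2 by lra.
have hs1 : cabs s <= 1 by lra.
have hz : cabs (u * v * s) <= 1 by do 2?apply: cabsM_le1.
have hz' : cabs (u * v * y * s) <= 1 by do 3?apply: cabsM_le1.
have hvs : cabs (v * s) <= 1 by apply: cabsM_le1.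
have hthw : 0 <= complex.Re (theta + w) by rewrite Re_add addr_ge0 // ltW.
have hz_s : cabs (u * v * s) <= cabs s.
  by rewrite cabsM -[leRHS]mul1r ler_wpM2r //; exact: cabsM_le1.
have hz'_s : cabs (u * v * y * s) <= cabs s.
  by rewrite cabsM -[leRHS]mul1r ler_wpM2r //; do 2?apply: cabsM_le1.
have near0 := pgf_near0 P ma.
set z := u * v * s in hz hz_s *; set z' := u * v * y * s in hz' hz'_s *.
pose D := theta + mark_rate P lambda a z' - mark_rate P lambda a z.
have DE : theta + lambda%:C * pgf P (a 1%N) z - lambda%:C * pgf P (a 1%N) z' = D.
  have alg (t l p q : R[i]) : t + l * p - l * q = t + l * (1 - q) - l * (1 - p) by ring.
  exact: alg.
have via0 (p q r : R[i]) (b b' e : R) : cabs (p - r) <= b -> b <= e -> cabs (q - r) <= b' -> b' <= e ->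
    cabs (p - q) <= 2 * e.
  move=> h1 h2 h3 h4; have -> : p - q = (p - r) - (q - r) by ring.
  by clear -h1 h2 h3 h4; apply: (le_trans (cabsB _ _)); lra.
have hD : 0 < complex.Re D.
  have gz : cabs (pgf P (a 1%N) z - pgf P (a 1%N) z') <= 2 * cabs s.
    exact: (via0 _ _ _ _ _ _ (near0 _ hz) hz_s (near0 _ hz') hz'_s).
  rewrite -DE -addrA -mulrBr Re_add Re_mul /= mul0r subr0 -/Th.
  move: gz; set q := pgf _ _ _ - _ => gz.
  have := Re_le_cabs q; rewrite ler_norml => /andP[q1 _].
  have : lambda * - complex.Re q <= lambda * (2 * cabs s) by rewrite ler_pM2l //; lra.
  have : 0 < Th by [].
  lra.
have first0 := gamma_first mT ma mtau hT ha htau hlambda hindep.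
have next0 := gamma_next mT ma mtau hT ha htau hlambda hindep 0.
have tail := cabs_generating_function_tail mT ma mtau hT ha htau hlambda hindep
  hu hv hy hw hx htheta hs hD N.
have subst_all (c p1 p2 q q0 q1 r0 r1 p1' p2' q' q0' q1' r0' r1' : R[i]) :
    p1 = p1' -> p2 = p2' -> q = q' -> q0 = q0' -> q1 = q1' -> r0 = r0' -> r1 = r1' ->
    c * ((p1 - p2) / q * (q0 / (1 - q1) - r0 / (1 - r1))) =
    c * ((p1' - p2') / q' * (q0' / (1 - q1') - r0' / (1 - r1'))).
  by do 7?move=> ->.
have E := subst_all (1 - s)^-1 _ _ _ _ _ _ _ _ _ _ _ _ _ _ (next0 v x hv hx) (next0 _ x hvs hx) DE
  (first0 z w hz hw) (next0 z w hz hw) (first0 z' (theta + w) hz' hthw) (next0 z' (theta + w) hz' hthw).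
rewrite [X in cabs (X - _)]E.
apply: (le_trans tail); rewrite exprMn -/Th.
have K1N : 1 <= K ^+ N by rewrite exprn_ege1.
have sN : 0 <= cabs s ^+ N by rewrite exprn_ge0.
rewrite mulrAC [leRHS]mulrCA mulrC; apply: ler_peMl => //.
by rewrite mulr_ge0 // divr_ge0 // ltW.
Qed.
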